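(* Let $R>0$ and let $k\ge 0$ be real. Then the Dunkl transform $D_k$ is a bijection from $C_R^\infty(\mathbb{R})$ onto $\mathcal{H}_R(\mathbb{C})$.
   Context: For $k\ge 0$, the Dunkl operator $T_k$ acts on smooth (or holomorphic) functions by $T_kf(x)=f'(x)+k\,\frac{f(x)-f(-x)}{x}$, equivalently $T_kf(x)=f'(x)+k\int_{-1}^1 f'(tx)\,dt$ (which gives the value at $x=0$). For each $\lambda\in\mathbb{C}$ there is a unique holomorphic function $\psi_\lambda^k:\mathbb{C}\to\mathbb{C}$ with $T_k\psi_\lambda^k=i\lambda\psi_\lambda^k$ and $\psi_\lambda^k(0)=1$; the map $(z,\lambda)\mapsto\psi_\lambda^k(z)$ is entire on $\mathbb{C}^2$, and $\psi^k_\lambda$ is bounded on $\mathbb{R}$ for $\lambda\in\mathbb{R}$. Put $w_k(x)=|x|^{2k}$ and $c_k=\int_{\mathbb{R}}e^{-x^2/2}w_k(x)\,dx$. The Dunkl transform of $f\in L^1(\mathbb{R},w_k(x)dx)$ is $$D_kf(\lambda)=\frac{1}{c_k}\int_{\mathbb{R}}f(x)\,\psi_{-\lambda}^k(x)\,w_k(x)\,dx\qquad(\lambda\in\mathbb{R}).$$ If $f$ has compact support, the same formula defines $D_kf(\lambda)$ for all $\lambda\in\mathbb{C}$, and $D_kf$ is regarded as a function on $\mathbb{C}$ in this way. $C_R^\infty(\mathbb{R})$ is the space of smooth complex-valued functions on $\mathbb{R}$ with support in $[-R,R]$. $\mathcal{H}_R(\mathbb{C})$ is the space of entire functions $f$ such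 that for every integer $n\ge 0$ there is a constant $C_{n,f}>0$ with $|f(z)|\le C_{n,f}(1+|z|)^{-n}e^{R|\operatorname{Im}z|}$ for all $z\in\mathbb{C}$. *)

(* Defs.v *)
From HB Require Import structures.
From mathcomp Require Export all_boot all_order all_algebra.
From mathcomp Require Export complex.
From mathcomp Require Export all_classical all_reals all_analysis.

Set Implicit Arguments.
Unset Strict Implicit.
Unset Printing Implicit Defensive.

Export Order.TTheory GRing.Theory Num.Theory.
Export numFieldNormedType.Exports.
Global Open Scope classical_set_scope.
Global Open Scope ring_scope.
Global Open Scope complex_scope.

(* The topology on [R[i]] is the one given by its modulus and its scalars are
   [R[i]] itself, so [derivable f z 1] is complex differentiability at [z] and
   [derive1 f] is the complex derivative. *)
Definition entire (R : realType) (f : R[i] -> R[i]) : Prop :=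
  forall z : R[i], derivable (f : R[i]^o -> R[i]^o) z 1.

(* The difference quotient has a removable singularity at [0]; the value there
   comes from [T_k f x = f' x + k * \int_(-1)^1 f' (t x) dt]. *)
Definition dunkl_operator (R : realType) (k : R) (f : R[i] -> R[i])
    (z : R[i]) : R[i] :=
  let f' := derive1 (f : R[i] -> R[i]^o) in
  if z == 0 then f' 0 + (k * 2)%:C * f' 0
  else f' z + k%:C * ((f z - f (- z)) / z).

Definition is_dunkl_kernel (R : realType) (k : R) (lambda : R[i])
    (psi : R[i] -> R[i]) : Prop :=
  [/\ entire psi,
      forall z : R[i], dunkl_operator k psi z = 'i%C * lambda * psi z
    & psi 0 = 1].

(* The default value [cst 0] is never reached: for [0 <= k] there is exactly
   one function satisfying [is_dunkl_kernel k lambda]. *)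
Definition dunkl_kernel (R : realType) (k : R) (lambda : R[i]) :
    R[i] -> R[i] :=
  xget (cst 0) [set psi | is_dunkl_kernel k lambda psi].

Definition complex_integral (R : realType) (f : R -> R[i]) : R[i] :=
  (\int[@lebesgue_measure R]_x complex.Re (f x))%R
  +i* (\int[@lebesgue_measure R]_x complex.Im (f x))%R.

(* [0 `^ 0 = 1], so [dunkl_weight 0] is constantly [1]. *)
Definition dunkl_weight (R : realType) (k x : R) : R := `|x| `^ (2 * k).

Definition dunkl_constant (R : realType) (k : R) : R :=
  (\int[@lebesgue_measure R]_x
     (expR (- (x ^+ 2 / 2)) * dunkl_weight k x))%R.

Definition dunkl_transform (R : realType) (k : R) (f : R -> R[i])
    (lambda : R[i]) : R[i] :=
  ((dunkl_constant k)^-1)%:C *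
  complex_integral
    (fun x : R => f x * dunkl_kernel k (- lambda) x%:C * (dunkl_weight k x)%:C).

Definition smooth (R : realType) (f : R -> R[i]) : Prop :=
  forall (n : nat) (x : R),
    derivable (derive1n n (fun y : R => complex.Re (f y))) x 1 /\
    derivable (derive1n n (fun y : R => complex.Im (f y))) x 1.

Definition smooth_supported (R : realType) (r : R) : set (R -> R[i]) :=
  [set f | smooth f /\ closure [set x : R | f x != 0] `<=` `[- r, r]].

Definition paley_wiener_space (R : realType) (r : R) : set (R[i] -> R[i]) :=
  [set f | entire f /\
    forall n : nat, exists2 C : R, 0 < C & forall z : R[i],
      Normc.normc (f z) <=
        C * (1 + Normc.normc z) ^- n * expR (r * `|complex.Im z|)].

(* Main.v *)
(* The kernel is the power series with coefficients [(i lambda)^n / gam k n],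
   so the Taylor coefficients at [0] of [D_k f] are, up to nonzero constants,
   the moments of [f] against [|x|^(2k)]. These moments determine [f], whence
   injectivity. An energy estimate for the Dunkl equation gives
   [|psi_(-lambda)(x)| <= sqrt 2 * exp (|Im lambda| |x|)], and
   [D_k (T_k f) (lambda) = i lambda D_k f (lambda)] supplies the polynomial
   decay, so [D_k] maps into the Paley-Wiener space.

   For surjectivity let [F] be in the Paley-Wiener space. When [k = 0], shifting
   the contour of the inverse Fourier integral shows that it is supported in
   [[-r, r]]. For general [k], it suffices to transform the resulting [f] into
   [g], smooth and supported in [[-r, r]], whose [k]-moments are those of [f]
   times the ratios that make the Taylor coefficients of [D_k g] and [D_0 f]
   equal. Write [f = p + x q] with [p] and [q] even; on even functions
   [g |-> g' / x] and the Weyl transform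
   [g |-> \int |t|^e g (sqrt (x^2 + t^2)) dt] shift the exponent of the weight
   in the moments by [-2] and by [e + 1] up to explicit constants, so that
   enough applications of the former followed by one of the latter give [g]. *)

(* The Dunkl operator is nonlocal: the equation at [x] involves the value at [- x], so the two
   values have to be estimated together through one energy. Moments are the common language of the
   rest. Multiplication by [i lambda], the passage from [0] to [k] and injectivity become statements
   about sequences of numbers, and integral transforms enter only through their effect on powers of
   the variable. The map from [f] to [g] is a derivative of fractional order [k] in the variable
   [u = x^2]. It is realised as [N] differentiations followed by a fractional integral of order
   [N - k], with [N > k + 1] so that the weight of that integral is continuous. The integral reads
   its argument only at points [sqrt (x^2 + t^2) >= |x|], hence the support does not grow. For
   [k = 0] the inversion formula is wanted at complex [lambda]. Moving the line of integration to
   height [Im lambda] cancels the real exponential of the kernel, and a translation by [Re lambda]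
   then reduces the formula to cosine inversion at the single point [0], obtained by Abel
   summation. *)
Require Import Defs.
From mathcomp Require Import measurable_realfun ring lra.

Set Implicit Arguments.
Unset Strict Implicit.
Unset Printing Implicit Defensive.

Local Notation normc := Normc.normc.
Local Notation Re := complex.Re.
Local Notation Im := complex.Im.

(** * Complex power series *)

Section ComplexNorm.
Context {R : realType}.
Implicit Types (z w : R[i]) (x y : R).

Lemma normr_normc z : `|z| = (normc z)%:C.
Proof. by []. Qed.

Lemma normc_ge0 z : 0 <= normc z.
Proof. by case: z => a b; exact: sqrtr_ge0. Qed.

Lemma normc_real x : normc x%:C = `|x|.
Proof. by rewrite /= expr0n /= addr0 sqrtr_sqr. Qed.

Lemma normcX z n : normc (z ^+ n) = normc z ^+ n.
Proof.
by elim: n => [|n IH]; rewrite ?expr0 ?Normc.normc1// !exprS Normc.normcM IH.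
Qed.

Lemma normcB z w : normc (z - w) = normc (w - z).
Proof. by rewrite -normcN opprB. Qed.

Lemma sqr_normc_ReIm z : normc z ^+ 2 = Re z ^+ 2 + Im z ^+ 2.
Proof. by case: z => a b /=; rewrite sqr_sqrtr// addr_ge0// sqr_ge0. Qed.

Lemma abs_Re_le_normc z : `|Re z| <= normc z.
Proof.
rewrite -(ler_pXn2r (n := 2))// ?nnegrE ?normc_ge0//.
by rewrite sqr_normc_ReIm real_normK ?num_real// lerDl sqr_ge0.
Qed.

Lemma abs_Im_le_normc z : `|Im z| <= normc z.
Proof.
rewrite -(ler_pXn2r (n := 2))// ?nnegrE ?normc_ge0//.
by rewrite sqr_normc_ReIm real_normK ?num_real// lerDr sqr_ge0.
Qed.

Lemma normc_le_ReIm z : normc z <= `|Re z| + `|Im z|.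
Proof.
rewrite -(ler_pXn2r (n := 2))// ?nnegrE ?normc_ge0 ?addr_ge0//.
rewrite sqr_normc_ReIm sqrrD !real_normK ?num_real//.
by rewrite -addrA [X in _ <= _ + X]addrC addrA lerDl mulrn_wge0// mulr_ge0.
Qed.

Lemma normc_sum (I : Type) (r : seq I) (P : pred I) (f : I -> R[i]) :
  normc (\sum_(i <- r | P i) f i) <= \sum_(i <- r | P i) normc (f i).
Proof.
elim/big_ind2 : _ => [|z1 x1 z2 x2 h1 h2|//]; first by rewrite Normc.normc0.
exact: le_trans (le_normcD _ _) (lerD h1 h2).
Qed.

Lemma ReD z w : Re (z + w) = Re z + Re w. Proof. by case: z w => ? ? []. Qed.
Lemma ImD z w : Im (z + w) = Im z + Im w. Proof. by case: z w => ? ? []. Qed.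
Lemma ReN z : Re (- z) = - Re z. Proof. by case: z. Qed.
Lemma ImN z : Im (- z) = - Im z. Proof. by case: z. Qed.
Lemma ReM z w : Re (z * w) = Re z * Re w - Im z * Im w.
Proof. by case: z w => ? ? []. Qed.
Lemma ImM z w : Im (z * w) = Re z * Im w + Im z * Re w.
Proof. by case: z w => ? ? []. Qed.
Lemma ReMr z x : Re (z * x%:C) = Re z * x.
Proof. by case: z => a b /=; rewrite mulr0 subr0. Qed.
Lemma ImMr z x : Im (z * x%:C) = Im z * x.
Proof. by case: z => a b /=; rewrite mulr0 add0r. Qed.
Lemma ReMl z x : Re (x%:C * z) = x * Re z.
Proof. by rewrite mulrC ReMr mulrC. Qed.
Lemma ImMl z x : Im (x%:C * z) = x * Im z.
Proof. by rewrite mulrC ImMr mulrC. Qed.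
Lemma eq_Complex (a b c d : R) : a = c -> b = d -> a +i* b = c +i* d.
Proof. by move=> -> ->. Qed.

Lemma complex_eq z w : Re z = Re w -> Im z = Im w -> z = w.
Proof. by case: z w => ? ? [? ?] /= -> ->. Qed.

Lemma Re_sum (I : Type) (r : seq I) (P : pred I) (f : I -> R[i]) :
  Re (\sum_(i <- r | P i) f i) = \sum_(i <- r | P i) Re (f i).
Proof. by rewrite (big_morph _ ReD (id1 := 0)). Qed.

Lemma Im_sum (I : Type) (r : seq I) (P : pred I) (f : I -> R[i]) :
  Im (\sum_(i <- r | P i) f i) = \sum_(i <- r | P i) Im (f i).
Proof. by rewrite (big_morph _ ImD (id1 := 0)). Qed.

End ComplexNorm.

Section ComplexSeries.
Context {R : realType}.
Implicit Types (u v : nat -> R[i]) (s t : R[i]).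

(** Convergence is stated through the real-valued modulus, so that all limits are taken in [R]. *)
Definition csums u s :=
  (fun n => normc (\sum_(i < n) u i - s)) @ \oo --> (0 : R).

Lemma csumsP u s : csums u s <->
  forall e : R, 0 < e -> \forall n \near \oo, normc (\sum_(i < n) u i - s) <= e.
Proof.
split=> [/cvgrPdist_le h e e0|h].
  apply: filterS (h e e0) => n.
  by rewrite sub0r normrN ger0_norm// normc_ge0.
apply/cvgrPdist_le => e e0; apply: filterS (h e e0) => n.
by rewrite sub0r normrN ger0_norm// normc_ge0.
Qed.

Lemma csums_unique u s t : csums u s -> csums u t -> s = t.
Proof.
move=> /csumsP hs /csumsP ht; apply/eqP; rewrite -subr_eq0; apply/eqP.
apply: Normc.eq0_normc; apply/eqP; rewrite eq_le normc_ge0 andbT.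
apply/ler_addgt0Pr => e e0; rewrite add0r.
have e2 : 0 < e / 2 by rewrite divr_gt0.
near \oo => n.
have h1 : normc (\sum_(i < n) u i - s) <= e / 2 by near: n; exact: hs.
have h2 : normc (\sum_(i < n) u i - t) <= e / 2 by near: n; exact: ht.
rewrite [e]splitr; apply: le_trans (lerD h1 h2).
rewrite (normcB _ s); apply: le_trans (le_normcD _ _).
by rewrite addrA subrK.
Unshelve. all: by end_near. Qed.

Lemma csumsD u v s t : csums u s -> csums v t ->
  csums (fun n => u n + v n) (s + t).
Proof.
move=> /csumsP hs /csumsP ht; apply/csumsP => e e0.
have e2 : 0 < e / 2 by rewrite divr_gt0.
near=> n.
have h1 : normc (\sum_(i < n) u i - s) <= e / 2 by near: n; exact: hs.
have h2 : normc (\sum_(i < n) v i - t) <= e / 2 by near: n; exact: ht.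
rewrite [e]splitr; apply: le_trans (lerD h1 h2).
by rewrite big_split /= opprD addrACA le_normcD.
Unshelve. all: by end_near. Qed.

Lemma csumsZ (c : R[i]) u s : csums u s -> csums (fun n => c * u n) (c * s).
Proof.
rewrite /csums => hs.
have -> : (fun n => normc (\sum_(i < n) c * u i - c * s)) =
  (fun n => normc c * normc (\sum_(i < n) u i - s)).
  by apply/funext => n; rewrite -mulr_sumr -mulrBr Normc.normcM.
by rewrite -[X in _ --> X](mulr0 (normc c)); apply: cvgM => //; exact: cvg_cst.
Qed.

Lemma csumsN u s : csums u s -> csums (fun n => - u n) (- s).
Proof.
move=> h; have := csumsZ (-1) h; rewrite mulN1r.
by under [X in csums X _]funext do rewrite mulN1r.
Qed.

Lemma csumsS u s : csums u s <-> csums (fun n => u n.+1) (s - u 0).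
Proof.
have E n : \sum_(i < n) u i.+1 - (s - u 0) = \sum_(i < n.+1) u i - s.
  by rewrite big_ord_recl /=; ring.
rewrite /csums; under [X in _ <-> X @ _ --> _]funext do rewrite E.
by rewrite -(cvg_shiftS (fun n => normc (\sum_(i < n) u i - s))); split.
Qed.

Lemma csums_le u s (B : R) :
  (\forall n \near \oo, normc (\sum_(i < n) u i) <= B) -> csums u s ->
  normc s <= B.
Proof.
move=> hB /csumsP hs; apply/ler_addgt0Pr => e e0.
near \oo => n.
have h1 : normc (\sum_(i < n) u i - s) <= e by near: n; exact: hs.
have h2 : normc (\sum_(i < n) u i) <= B by near: n.
apply: le_trans (lerD h2 h1); rewrite (normcB _ s).
by apply: le_trans (le_normcD _ _); rewrite addrC subrK.
Unshelve. all: by end_near. Qed.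

Lemma sum_geom2_le (C : R) (m n : nat) : 0 <= C ->
  \sum_(m <= i < n) C * 2^-1 ^+ i <= 2 * C * 2^-1 ^+ m.
Proof.
move=> C0; have [nm|mn] := leqP n m.
  by rewrite big_geq// !mulr_ge0// exprn_ge0// invr_ge0.
suff -> : \sum_(m <= i < n) C * 2^-1 ^+ i =
    2 * C * 2^-1 ^+ m - 2 * C * 2^-1 ^+ n.
  by rewrite gerBl !mulr_ge0// exprn_ge0// invr_ge0.
elim: n mn => // n IH; rewrite ltnS leq_eqVlt => /orP[/eqP->|mn].
  by rewrite big_nat1 exprS; field.
by rewrite big_nat_recr 1?ltnW//= IH// exprS; field.
Qed.

Lemma csums_geom_tail u s (C : R) : (forall n, normc (u n) <= C * 2^-1 ^+ n) ->
  csums u s ->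
  forall N, normc (s - \sum_(i < N) u i) <= 2 * C * 2^-1 ^+ N.
Proof.
move=> hu /csumsP hs N.
have C0 : 0 <= C by have := hu 0%N; rewrite expr0 mulr1; apply: le_trans (normc_ge0 _).
apply/ler_addgt0Pr => e e0.
near \oo => n.
have h1 : normc (\sum_(i < n) u i - s) <= e by near: n; exact: hs.
have Nn : (N <= n)%N by near: n; exact: nbhs_infty_ge.
have E : \sum_(i < n) u i = \sum_(i < N) u i + \sum_(N <= i < n) u i.
  by rewrite -!(big_mkord xpredT) -big_cat_nat.
have -> : s - \sum_(i < N) u i =
    \sum_(N <= i < n) u i - (\sum_(i < n) u i - s) by rewrite E; ring.
apply: le_trans (le_normcD _ _) _; rewrite normcN; apply: lerD h1.
apply: le_trans (normc_sum _ _ _) _.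
apply: le_trans (sum_geom2_le _ _ C0).
exact: ler_sum.
Unshelve. all: by end_near. Qed.

Lemma csums_geom u (C : R) : (forall n, normc (u n) <= C * 2^-1 ^+ n) ->
  exists s, csums u s.
Proof.
move=> hu.
have H (f : R[i] -> R) : (forall z, `|f z| <= normc z) ->
    cvgn (series (fun n => f (u n))).
  move=> hf; apply: normed_cvg.
  apply: (@series_le_cvg _ _ (geometric C 2^-1)) => [n|n|n|].
  - by rewrite normr_ge0.
  - by apply: le_trans (hu n); exact: normc_ge0.
  - exact: le_trans (hf _) (hu n).
  - by apply: is_cvg_geometric_series; rewrite ger0_norm ?invr_ge0// invf_lt1// ltr1n.
have /cvg_ex[a ha] := H _ abs_Re_le_normc.
have /cvg_ex[b hb] := H _ abs_Im_le_normc.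
exists (a +i* b); apply/csumsP => e e0.
have e2 : 0 < e / 2 by rewrite divr_gt0.
move/cvgrPdist_le : ha => /(_ _ e2) ha; move/cvgrPdist_le : hb => /(_ _ e2) hb.
near=> n.
apply: le_trans (normc_le_ReIm _) _; rewrite [e]splitr ReD ImD ReN ImN /=.
rewrite Re_sum Im_sum -(big_mkord xpredT (fun i => Re (u i))) -(big_mkord xpredT (fun i => Im
  (u i))).
apply: lerD; rewrite distrC; near: n; [exact: ha|exact: hb].
Unshelve. all: by end_near. Qed.

End ComplexSeries.

Section PowerSeries.
Context {R : realType}.
Implicit Types (a : nat -> R[i]) (z h : R[i]).

Lemma normc_nat n : normc (n%:R : R[i]) = n%:R.
Proof. by rewrite -(rmorph_nat (real_complex R)) normc_real normr_nat. Qed.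

Lemma is_derive_quadratic (f : R[i] -> R[i]) z (d : R[i]) (K : R) :
  (forall h, normc h <= 1 -> normc (f (z + h) - f z - h * d) <= K * normc h ^+ 2) ->
  is_derive (z : R[i]^o) (1 : R[i]^o) (f : R[i]^o -> R[i]^o) (d : R[i]^o).
Proof.
move=> hK.
have K0 : 0 <= K.
  have := hK 1; rewrite Normc.normc1 lexx expr1n mulr1 => /(_ isT).
  by apply: le_trans; exact: normc_ge0.
suff H : (fun h : R[i]^o => h^-1 *: (((f : R[i]^o -> R[i]^o) \o shift (z : R[i]^o)) (h *: (1
  : R[i]^o)) - f z))
    h @[h --> (0 : R[i]^o)^'] --> (d : R[i]^o).
  apply: DeriveDef; first by apply/cvg_ex; exists d.
  exact: cvg_lim H.
(* The radius [e] lives in [R[i]]; being positive there forces [Im e = 0], so [Re e] can take its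
   place. *)
apply/cvgrPdist_le => e; rewrite ltcE /= => /andP[/eqP Ie e0].
near=> h.
have h0 : h != 0 by near: h; exact: nbhs_dnbhs_neq.
have h1 : normc h <= 1.
  rewrite -lecR -normr_normc; near: h; exact: dnbhs0_le.
have h2 : normc h <= Re e / (K + 1).
  rewrite -lecR -normr_normc; near: h; apply: dnbhs0_le.
  by rewrite ltcR divr_gt0// ltr_wpDl.
have hp : 0 < normc h.
  rewrite lt_neqAle normc_ge0 andbT eq_sym; apply/eqP => /Normc.eq0_normc.
  by apply/eqP.
rewrite /= /GRing.scale /= mulr1 (addrC h z).
have -> : d - h^-1 * (f (z + h) - f z) = - (h^-1 * (f (z + h) - f z - h * d)).
  by field.
have -> : e = (Re e)%:C by rewrite {1}(complexE e) Ie mulr0 addr0.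
rewrite normr_normc lecR normcN Normc.normcM Normc.normcV ler_pdivrMl//.
apply: le_trans (hK _ h1) _.
rewrite expr2 mulrA mulrC ler_wpM2l ?normc_ge0//.
rewrite mulrC; apply: le_trans (_ : (K + 1) * normc h <= _).
  by rewrite mulrC ler_wpM2r ?normc_ge0// lerDl.
by rewrite mulrC -ler_pdivlMr// ltr_wpDl.
Unshelve. all: by end_near. Qed.

(** Infinite radius of convergence. Boundedness at [2 * rho] yields geometric decay with ratio
    [1 / 2] at [rho], the form in which it is used. *)
Definition entire_coef a :=
  forall rho : R, 0 <= rho -> exists C : R, forall n, normc (a n) * rho ^+ n <= C.

Definition pser a z := xget 0 [set s | csums (fun n => a n * z ^+ n) s].

Lemma entire_coef_geom a (rho : R) : entire_coef a -> 0 <= rho ->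
  exists C : R, forall n, normc (a n) * rho ^+ n <= C * 2^-1 ^+ n.
Proof.
move=> ha rho0; have [|C hC] := ha (2 * rho); first by rewrite mulr_ge0.
exists C => n; rewrite exprVn ler_pdivlMr ?exprn_gt0// -mulrA -exprMn.
by rewrite (mulrC rho).
Qed.

Lemma pserP a z : entire_coef a -> csums (fun n => a n * z ^+ n) (pser a z).
Proof.
move=> ha; have [C hC] := entire_coef_geom ha (normc_ge0 z).
have [|s hs] := @csums_geom R (fun n => a n * z ^+ n) C.
  by move=> n; rewrite Normc.normcM normcX.
by apply: (@xgetPex _ 0 [set s | csums (fun n => a n * z ^+ n) s]); exists s.
Qed.

Lemma pser_tail a (rho : R) : entire_coef a -> 0 <= rho ->
  exists C : R, forall z N, normc z <= rho ->
    normc (pser a z - \sum_(i < N) a i * z ^+ i) <= C * 2^-1 ^+ N.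
Proof.
move=> ha rho0; have [C hC] := entire_coef_geom ha rho0.
exists (2 * C) => z N zr; apply: csums_geom_tail (pserP z ha) N.
move=> n; apply: le_trans (hC n).
by rewrite Normc.normcM normcX ler_wpM2l ?normc_ge0// lerXn2r ?nnegrE ?normc_ge0.
Qed.

(** The factor [n.+1] is absorbed by [2 ^ n.+1], and [rho + 1 >= 1] pays for the shift of the
    exponent; hence the radius [2 * (rho + 1)]. *)
Lemma entire_coef_deriv a : entire_coef a ->
  entire_coef (fun n => n.+1%:R * a n.+1).
Proof.
move=> ha rho rho0; have [|C hC] := ha (2 * (rho + 1)).
  by rewrite mulr_ge0// addr_ge0.
exists C => n; apply: le_trans (hC n.+1).
rewrite Normc.normcM normc_nat mulrAC mulrC ler_wpM2l ?normc_ge0//.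
rewrite exprMn; apply: ler_pM => //; first by rewrite exprn_ge0.
  by rewrite -natrX ler_nat ltnW// ltn_expl.
rewrite exprS; apply: le_trans (_ : (rho + 1) ^+ n <= _).
  by rewrite lerXn2r ?nnegrE ?addr_ge0// lerDl.
by rewrite ler_peMl ?exprn_ge0 ?addr_ge0// lerDr.
Qed.

(** Induction on [n]: the remainder of order [n.+1] is [z + h] times the previous one plus
    [h ^ 2 * (n * z ^ n.-1)]. The base [3 * rho] absorbs both the coefficient [n <= 3 ^ n] and the
    sum of the two resulting terms. *)
Lemma pow_taylor1 z h n (rho : R) : normc h <= 1 -> normc z + 1 <= rho ->
  normc ((z + h) ^+ n - z ^+ n - h * (n%:R * z ^+ n.-1)) <=
    normc h ^+ 2 * (3 * rho) ^+ n.
Proof.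
move=> h1 zr.
have r1 : 1 <= rho by apply: le_trans zr; rewrite lerDr normc_ge0.
have r0 : 0 <= rho by apply: le_trans r1.
elim: n => [|n IH].
  by rewrite !expr0 subrr mul0r mulr0 subr0 Normc.normc0 mulr1 sqr_ge0.
have -> : (z + h) ^+ n.+1 - z ^+ n.+1 - h * (n.+1%:R * z ^+ n.+1.-1) =
  (z + h) * ((z + h) ^+ n - z ^+ n - h * (n%:R * z ^+ n.-1)) +
  h ^+ 2 * (n%:R * z ^+ n.-1).
  rewrite !exprS /=; case: n {IH} => [|n]; first by rewrite !expr0 /=; ring.
  by rewrite /= !exprS -!natr1; ring.
have zh : normc (z + h) <= rho.
  apply: le_trans zr; apply: le_trans (le_normcD _ _) _.
  by rewrite lerD2l.
have zn : normc (n%:R * z ^+ n.-1) <= 3 ^+ n * rho ^+ n.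
  rewrite Normc.normcM normc_nat normcX; apply: ler_pM => //.
  - by rewrite exprn_ge0 ?normc_ge0.
  - by rewrite -natrX ler_nat ltnW// ltn_expl.
  - apply: le_trans (_ : rho ^+ n.-1 <= _).
      rewrite lerXn2r ?nnegrE ?normc_ge0//.
      by apply: le_trans zr; rewrite lerDl.
    by rewrite ler_weXn2l// leq_pred.
apply: le_trans (le_normcD _ _) _.
rewrite (Normc.normcM (z + h)) (Normc.normcM (h ^+ 2)) normcX.
have /(ler_pM (normc_ge0 _) (normc_ge0 _) zh) := IH => {}IH.
have zn' : normc h ^+ 2 * normc (n%:R * z ^+ n.-1) <=
     normc h ^+ 2 * (rho * (3 * rho) ^+ n).
  rewrite ler_wpM2l ?sqr_ge0//; apply: le_trans zn _.
  by rewrite -exprMn ler_peMl// exprn_ge0// mulr_ge0.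
apply: le_trans (lerD IH zn') _.
rewrite [X in _ <= _ * X]exprS.
have := mulr_ge0 (sqr_ge0 (normc h)) (mulr_ge0 r0 (exprn_ge0 n (mulr_ge0 (ler0n R 3) r0))).
set A := normc h; set B := (3 * rho) ^+ n; nra.
Qed.

Lemma pser_taylor1 a z : entire_coef a ->
  exists K : R, forall h, normc h <= 1 ->
    normc (pser a (z + h) - pser a z - h * pser (fun n => n.+1%:R * a n.+1) z)
      <= K * normc h ^+ 2.
Proof.
move=> ha; pose rho := normc z + 1.
have r0 : 0 <= 3 * rho by rewrite mulr_ge0// addr_ge0// normc_ge0.
have [C hC] := entire_coef_geom ha r0.
have C0 : 0 <= C.
  by have := hC 0%N; rewrite !expr0 !mulr1; apply: le_trans; exact: normc_ge0.
exists (2 * C) => h h1.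
(* The derived series indexed like the original one; its term at [0] vanishes because of the factor
   [n], whatever [0.-1] is. *)
pose v n := n%:R * a n * z ^+ n.-1.
have hv : csums v (pser (fun n => n.+1%:R * a n.+1) z).
  by apply/csumsS; rewrite /v /= !mul0r subr0; exact/pserP/entire_coef_deriv.
have := csumsD (csumsD (pserP (z + h) ha) (csumsN (pserP z ha)))
               (csumsN (csumsZ h hv)).
apply: csums_le; apply: nearW => n.
apply: le_trans (normc_sum _ _ _) _.
apply: le_trans (_ : \sum_(i < n) normc h ^+ 2 * (C * 2^-1 ^+ i) <= _).
  apply: ler_sum => i _.
  have -> : a i * (z + h) ^+ i - a i * z ^+ i - h * v i =
    a i * ((z + h) ^+ i - z ^+ i - h * (i%:R * z ^+ i.-1)) by rewrite /v; ring.
  rewrite Normc.normcM; have := pow_taylor1 i h1 (lexx rho).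
  move=> /(ler_wpM2l (normc_ge0 (a i))) /le_trans; apply.
  by rewrite mulrCA ler_wpM2l// sqr_ge0.
rewrite -mulr_sumr mulrC ler_wpM2r ?sqr_ge0//.
rewrite -(big_mkord xpredT (fun i => C * 2^-1 ^+ i)).
by apply: le_trans (sum_geom2_le _ _ C0) _; rewrite expr0 mulr1.
Qed.

Lemma is_derive_pser a z : entire_coef a ->
  is_derive (z : R[i]^o) (1 : R[i]^o) (pser a : R[i]^o -> R[i]^o)
    (pser (fun n => n.+1%:R * a n.+1) z : R[i]^o).
Proof. by move=> /(pser_taylor1 z)[K hK]; exact: is_derive_quadratic hK. Qed.

Lemma entire_pser a : entire_coef a -> entire (pser a).
Proof. by move=> /is_derive_pser ha z; case: (ha z). Qed.

Lemma pser0 a : entire_coef a -> pser a 0 = a 0%N.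
Proof.
move=> ha; apply: csums_unique (pserP 0 ha) _.
apply/csumsP => e e0; near=> n.
have n0 : (0 < n)%N by near: n; exact: nbhs_infty_gt.
rewrite -(prednK n0) big_ord_recl /= expr0 mulr1 big1 ?addr0 ?subrr.
  by rewrite Normc.normc0 ltW.
by move=> i _; rewrite /bump /= expr0n /= mulr0.
Unshelve. all: by end_near. Qed.

(** Induction through the derivative, which vanishes as well and whose coefficient of index [n] is
    [n.+1 * a n.+1]. *)
Lemma pser_eq0 a : entire_coef a -> (forall z, pser a z = 0) -> forall n, a n = 0.
Proof.
move=> ha h0 n; elim: n a ha h0 => [|n IH] a ha h0.
  by rewrite -(pser0 ha) h0.
suff /eqP : n.+1%:R * a n.+1 = 0 by rewrite mulf_eq0 pnatr_eq0 => /eqP.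
apply: (IH _ (entire_coef_deriv ha)) => z.
have [_ dz] := is_derive_pser z ha; rewrite -dz.
by rewrite (_ : pser a = cst 0) ?derive_cst//; apply/funext.
Qed.

End PowerSeries.

(** * The Dunkl kernel *)

Section RealDerivatives.
Context {R : realType}.
Implicit Types (f g : R -> R) (x a b : R).

Lemma is_derive_eqr f x a b : is_derive x 1 f a -> a = b -> is_derive x 1 f b.
Proof. by move=> h <-. Qed.

Lemma is_derive_addf f g x a b : is_derive x 1 f a -> is_derive x 1 g b ->
  is_derive x 1 (fun t => f t + g t) (a + b).
Proof. by move=> fa gb; exact: is_deriveD. Qed.

Lemma is_derive_subf f g x a b : is_derive x 1 f a -> is_derive x 1 g b ->
  is_derive x 1 (fun t => f t - g t) (a - b).
Proof. by move=> fa gb; exact: is_deriveB. Qed.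

Lemma is_derive_mulf f g x a b : is_derive x 1 f a -> is_derive x 1 g b ->
  is_derive x 1 (fun t => f t * g t) (a * g x + f x * b).
Proof.
move=> fa gb; have := is_deriveM fa gb; move/is_derive_eqr; apply.
by rewrite /GRing.scale /= addrC mulrC.
Qed.

Lemma is_derive_scalef (c : R) f x a : is_derive x 1 f a ->
  is_derive x 1 (fun t => c * f t) (c * a).
Proof. by move=> fa; exact: is_deriveZ. Qed.

Lemma is_derive_idf x : is_derive x 1 (fun t : R => t) 1.
Proof. exact: is_derive_id. Qed.

Lemma is_derive_cstf (c : R) x : is_derive x 1 (fun _ : R => c) 0.
Proof. exact: is_derive_cst. Qed.

Lemma is_derive_compf f g x a b : is_derive (g x) 1 f a -> is_derive x 1 g b ->
  is_derive x 1 (fun t => f (g t)) (a * b).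
Proof. by move=> fa gb; exact: is_derive1_comp. Qed.

Lemma is_derive_Nf f x a : is_derive (- x) 1 f a ->
  is_derive x 1 (fun t => f (- t)) (- a).
Proof.
move=> fa; have := is_derive_compf fa (is_deriveNid x 1).
by rewrite mulrN1.
Qed.

Lemma is_derive_continuous f x a : is_derive x 1 f a -> {for x, continuous f}.
Proof. by case=> df _; exact/differentiable_continuous/derivable1_diffP. Qed.

Lemma is_derive_near f g x a : (\forall y \near x, f y = g y) ->
  is_derive x 1 f a -> is_derive x 1 g a.
Proof.
move=> fg [df dv]; apply: DeriveDef.
  exact: near_eq_derivable fg df.
by rewrite -dv; apply: near_eq_derive => //; rewrite ?oner_eq0//; apply: filterS fg.
Qed.

End RealDerivatives.

Section DunklKernel.
Context {R : realType}.
Implicit Types (k : R) (lambda : R[i]) (y : R -> R[i]).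

Definition cderiv y y' := forall x : R,
  is_derive x 1 (fun t => Re (y t)) (Re (y' x)) /\
  is_derive x 1 (fun t => Im (y t)) (Im (y' x)).

Lemma cderiv_entire (f : R[i] -> R[i]) : entire f ->
  cderiv (fun x => f x%:C) (fun x => derive1 (f : R[i] -> R[i]^o) x%:C).
Proof.
move=> ef x.
have H : (fun h : R[i]^o => h^-1 *: (((f : R[i]^o -> R[i]^o) \o shift (x%:C : R[i]^o)) (h *:
  (1 : R[i]^o)) - f x%:C))
    h @[h --> (0 : R[i]^o)^'] --> (derive1 (f : R[i] -> R[i]^o) x%:C : R[i]^o).
  by rewrite derive1E; exact: (ef x%:C).
have H2 : forall e : R, 0 < e -> \forall h \near (0 : R)^',
    normc (derive1 (f : R[i] -> R[i]^o) x%:C - (h^-1)%:C * (f (h + x)%:C - f x%:C)) <= e.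
  move=> e e0; move/cvgrPdist_le : H => /(_ e%:C).
  rewrite ltcR => /(_ e0)/nbhs_ballP[d] /=.
  rewrite ltcE /= => /andP[/eqP Id d0] hd.
  apply/nbhs_ballP; exists (Re d) => //= h; rewrite /ball /= => hb hn.
  have := hd h%:C; rewrite /ball /= sub0r normrN normr_normc.
  have -> : d = (Re d)%:C by rewrite {1}(complexE d) Id mulr0 addr0.
  rewrite ltcR normc_real.
  rewrite sub0r normrN in hb => /(_ hb).
  have -> : h%:C != 0 by apply: contra_neq hn => -[].
  move=> /(_ isT); rewrite normr_normc lecR /= /GRing.scale /= mulr1 => h1.
  by rewrite fmorphV rmorphD.
(* [p] stands for [Re] or [Im]: a real-linear functional of norm at most [1] carries the complex
   difference quotient, taken along real increments, to the real one. *)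
have G (p : R[i] -> R) : (forall z, `|p z| <= normc z) -> {morph p : z w / z - w} ->
   (forall z (t : R), p (t%:C * z) = t * p z) ->
   is_derive x 1 (fun t : R => p (f t%:C)) (p (derive1 (f : R[i] -> R[i]^o) x%:C)).
  move=> p1 p2 p3.
  suff K : (fun h : R => h^-1 *: (((fun t : R => p (f t%:C)) \o shift x) (h *: 1) - p (f x%:C)))
     h @[h --> 0^'] --> p (derive1 (f : R[i] -> R[i]^o) x%:C).
    apply: DeriveDef; first by apply/cvg_ex; eexists; exact: K.
    exact: cvg_lim K.
  apply/cvgrPdist_le => e e0; near=> h.
  rewrite /= /GRing.scale /= mulr1 -p2 -p3 -p2.
  by apply: le_trans (p1 _) _; near: h; exact: H2.
split; apply: G.
- exact: abs_Re_le_normc.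
- by move=> z w; rewrite ReD ReN.
- by move=> z t; rewrite ReMl.
- exact: abs_Im_le_normc.
- by move=> z w; rewrite ImD ImN.
- by move=> z t; rewrite ImMl.
Unshelve. all: by end_near. Qed.

Definition dunkl_solution k lambda y := exists2 y', cderiv y y' &
  forall x : R, x != 0 ->
    y' x + k%:C * ((y x - y (- x)) / x%:C) = 'i%C * lambda * y x.

Lemma is_dunkl_kernel_solution k lambda (psi : R[i] -> R[i]) :
  is_dunkl_kernel k lambda psi -> dunkl_solution k lambda (fun x => psi x%:C).
Proof.
move=> [epsi hpsi _]; exists (fun x => derive1 (psi : R[i] -> R[i]^o) x%:C).
  exact: cderiv_entire.
move=> x x0; rewrite -hpsi /dunkl_operator rmorphN ifF//.
by apply/negbTE; apply: contra_neq x0 => -[].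
Qed.

(* [V x = |y x|^2 + |y (- x)|^2] satisfies
   [V' = - 2 * Im lambda * (|y x|^2 - |y (- x)|^2) - 2 * k / x * |y x - y (- x)|^2
       <= 2 * `|Im lambda| * V] on [x > 0]. *)
Lemma dunkl_energy k lambda y : 0 <= k -> dunkl_solution k lambda y ->
  forall x, normc (y x) ^+ 2 <=
    2 * normc (y 0) ^+ 2 * expR (2 * `|Im lambda| * `|x|).
Proof.
move=> k0 [y' dy ey].
pose V x := Re (y x) * Re (y x) + Im (y x) * Im (y x) +
  (Re (y (- x)) * Re (y (- x)) + Im (y (- x)) * Im (y (- x))).
have VE x : V x = normc (y x) ^+ 2 + normc (y (- x)) ^+ 2 by rewrite !sqr_normc_ReIm !expr2.
pose E := `|Im lambda|; pose xi := Re lambda; pose eta := Im lambda.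
pose V' x := (Re (y' x) * Re (y x) + Re (y x) * Re (y' x)) + (Im (y' x) * Im (y x) + Im (y x)
  * Im (y' x))
  + ((- Re (y' (- x)) * Re (y (- x)) + Re (y (- x)) * - Re (y' (- x))) +
     (- Im (y' (- x)) * Im (y (- x)) + Im (y (- x)) * - Im (y' (- x)))).
have dV (x : R) : is_derive x 1 V (V' x).
  have [d1 d2] := dy x; have [/is_derive_Nf d3 /is_derive_Nf d4] := dy (- x).
  rewrite /V; apply: is_derive_addf; apply: is_derive_addf; exact: is_derive_mulf.
(* Gronwall: [V' <= 2 * E * V] makes [G] nonincreasing on the half line, and [V 0 = 2 * |y 0|^2] is
   the origin of the factor [2]. Negative [x] is covered by the symmetry of [V]. *)
pose G x := V x * expR (- (2 * E) * x).
have dG (x : R) : is_derive x 1 G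
    (V' x * expR (- (2 * E) * x) + V x * (expR (- (2 * E) * x) * (- (2 * E) * 1))).
  by apply: is_derive_mulf; apply: (is_derive_compf (f := expR) (g := fun t => - (2 * E) * t)).
have V'le x : 0 < x -> V' x <= 2 * E * V x.
  move=> x0; have xn : x != 0 by rewrite gt_eqF.
  have e1 := ey x xn; have := ey (- x); rewrite oppr_eq0 => /(_ xn).
  move: e1; rewrite opprK /V' /V.
  case: (y x) => a b; case: (y (- x)) => c d; case: (y' x) => a' b'; case: (y' (- x)) => c' d'.
  have -> : lambda = xi +i* eta by rewrite /xi /eta; case: (lambda).
  rewrite rmorphN invrN mulrN -fmorphV => /(congr1 (fun z => (Re z, Im z))).
  simpl; rewrite !(mulr0, mul0r, addr0, subr0, sub0r, mul1r, mulr1, oppr0) => -[h1 h2].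
  move=> /(congr1 (fun z => (Re z, Im z))).
  simpl; rewrite !(mulr0, mul0r, addr0, subr0, sub0r, mul1r, mulr1, oppr0) => -[h3 h4].
  have q0 : 0 <= k * x^-1 by rewrite mulr_ge0// invr_ge0 ltW.
  have {}h1 : a' = - eta * a - xi * b - k * x^-1 * (a - c) by lra.
  have {}h2 : b' = xi * a - eta * b - k * x^-1 * (b - d) by lra.
  have {}h3 : c' = - eta * c - xi * d + k * x^-1 * (c - a) by lra.
  have {}h4 : d' = xi * c - eta * d + k * x^-1 * (d - b) by lra.
  set q := k * x^-1 in q0 h1 h2 h3 h4.
  have -> : a' * a + a * a' + (b' * b + b * b') + (- c' * c + c * - c' + (- d' * d + d * -
    d')) =
    2 * (- eta) * (a ^+ 2 + b ^+ 2) + 2 * eta * (c ^+ 2 + d ^+ 2)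
    - 2 * (q * ((a - c) ^+ 2 + (b - d) ^+ 2)) by rewrite h1 h2 h3 h4; ring.
  apply: le_trans (_ : 2 * (- eta) * (a ^+ 2 + b ^+ 2) + 2 * eta * (c ^+ 2 + d ^+ 2) <= _).
    rewrite gerBl; apply: mulr_ge0 => //; apply: mulr_ge0 => //.
    by apply: addr_ge0; exact: sqr_ge0.
  rewrite -!expr2 [leRHS]mulrDr; apply: lerD; rewrite ler_wpM2r ?addr_ge0 ?sqr_ge0//
    ler_wpM2l//.
    by rewrite /E -normrN ler_norm.
  exact: ler_norm.
have G0 x : 0 <= x -> G x <= G 0.
  move=> x0; apply: (@ler0_derive1_nincry _ G 0) => //.
  - move=> t; rewrite in_itv /= andbT => t0.
    rewrite derive1E; case: (dG t) => _ ->.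
    have -> : V' t * expR (- (2 * E) * t) + V t * (expR (- (2 * E) * t) * (- (2 * E) * 1)) =
      expR (- (2 * E) * t) * (V' t - 2 * E * V t) by ring.
    by rewrite pmulr_rle0 ?expR_gt0// subr_le0 V'le.
  - apply: continuous_subspaceT => t; exact: is_derive_continuous (dG t).
have VB x : 0 <= x -> V x <= 2 * normc (y 0) ^+ 2 * expR (2 * E * x).
  move=> x0; have := G0 x x0; rewrite /G mulr0 expR0 mulr1 (VE 0) oppr0 -mulr2n -(mulr_natl
    (normc (y 0) ^+ 2)).
  by rewrite [- _ * x]mulNr expRN ler_pdivrMr ?expR_gt0.
move=> x; have [x0|x0] := leP 0 x.
  rewrite (ger0_norm x0); apply: le_trans (VB x x0).
  by rewrite VE lerDl sqr_ge0.
rewrite (ltr0_norm x0); have x0' : 0 <= - x by rewrite oppr_ge0 ltW.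
by apply: le_trans (VB _ x0'); rewrite VE opprK lerDr sqr_ge0.
Qed.

(** The difference solves the same linear equation and has zero initial value, so its energy bound
    is [0]. *)
Lemma dunkl_solution_unique k lambda y z : 0 <= k ->
  dunkl_solution k lambda y -> dunkl_solution k lambda z -> y 0 = z 0 -> y =1 z.
Proof.
move=> k0 [y' dy ey] [z' dz ez] yz x.
have h : dunkl_solution k lambda (fun x => y x - z x).
  exists (fun x => y' x - z' x).
    move=> t; have [y1 y2] := dy t; have [z1 z2] := dz t; rewrite ReD ImD ReN ImN; split.
      by have := is_derive_subf y1 z1; under eq_fun do rewrite -ReN -ReD.
    by have := is_derive_subf y2 z2; under eq_fun do rewrite -ImN -ImD.
  move=> t t0; rewrite mulrBr -ey// -ez//.
  by field; apply: contra_neq t0 => -[].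
have := dunkl_energy k0 h x.
rewrite yz subrr Normc.normc0 expr0n /= mulr0 mul0r => h0.
apply/eqP; rewrite -subr_eq0; apply/eqP/Normc.eq0_normc/eqP.
by rewrite -sqrf_eq0 eq_le h0 sqr_ge0.
Qed.

End DunklKernel.

(** * Power series and growth of the Dunkl kernel *)

Section KernelSeries.
Context {R : realType}.
Implicit Types (k : R) (lambda : R[i]).

Lemma pow_le_fact (x : R) : 0 <= x ->
  exists C : R, forall n, x ^+ n <= C * n`!%:R.
Proof.
move=> x0; have /cvg_series_cvg_0 h := is_cvg_series_exp_coeff x.
have /cvg_seq_bounded[M [_ hM]] : cvgn (exp_coeff x) by apply/cvg_ex; exists 0.
exists (M + 1) => n; have := hM (M + 1); rewrite ltrDl => /(_ ltr01 n I).
rewrite /exp_coeff /= ger0_norm ?divr_ge0 ?exprn_ge0//.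
by rewrite ler_pdivrMr// ltr0n fact_gt0.
Qed.

(* [dunkl_operator k] maps ['X^n] to [gam k n / gam k n.-1 *: 'X^n.-1]. *)
Definition gam k n : R := \prod_(i < n) (i.+1%:R + 2 * k * (odd i.+1)%:R).

Lemma gam0 k : gam k 0 = 1. Proof. by rewrite /gam big_ord0. Qed.

Lemma gamS k n : gam k n.+1 = gam k n * (n.+1%:R + 2 * k * (odd n.+1)%:R).
Proof. by rewrite /gam big_ord_recr. Qed.

Lemma gam_gefact k n : 0 <= k -> n`!%:R <= gam k n.
Proof.
move=> k0; elim: n => [|n IH]; first by rewrite gam0.
rewrite gamS factS natrM mulrC; apply: ler_pM => //.
by rewrite lerDl mulr_ge0// mulr_ge0.
Qed.

Lemma gam_gt0 k n : 0 <= k -> 0 < gam k n.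
Proof. by move=> /(gam_gefact n); apply: lt_le_trans; rewrite ltr0n fact_gt0. Qed.

(** Since [gam k n >= n!], a numerator of geometric growth is harmless. It serves both the kernel,
    with powers of [i lambda], and the transform, with moments. *)
Lemma entire_coef_gam k (u : nat -> R[i]) (A B : R) : 0 <= k -> 0 <= A -> 0 <= B ->
  (forall n, normc (u n) <= A * B ^+ n) ->
  entire_coef (fun n => u n / (gam k n)%:C).
Proof.
move=> k0 A0 B0 hu rho rho0.
have [|C hC] := @pow_le_fact (B * rho); first by rewrite mulr_ge0.
exists (A * C) => n; have g0 := gam_gt0 n k0.
rewrite Normc.normcM Normc.normcV normc_real gtr0_norm// mulrAC.
rewrite ler_pdivrMr//; apply: le_trans (_ : A * B ^+ n * rho ^+ n <= _).
  by rewrite ler_wpM2r ?exprn_ge0.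
rewrite -!mulrA ler_wpM2l// -exprMn; apply: le_trans (hC n) _.
apply: ler_wpM2l; last exact: gam_gefact.
by have := hC 0%N; rewrite expr0 fact0 mulr1; apply: le_trans.
Qed.

Definition kernel_coef k lambda n : R[i] := ('i%C * lambda) ^+ n / (gam k n)%:C.

Lemma entire_kernel_coef k lambda : 0 <= k -> entire_coef (kernel_coef k lambda).
Proof.
move=> k0; apply: (@entire_coef_gam _ _ 1 (normc ('i%C * lambda))) => //.
  exact: normc_ge0.
by move=> n; rewrite mul1r normcX.
Qed.

Lemma kernel_coefS k lambda n : 0 <= k ->
  (n.+1%:R + (2 * k * (odd n.+1)%:R)%:C) * kernel_coef k lambda n.+1 =
    'i%C * lambda * kernel_coef k lambda n.
Proof.
move=> k0; rewrite /kernel_coef gamS exprS.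
have g0 : (gam k n)%:C != 0 :> R[i].
  by apply/eqP => -[]; apply/eqP; rewrite gt_eqF ?gam_gt0.
have s0 : (n.+1%:R + 2 * k * (odd n.+1)%:R)%:C != 0 :> R[i].
  apply/eqP => -[]; apply/eqP; rewrite gt_eqF// ltr_pwDl// mulr_ge0//.
  by rewrite mulr_ge0.
have -> : n.+1%:R + (2 * k * (odd n.+1)%:R)%:C =
    (n.+1%:R + 2 * k * (odd n.+1)%:R)%:C :> R[i] by rewrite rmorphD rmorph_nat.
set s := _%:C in s0 *; set g := _%:C in g0 *.
rewrite (_ : (_ * _)%:C = g * s) ?rmorphM//.
by move: g g0 s s0 => g g0 s s0; field; rewrite g0 s0.
Qed.

Lemma is_dunkl_kernel_pser k lambda : 0 <= k ->
  is_dunkl_kernel k lambda (pser (kernel_coef k lambda)).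
Proof.
move=> k0; set a := kernel_coef k lambda.
have ha : entire_coef a := entire_kernel_coef lambda k0.
have D z : derive1 (pser a : R[i] -> R[i]^o) z = pser (fun n => n.+1%:R * a n.+1) z.
  by rewrite derive1E; case: (is_derive_pser z ha).
split.
- exact: entire_pser.
- move=> z; rewrite /dunkl_operator !D; case: eqP => [->|/eqP z0].
    rewrite (pser0 ha) (pser0 (entire_coef_deriv ha)) -(kernel_coefS lambda 0 k0) -/a.
    by rewrite /= mulr1 mulrDl mulr1n mul1r (mulrC k).
  (* Only odd powers survive in [psi z - psi (- z)]. As [b 0 = 0], the series can be shifted and
     divided by [z]; degree by degree the equation is then [kernel_coefS]. *)
  pose b n := a n * (z ^+ n - (- z) ^+ n).
  have hb : csums b (pser a z - pser a (- z)).
    have := csumsD (pserP z ha) (csumsN (pserP (- z) ha)).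
    by under [X in csums X _]funext do rewrite -mulrBr.
  have b0 : b 0%N = 0 by rewrite /b !expr0 subrr mulr0.
  move: ((csumsS _ _).1 hb); rewrite b0 subr0 /b => /(csumsZ (k%:C * z^-1)).
  move/(csumsD (pserP z (entire_coef_deriv ha))).
  have := csumsZ ('i%C * lambda) (pserP z ha).
  have -> : (fun n => 'i%C * lambda * (a n * z ^+ n)) =
    (fun n => n.+1%:R * a n.+1 * z ^+ n +
       k%:C * z^-1 * (a n.+1 * (z ^+ n.+1 - (- z) ^+ n.+1))).
    apply/funext => n; rewrite mulrA -kernel_coefS// -/a exprNn.
    rewrite -signr_odd !rmorphM /=.
    by case: odd => /=; rewrite !exprS; field.
  move=> /csums_unique h /h ->.
  by rewrite -mulrA (mulrC z^-1).
- by rewrite pser0// /a /kernel_coef expr0 gam0 divr1.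
Qed.

Lemma dunkl_kernelP k lambda : 0 <= k ->
  is_dunkl_kernel k lambda (dunkl_kernel k lambda).
Proof.
move=> k0.
apply: (@xgetPex _ (cst 0) [set psi | is_dunkl_kernel k lambda psi]).
by eexists; exact: is_dunkl_kernel_pser.
Qed.

(** Identifies the chosen kernel on the real line with any explicit solution: the power series for
    general [k], the exponential for [k = 0]. *)
Lemma dunkl_kernel_solution k lambda (y : R -> R[i]) : 0 <= k ->
  dunkl_solution k lambda y -> y 0 = 1 ->
  forall x, dunkl_kernel k lambda x%:C = y x.
Proof.
move=> k0 hy y0; have hk := dunkl_kernelP lambda k0.
apply: (dunkl_solution_unique k0 (is_dunkl_kernel_solution hk) hy).
by rewrite y0; case: hk.
Qed.

Lemma dunkl_kernelE k lambda (x : R) : 0 <= k ->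
  dunkl_kernel k lambda x%:C = pser (kernel_coef k lambda) x%:C.
Proof.
move=> k0; have hk := is_dunkl_kernel_pser lambda k0.
apply: (dunkl_kernel_solution k0 (is_dunkl_kernel_solution hk)).
by case: hk.
Qed.

(** Square root of the energy bound, with [sqrt 2] rounded up to [2]. *)
Lemma dunkl_kernel_le k lambda (x : R) : 0 <= k ->
  normc (dunkl_kernel k lambda x%:C) <= 2 * expR (`|Im lambda| * `|x|).
Proof.
move=> k0; have hk := dunkl_kernelP lambda k0.
have := dunkl_energy k0 (is_dunkl_kernel_solution hk) x.
have [_ _ ->] := hk; rewrite Normc.normc1 expr1n mulr1 => h.
rewrite -(ler_pXn2r (n := 2))// ?nnegrE ?normc_ge0 ?mulr_ge0 ?expR_ge0//.
apply: le_trans h _; rewrite exprMn -expRM_natl.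
rewrite mulrA ler_wpM2r ?expR_ge0//.
by rewrite expr2 ler_peMl// ler1n.
Qed.

Lemma dunkl_kernel_continuous k lambda : 0 <= k ->
  continuous (fun x : R => Re (dunkl_kernel k lambda x%:C)) /\
  continuous (fun x : R => Im (dunkl_kernel k lambda x%:C)).
Proof.
move=> k0; have [y' hy _] := is_dunkl_kernel_solution (dunkl_kernelP lambda k0).
by split=> x; have [h1 h2] := hy x; [exact: is_derive_continuous h1|exact:
  is_derive_continuous h2].
Qed.

(* The exponential [exp (- i * lambda * x)]. *)
Lemma dunkl_kernel0E lambda (x : R) :
  dunkl_kernel 0 (- lambda) x%:C =
    (expR (Im lambda * x) * cos (Re lambda * x)) +i*
    (- (expR (Im lambda * x) * sin (Re lambda * x))).
Proof.
pose eta := Im lambda; pose xi := Re lambda.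
move: x; apply: dunkl_kernel_solution => //; last first.
  by rewrite !mulr0 expR0 cos0 sin0 !mul1r oppr0.
pose E (x : R) := expR (eta * x); pose C (x : R) := cos (xi * x);
  pose S (x : R) := sin (xi * x).
have dE (x : R) : is_derive x 1 E (E x * (eta * 1)).
  by apply: (is_derive_compf (f := expR) (g := fun t => eta * t)); exact: is_derive_scalef.
have dC (x : R) : is_derive x 1 C (- S x * (xi * 1)).
  by apply: (is_derive_compf (f := cos) (g := fun t => xi * t)); exact: is_derive_scalef.
have dS (x : R) : is_derive x 1 S (C x * (xi * 1)).
  by apply: (is_derive_compf (f := sin) (g := fun t => xi * t)); exact: is_derive_scalef.
exists (fun x => (E x * (eta * 1) * C x + E x * (- S x * (xi * 1))) +i*
   (- (E x * (eta * 1) * S x + E x * (C x * (xi * 1))))).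
  move=> x; split; first exact: is_derive_mulf.
  by have := is_deriveN (is_derive_mulf (dE x) (dS x)).
move=> x _; rewrite mul0r addr0 -/eta -/xi.
have -> : lambda = xi +i* eta by rewrite /xi /eta; case: (lambda).
rewrite -/(E x) -/(C x) -/(S x).
by apply: complex_eq => /=; ring.
Qed.

End KernelSeries.

(** * Segment integrals and smooth functions *)

Section SegmentIntegral.
Context {R : realType}.
Implicit Types (f g F : R -> R) (a b c L M : R).
Local Notation mu := (@lebesgue_measure R).

Lemma segment_integrable f a b : continuous f ->
  mu.-integrable `[a, b] (EFin \o f).
Proof.
move=> cf; apply: continuous_compact_integrable; first exact: segment_compact.
exact: continuous_subspaceT.
Qed.

(** Differentiability is asked only inside the segment because later primitives contain [|x| ^ a],
    which is differentiated for [0 < x] only. *)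
Lemma FTC_segment F f a b : a <= b -> continuous F -> continuous f ->
  (forall x : R, a < x < b -> is_derive x 1 F (f x)) ->
  \int[mu]_(x in `[a, b]) f x = F b - F a.
Proof.
rewrite le_eqVlt => /predU1P[-> _ _ _|ab cF cf dF].
  by rewrite set_itv1 Rintegral_set1 subrr.
rewrite /Rintegral (continuous_FTC2 (F := F) ab)//.
- exact: continuous_subspaceT.
- split.
  + by move=> x; rewrite in_itv /= => /dF[].
  + by apply: cvg_at_right_filter; exact: cF.
  + by apply: cvg_at_left_filter; exact: cF.
- by move=> x; rewrite in_itv /= => /dF[_ <-]; rewrite derive1E.
Qed.

Lemma segment_integral_cst a b M : a <= b ->
  \int[mu]_(x in `[a, b]) cst M x = M * (b - a).
Proof.
move=> ab; have H : fine (mu `[a, b]) = b - a.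
  rewrite lebesgue_measure_itv /= lte_fin.
  by move: ab; case: ltgtP => //= ->; rewrite subrr.
by rewrite -H -Rintegral_cst.
Qed.

Lemma segment_integral_le f a b M : a <= b -> continuous f ->
  (forall x, a <= x <= b -> `|f x| <= M) ->
  `|\int[mu]_(x in `[a, b]) f x| <= M * (b - a).
Proof.
move=> ab cf hM.
apply: le_trans (le_normr_Rintegral _ (segment_integrable _ _ cf)) _ => //.
rewrite -segment_integral_cst//; apply: le_Rintegral => //.
- by apply: (segment_integrable (f := fun x => `|f x|)) => x; apply: cvg_norm; exact: cf.
- by apply: segment_integrable => x; exact: cvg_cst.
Qed.

Lemma segment_integral_ge f a b M : a <= b -> continuous f ->
  (forall x, a <= x <= b -> M <= f x) ->
  M * (b - a) <= \int[mu]_(x in `[a, b]) f x.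
Proof.
move=> ab cf hM.
rewrite -segment_integral_cst//; apply: le_Rintegral => //.
- by apply: segment_integrable => x; exact: cvg_cst.
- exact: segment_integrable.
Qed.

Lemma segment_integralD f g a b : continuous f -> continuous g ->
  \int[mu]_(x in `[a, b]) (f x + g x) =
  \int[mu]_(x in `[a, b]) f x + \int[mu]_(x in `[a, b]) g x.
Proof. by move=> cf cg; apply: RintegralD => //; exact: segment_integrable. Qed.

Lemma segment_integralB f g a b : continuous f -> continuous g ->
  \int[mu]_(x in `[a, b]) (f x - g x) =
  \int[mu]_(x in `[a, b]) f x - \int[mu]_(x in `[a, b]) g x.
Proof. by move=> cf cg; apply: RintegralB => //; exact: segment_integrable. Qed.

Lemma segment_integralZ f (r : R) a b : continuous f ->
  \int[mu]_(x in `[a, b]) (r * f x) = r * \int[mu]_(x in `[a, b]) f x.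
Proof. by move=> cf; apply: RintegralZl => //; exact: segment_integrable. Qed.

Lemma segment_integral_cat f a b c : a <= b -> b <= c -> continuous f ->
  \int[mu]_(x in `[a, c]) f x =
  \int[mu]_(x in `[a, b]) f x + \int[mu]_(x in `[b, c]) f x.
Proof.
move=> ab bc cf.
have := @Rintegral_itvB R f (BLeft a) (BRight c) b (segment_integrable _ _ cf).
rewrite !bnd_simp => /(_ ab bc) h.
have := @Rintegral_itv_obnd_cbnd R b (BRight c) f.
rewrite -h => <-; first by rewrite addrC subrK.
by apply: integrableS (segment_integrable b c cf) => //; apply: subset_itvr; rewrite bnd_simp.
Qed.

Lemma eq_segment_integral f g a b : continuous f -> continuous g ->
  (forall x, a < x <= b -> f x = g x) ->
  \int[mu]_(x in `[a, b]) f x = \int[mu]_(x in `[a, b]) g x.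
Proof.
have H h : continuous h ->
    \int[mu]_(x in `]a, b]) h x = \int[mu]_(x in `[a, b]) h x.
  move=> ch; apply: Rintegral_itv_obnd_cbnd.
  by apply: integrableS (segment_integrable a b ch) => //; apply: subset_itvr; rewrite bnd_simp.
move=> cf cg fg; rewrite -H// -[RHS]H//; apply: eq_Rintegral => x.
by rewrite inE /= in_itv /=; exact: fg.
Qed.

Lemma segment_integral_fold f L : 0 <= L -> continuous f ->
  \int[mu]_(x in `[- L, L]) f x = \int[mu]_(x in `[0, L]) (f x + f (- x)).
Proof.
move=> L0 cf; have cfN : continuous (fun x => f (- x)).
  by move=> x; apply: continuous_comp; [exact: opp_continuous|exact: cf].
rewrite (@segment_integral_cat _ _ 0) ?oppr_le0// segment_integralD// addrC.
congr (_ + _); rewrite /Rintegral -[X in `[- L, X]]oppr0.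
by rewrite integration_by_substitution_oppr//; exact: continuous_subspaceT.
Qed.

Lemma compact_support_integral f L : 0 <= L -> continuous f ->
  (forall x, L < `|x| -> f x = 0) ->
  \int[mu]_x f x = \int[mu]_(x in `[- L, L]) f x.
Proof.
move=> L0 cf f0; rewrite [RHS]Rintegral_mkcond; apply: eq_Rintegral => x _.
rewrite /patch; case: ifPn => //; rewrite notin_setE /= in_itv /= -ler_norml => h.
by apply: f0; rewrite ltNge; apply/negP.
Qed.

Lemma compact_support_integrable f L : continuous f ->
  (forall x, L < `|x| -> f x = 0) -> mu.-integrable setT (EFin \o f).
Proof.
move=> cf f0.
have h := segment_integrable (- L) L cf.
have -> : EFin \o f = (EFin \o f) \_ `[- L, L].
  apply/funext => x; rewrite /patch; case: ifPn => //.
  rewrite notin_setE /= in_itv /= -ler_norml => hx.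
  by rewrite f0// ltNge; apply/negP.
by apply/integrable_restrict => //; rewrite setTI.
Qed.

Lemma bounded_on_segment f a b : continuous f ->
  exists M, 0 <= M /\ forall x, a <= x <= b -> `|f x| <= M.
Proof.
move=> cf; have [ab|ba] := leP a b; last first.
  by exists 0; split => // x /andP[ax xb]; have := lt_le_trans ba (le_trans ax xb);
    rewrite ltxx.
have [|c _ hc] := @EVT_max R (fun x => `|f x|) a b ab.
  by apply: continuous_subspaceT => x; apply: cvg_norm; exact: cf.
by exists `|f c|; split => // x hx; apply: hc; rewrite in_itv.
Qed.

End SegmentIntegral.

Section SmoothFunctions.
Context {R : realType}.
Implicit Types (f g h : R -> R) (n : nat).
Local Notation mu := (@lebesgue_measure R).

(** A chain of derivatives given as witnesses, so that closure under sums, products and parameter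
    integrals is an induction on [n]. *)
Fixpoint Ck n f : Prop :=
  if n is n'.+1 then
    exists2 f', (forall x : R, is_derive x 1 f (f' x)) & Ck n' f'
  else continuous f.

Lemma Ck_continuous n f : Ck n f -> continuous f.
Proof.
by case: n => [//|n [f' df _]] x; exact: is_derive_continuous (df x).
Qed.

Lemma Ck_pred n f : Ck n.+1 f -> Ck n f.
Proof.
elim: n f => [|n IH] f hf; first exact: Ck_continuous hf.
by case: hf => f' df /IH hf'; exists f'.
Qed.

Lemma Ck_cst n (c : R) : Ck n (fun _ => c).
Proof.
elim: n c => [|n IH] c; first by move=> x; exact: cvg_cst.
by exists (fun _ => 0) => // x; exact: is_derive_cstf.
Qed.

Lemma Ck_id n : Ck n (fun x : R => x).
Proof.
case: n => [|n]; first by move=> x; exact: cvg_id.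
by exists (fun _ => 1) => [x|]; [exact: is_derive_idf|exact: Ck_cst].
Qed.

Lemma Ck_add n f g : Ck n f -> Ck n g -> Ck n (fun x => f x + g x).
Proof.
elim: n f g => [|n IH] f g; first by move=> cf cg x; apply: cvgD; [exact: cf|exact: cg].
move=> [f' df hf] [g' dg hg]; exists (fun x => f' x + g' x); last exact: IH.
by move=> x; exact: is_derive_addf.
Qed.

Lemma Ck_mul n f g : Ck n f -> Ck n g -> Ck n (fun x => f x * g x).
Proof.
elim: n f g => [|n IH] f g; first by move=> cf cg x; apply: cvgM; [exact: cf|exact: cg].
move=> hf hg; have hf0 := Ck_pred hf; have hg0 := Ck_pred hg.
move: hf hg => [f' df hf] [g' dg hg].
exists (fun x => f' x * g x + f x * g' x); last by apply: Ck_add; exact: IH.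
by move=> x; exact: is_derive_mulf.
Qed.

Lemma Ck_opp n f : Ck n f -> Ck n (fun x => f (- x)).
Proof.
elim: n f => [|n IH] f.
  by move=> cf x; apply: continuous_comp; [exact: opp_continuous|exact: cf].
move=> [f' df hf]; exists (fun x => -1 * f' (- x)).
  by move=> x; have := is_derive_Nf (df (- x)); rewrite mulN1r.
by apply: Ck_mul; [exact: Ck_cst|exact: IH].
Qed.

Definition smoothr f := forall n, Ck n f.

Lemma smoothr_deriv f : smoothr f ->
  exists2 f', (forall x : R, is_derive x 1 f (f' x)) & smoothr f'.
Proof.
move=> hf; have [f' df _] := hf 1%N; exists f' => // n.
(* Derivatives are unique, so the one provided at order [1] is the one provided at every order. *)
have [g dg hg] := hf n.+1; suff -> : f' = g by [].
by apply/funext => x; case: (df x) => _ <-; case: (dg x).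
Qed.

Lemma smoothr_continuous f : smoothr f -> continuous f.
Proof. by move=> /(_ 0%N). Qed.

Lemma smoothrP f :
  smoothr f <-> forall n x, derivable (derive1n n f) x 1.
Proof.
have DS n h : derive1n n.+1 h = derive1n n (derive1 h) by rewrite /derive1n iterSr.
split=> [hf n|hf n].
  elim: n f hf => [|n IH] f hf x.
    by have [f' df _] := smoothr_deriv hf; case: (df x).
  have [f' df hf'] := smoothr_deriv hf; rewrite DS.
  have -> : derive1 f = f' by apply/funext => t; rewrite derive1E; case: (df t).
  exact: IH.
elim: n f hf => [|n IH] f hf.
  by move=> x; apply: differentiable_continuous; apply/derivable1_diffP; exact: (hf 0%N).
exists (derive1 f) => [x|]; last by apply: IH => m x; rewrite -DS.
by rewrite derive1E; apply: DeriveDef; first exact: (hf 0%N).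
Qed.

Lemma is_derive_segment_integral (f f' : R -> R -> R) (x a b M : R) : 0 <= M ->
  (forall y, continuous (f y)) ->
  (forall y t : R, is_derive y 1 (f^~ t) (f' y t)) ->
  (forall y t, `|y - x| < 1 -> a <= t <= b -> `|f' y t| <= M) ->
  is_derive x 1 (fun y => \int[mu]_(t in `[a, b]) f y t)
    (\int[mu]_(t in `[a, b]) f' x t).
Proof.
move=> M0 cf df hM.
have d1f y t : partial1of2 f y t = f' y t.
  by rewrite partial1of2E; case: (df y t).
have Ix : `](x - 1), (x + 1)[%classic x by rewrite /= in_itv /= ltrBlDr ltrDl ltr01.
have intf y : `](x - 1), (x + 1)[%classic y -> mu.-integrable `[a, b] (EFin \o f y).
  by move=> _; exact: segment_integrable.
have derf y t : `](x - 1), (x + 1)[%classic y -> `[a, b]%classic t -> derivable (f^~ t) y 1.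
  by move=> _ _; case: (df y t).
have intM : mu.-integrable `[a, b] (EFin \o (fun _ : R => M)).
  by apply: segment_integrable => t; exact: cvg_cst.
have ub y t : `](x - 1), (x + 1)[%classic y -> `[a, b]%classic t ->
    `|partial1of2 f y t| <= M.
  rewrite /= !in_itv /= => /andP[y1 y2] tab; rewrite d1f; apply: hM => //.
  by rewrite ltr_norml; apply/andP; split; lra.
have E := @differentiation_under_integral R _ _ mu f [set` `[a, b]]
  (measurable_itv _) _ _ _ Ix intf derf (fun _ => M) (fun _ => M0) intM ub.
have D := @derivable_under_integral R _ _ mu f [set` `[a, b]]
  (measurable_itv _) _ _ _ Ix intf derf (fun _ => M) (fun _ => M0) intM ub.
apply: DeriveDef; first exact: D.
by rewrite -derive1E [LHS]E; apply: eq_Rintegral => t _; exact: d1f.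
Qed.

(* [Qint n h] is the [n]-th derivative of [x |-> \int_0^1 H (t * x) dt]
   when [h] is the [n]-th derivative of [H]. *)
Definition Qint n h x := \int[mu]_(t in `[0, 1]) (t ^+ n * h (t * x)).

Lemma continuous_mulr_comp h x : continuous h -> continuous (fun t : R => h (t * x)).
Proof.
move=> ch t; apply: (@continuous_comp _ _ _ (fun t : R => t * x) h); last exact: ch.
by apply: cvgM; [exact: cvg_id|exact: cvg_cst].
Qed.

Lemma continuous_Qint_integrand n h x : continuous h ->
  continuous (fun t : R => t ^+ n * h (t * x)).
Proof.
by move=> ch t; apply: cvgM; [exact: exprn_continuous|exact: continuous_mulr_comp].
Qed.

Lemma is_derive_Qint n h h' (x : R) : (forall y : R, is_derive y 1 h (h' y)) ->
  continuous h' -> is_derive x 1 (Qint n h) (Qint n.+1 h' x).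
Proof.
move=> dh ch'; have ch : continuous h by move=> y; exact: is_derive_continuous (dh y).
(* All points [t * y] with [0 <= t <= 1] and [|y - x| < 1] lie in [[- B, B]], where [h'] is
   bounded. *)
pose B := `|x| + 1.
have [M [M0 hM]] := bounded_on_segment (- B) B ch'.
apply: (@is_derive_segment_integral (fun y t => t ^+ n * h (t * y))
  (fun y t => t ^+ n.+1 * h' (t * y)) _ _ _ _ M0).
- by move=> y; exact: continuous_Qint_integrand.
- move=> y t; have := is_derive_scalef (t ^+ n) (is_derive_compf (dh (t * y))
  (is_derive_scalef t (is_derive_idf y))).
  by move/is_derive_eqr; apply; rewrite mulr1 exprSr; ring.
- move=> y t yx /andP[t0 t1].
  rewrite normrM -[leRHS]mul1r; apply: ler_pM => //.
    by rewrite ger0_norm ?exprn_ge0// exprn_ile1.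
  apply: hM; rewrite -ler_norml normrM (ger0_norm t0).
  apply: le_trans (_ : 1 * `|y| <= _); first by rewrite ler_wpM2r.
  rewrite mul1r /B -[y](subrK x); apply: le_trans (ler_normD _ _) _.
  by rewrite addrC lerD2l ltW.
Qed.

Lemma Qint_smooth n h : smoothr h -> smoothr (Qint n h).
Proof.
move=> hh m; elim: m n h hh => [|m IH] n h hh.
  have [h' dh hh'] := smoothr_deriv hh.
  by move=> x; exact: is_derive_continuous (is_derive_Qint n x dh (smoothr_continuous hh')).
have [h' dh hh'] := smoothr_deriv hh; exists (Qint n.+1 h'); last exact: IH.
by move=> x; exact: (is_derive_Qint n x dh (smoothr_continuous hh')).
Qed.

(** The quotient is [\int_0^1 h' (t x) dt], which is smooth across [0] as an integral depending on a
    parameter. *)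
Lemma hadamard h : smoothr h -> h 0 = 0 ->
  exists2 q, smoothr q & forall x, h x = x * q x.
Proof.
move=> hh h0; have [h' dh hh'] := smoothr_deriv hh.
have ch' := smoothr_continuous hh'.
exists (Qint 0 h'); first exact: Qint_smooth.
move=> x; rewrite /Qint -segment_integralZ; last exact: continuous_Qint_integrand.
transitivity (h (1 * x) - h (0 * x)); first by rewrite mul1r mul0r h0 subr0.
apply/esym/(@FTC_segment _ (fun t => h (t * x))).
- exact: ler01.
- exact/continuous_mulr_comp/smoothr_continuous.
- move=> t; apply: cvgM; first exact: cvg_cst.
  exact: continuous_Qint_integrand.
- move=> t _; have := is_derive_compf (g := fun t => t * x) (dh (t * x)) (is_derive_mulf
  (is_derive_idf t) (is_derive_cstf x t)).
  by move/is_derive_eqr; apply; rewrite expr0; ring.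
Qed.

End SmoothFunctions.

(** * Weighted moments and the Dunkl operator *)

Section EvenSmooth.
Context {R : realType}.
Implicit Types (f g p q : R -> R) (k a L x : R) (n m : nat).
Local Notation mu := (@lebesgue_measure R).

Definition supp_in L f := forall x, L < `|x| -> f x = 0.

Lemma supp_in_derive L f f' : supp_in L f ->
  (forall x : R, is_derive x 1 f (f' x)) -> supp_in L f'.
Proof.
move=> sf df x Lx.
have : is_derive x 1 f 0.
  apply: (@is_derive_near _ (fun _ => 0)).
  have : \forall y \near x, L < `|y|.
    have /cvgr_gt : `|y| @[y --> x] --> `|x| by apply: cvg_norm; exact: cvg_id.
    exact.
  by apply: filterS => y /sf.
by case: (df x) => _ <- [_ ->].
Qed.

(** Kills the boundary term at [L] when integrating by parts over [[0, L]]. *)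
Lemma supp_in_edge L f : 0 <= L -> continuous f -> supp_in L f -> f L = 0.
Proof.
move=> L0 cf zf; apply/eqP; apply/negPn/negP => fL0.
have : \forall y \near L, f y != 0.
  have /cvgr_norm_gt := cf L; move=> /(_ 0); rewrite normr_gt0 => /(_ fL0).
  by apply: filterS => y; rewrite normr_gt0.
move=> /nbhs_ballP[e /= e0 he].
have := he (L + e / 2); rewrite /ball /= opprD addNKr normrN gtr0_norm ?divr_gt0//.
rewrite ltr_pdivrMr// ltr_pMr// ltr1n => /(_ isT).
by rewrite zf ?eqxx// ger0_norm ?addr_ge0 ?divr_ge0 ?ltrDl ?divr_gt0// ltW.
Qed.

Record evs L g : Prop := Evs {
  evs_smooth : smoothr g;
  evs_even : forall x, g (- x) = g x;
  evs_supp : supp_in L g }.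

Lemma evs_continuous L g : evs L g -> continuous g.
Proof. by case=> /smoothr_continuous. Qed.

Lemma even_quotient L f q : 0 <= L -> smoothr q -> supp_in L f ->
  (forall x, f (- x) = - f x) -> (forall x, f x = x * q x) -> evs L q.
Proof.
move=> L0 sq sf fo fq; split => // x.
  have [->|x0] := eqVneq x 0; first by rewrite oppr0.
  have := fo x; rewrite !fq mulNr => /oppr_inj.
  by move/(mulfI x0).
move=> Lx; have x0 : x != 0 by rewrite -normr_gt0; exact: le_lt_trans Lx.
by apply: (mulfI x0); rewrite mulr0 -fq sf.
Qed.

(* In the variable [u = x ^+ 2] the operator [g |-> Sg] is [2 * d/du]. *)
Lemma evs_sdiv L g : 0 <= L -> evs L g ->
  exists2 Sg, evs L Sg & forall x : R, is_derive x 1 g (x * Sg x).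
Proof.
move=> L0 [sg eg zg]; have [g' dg sg'] := smoothr_deriv sg.
have og x : g' (- x) = - g' x.
  have h := is_derive_Nf (dg (- x)).
  have E : (fun t => g (- t)) = g by apply/funext.
  by move: h; rewrite E => -[_]; case: (dg x) => _ -> ->; rewrite opprK.
have g0 : g' 0 = 0.
  by have := og 0; rewrite oppr0 => h; lra.
have [q sq hq] := hadamard sg' g0; exists q.
  exact: even_quotient L0 sq (supp_in_derive zg dg) og hq.
by move=> x; rewrite -hq.
Qed.

Lemma even_odd_split L f : 0 <= L -> smoothr f -> supp_in L f ->
  exists p q, [/\ evs L p, evs L q & forall x, f x = p x + x * q x].
Proof.
move=> L0 sf zf.
have sN : smoothr (fun x => f (- x)) by move=> n; exact: Ck_opp.
have sp c : smoothr (fun x => 2^-1 * (f x + c * f (- x))).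
  move=> n; apply: Ck_mul; first exact: Ck_cst.
  by apply: Ck_add; [exact: sf|apply: Ck_mul; [exact: Ck_cst|exact: sN]].
have zN x : L < `|x| -> f (- x) = 0 by move=> Lx; apply: zf; rewrite normrN.
have [|q sq hq] := hadamard (sp (-1)); first by rewrite oppr0; ring.
exists (fun x => 2^-1 * (f x + 1 * f (- x))), q; split.
- split; [exact: sp| |].
  + by move=> x; rewrite opprK; ring.
  + by move=> x Lx; rewrite zf// zN//; ring.
- apply: (even_quotient L0 sq _ _ hq).
  + by move=> x Lx; rewrite zf// zN//; ring.
  + by move=> x; rewrite opprK; ring.
- by move=> x; rewrite -hq; field.
Qed.

Definition wt a (x : R) : R := `|x| `^ a.

Lemma wtN a x : wt a (- x) = wt a x. Proof. by rewrite /wt normrN. Qed.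

Lemma wt_ge0 a x : 0 <= wt a x. Proof. exact: powR_ge0. Qed.

Lemma is_derive_wt a x : 0 < x -> is_derive x 1 (wt a) (a * wt (a - 1) x).
Proof.
move=> x0; rewrite [X in a * X]/wt gtr0_norm//.
apply: is_derive_near (is_derive1_powR a x0).
have : \forall y \near x, 0 < y by exact: lt_nbhsr.
by apply: filterS => y y0; rewrite /wt gtr0_norm.
Qed.

Lemma wt_continuous a : 0 <= a -> continuous (wt a).
Proof.
rewrite le_eqVlt => /predU1P[<-|a0].
  by rewrite (_ : wt 0 = cst 1); [move=> x; exact: cvg_cst|apply/funext => x; exact: powRr0].
have H x : 0 < x -> {for x, continuous (wt a)}.
  by move=> /(is_derive_wt a)/is_derive_continuous.
move=> x; have [x0|x0|->] := ltgtP x 0; last 1 first.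
- suff : wt a y @[y --> (0 : R)] --> wt a 0 by [].
  apply/cvgrPdist_le => e e0; apply/nbhs_ballP.
  exists (e `^ a^-1) => [|y]; first exact: powR_gt0.
  rewrite /ball /= sub0r normrN => /ltW hy.
  rewrite /wt normr0 powR0 ?gt_eqF// sub0r normrN ger0_norm ?powR_ge0//.
  have -> : e = (e `^ a^-1) `^ a by rewrite -powRrM mulVf ?gt_eqF// powRr1// ltW.
  by apply: ge0_ler_powR; rewrite ?nnegrE ?powR_ge0 ?(ltW a0)//.
- have -> : wt a = (wt a \o -%R) by apply/funext => y; rewrite /= wtN.
  by apply: continuous_comp; [exact: opp_continuous|apply: H; rewrite oppr_gt0].
- exact: H.
Qed.

Lemma wtX a n x : 0 < x -> x ^+ n * wt a x = wt (a + n%:R) x.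
Proof.
move=> x0; rewrite /wt gtr0_norm// -powR_mulrn 1?ltW//.
by rewrite addrC powRD// (gt_eqF x0) implybT.
Qed.

Definition mom L a g := \int[mu]_(x in `[0, L]) (wt a x * g x).

Lemma mom_continuous a g : 0 <= a -> continuous g ->
  continuous (fun x => wt a x * g x).
Proof. by move=> a0 cg x; apply: cvgM; [exact: wt_continuous|exact: cg]. Qed.

(** Integration by parts: the derivative of [x ^ (a + 1) * g x] is [(a + 1) * x ^ a * g x + x ^ (a +
    2) * Sg x], and this primitive vanishes at [0] and at [L]. *)
Lemma mom_sdiv L a g Sg : 0 <= L -> 0 <= a -> evs L g -> evs L Sg ->
  (forall x : R, is_derive x 1 g (x * Sg x)) ->
  mom L (a + 2) Sg = - (a + 1) * mom L a g.
Proof.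
move=> L0 a0 hg hS dg.
have a2 : 0 <= a + 2 by rewrite addr_ge0.
have cg := evs_continuous hg; have cS := evs_continuous hS.
have c1 := mom_continuous a0 cg; have c2 := mom_continuous a2 cS.
have c1' : continuous (fun x => (a + 1) * (wt a x * g x)).
  by move=> x; apply: cvgM; [exact: cvg_cst|exact: c1].
pose F x := x * (wt a x * g x).
have gL := supp_in_edge L0 cg (evs_supp hg).
have := @FTC_segment R F (fun x => (a + 1) * (wt a x * g x) + wt (a + 2) x * Sg x) 0 L L0.
rewrite segment_integralD// segment_integralZ// /F gL !mulr0 mul0r subrr => h.
apply: (addrI ((a + 1) * mom L a g)); rewrite mulNr subrr; apply: h.
- by move=> x; apply: cvgM; [exact: cvg_id|exact: c1].
- by move=> x; apply: cvgD; [exact: c1'|exact: c2].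
- move=> x /andP[x0 _].
  have := is_derive_mulf (is_derive_idf x) (is_derive_mulf (is_derive_wt a x0) (dg x)).
  move/is_derive_eqr; apply.
  rewrite -(wtX a 2 x0).
  have -> : wt a x = x ^+ 1 * wt (a - 1) x by rewrite wtX// subrK.
  by ring.
Qed.

Definition rmom k f n := \int[mu]_x (f x * (x ^+ n * wt (2 * k) x)).

(** Folding the line onto [[0, L]] cancels the component whose parity differs from that of [n]. The
    factor [x] of the odd component raises the exponent, so that [mom] always receives an even shift
    of [2 * k]. *)
Lemma rmom_split k L p q n : 0 <= k -> 0 <= L -> evs L p -> evs L q ->
  rmom k (fun x => p x + x * q x) n =
    if odd n then 2 * mom L (2 * k + n.+1%:R) q else 2 * mom L (2 * k + n%:R) p.
Proof.
move=> k0 L0 hp hq; have k2 : 0 <= 2 * k by rewrite mulr_ge0.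
have cp := evs_continuous hp; have cq := evs_continuous hq.
have c1 : continuous (fun x => (p x + x * q x) * (x ^+ n * wt (2 * k) x)).
  move=> x; apply: cvgM.
    by apply: cvgD; [exact: cp|apply: cvgM; [exact: cvg_id|exact: cq]].
  by apply: cvgM; [exact: exprn_continuous|exact: wt_continuous].
rewrite /rmom (@compact_support_integral _ _ L)//; last first.
  by move=> x Lx; rewrite (evs_supp hp)// (evs_supp hq)// mulr0 addr0 mul0r.
rewrite segment_integral_fold// /mom.
have kn i : 0 <= 2 * k + i%:R by rewrite addr_ge0.
have E (h : R -> R) i : continuous h ->
    (forall x, 0 < x -> (p x + x * q x) * (x ^+ n * wt (2 * k) x) +
      (p (- x) + - x * q (- x)) * ((- x) ^+ n * wt (2 * k) (- x)) =
      2 * (wt (2 * k + i%:R) x * h x)) ->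
    \int[mu]_(x in `[0, L]) ((p x + x * q x) * (x ^+ n * wt (2 * k) x) +
      (p (- x) + - x * q (- x)) * ((- x) ^+ n * wt (2 * k) (- x))) =
    2 * \int[mu]_(x in `[0, L]) (wt (2 * k + i%:R) x * h x).
  move=> ch hE; have c3 := mom_continuous (kn i) ch.
  have cN : continuous (fun x => (p (- x) + - x * q (- x)) * ((- x) ^+ n * wt (2 * k) (- x))).
    by move=> x; apply: (@continuous_comp _ _ _ -%R (fun x => (p x + x * q x) * (x ^+ n * wt
      (2 * k) x))); [exact: opp_continuous|exact: c1].
  have cs : continuous (fun x => (p x + x * q x) * (x ^+ n * wt (2 * k) x) +
      (p (- x) + - x * q (- x)) * ((- x) ^+ n * wt (2 * k) (- x))).
    by move=> x; apply: cvgD; [exact: c1|exact: cN].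
  have c2 : continuous (fun x => 2 * (wt (2 * k + i%:R) x * h x)).
    by move=> x; apply: cvgM; [exact: cvg_cst|exact: c3].
  rewrite -segment_integralZ//; apply: eq_segment_integral => // x /andP[x0 _].
  exact: hE.
case: ifPn => on; apply: E => // x x0.
  rewrite -(wtX _ _ x0) (evs_even hp) (evs_even hq) wtN exprNn -signr_odd on exprS; ring.
rewrite -(wtX _ _ x0) (evs_even hp) (evs_even hq) wtN exprNn -signr_odd (negbTE on); ring.
Qed.

(** The witness is [T_k f]: for [f = p + x q] it equals [x Sp + x^2 Sq + (1 + 2 k) q]. The identity
    expresses that [T_k] is skew-adjoint for the weight and sends [x ^ n] to [(n + 2 k) x ^ n.-1] or
    [n x ^ n.-1] according to the parity of [n]. *)
Lemma dunkl_operator_moments k L f : 0 <= k -> 0 <= L ->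
  smoothr f -> supp_in L f ->
  exists g, [/\ smoothr g, supp_in L g &
    forall n, rmom k g n = - (n%:R + 2 * k * (odd n)%:R) * rmom k f n.-1].
Proof.
move=> k0 L0 sf zf; have [p [q [hp hq fE]]] := even_odd_split L0 sf zf.
have [Sp hSp dp] := evs_sdiv L0 hp; have [Sq hSq dq] := evs_sdiv L0 hq.
pose h x := x ^+ 2 * Sq x + (1 + 2 * k) * q x.
have hh : evs L h.
  split.
  - move=> n; apply: Ck_add; last by apply: Ck_mul; [exact: Ck_cst|exact: (evs_smooth hq)].
    by rewrite /h; apply: Ck_mul; [apply: Ck_mul; exact: Ck_id|exact: (evs_smooth hSq)].
  - by move=> x; rewrite /h (evs_even hq) (evs_even hSq) sqrrN.
  - by move=> x Lx; rewrite /h (evs_supp hq)// (evs_supp hSq)// !mulr0 addr0.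
exists (fun x => h x + x * Sp x); split.
- move=> n; apply: Ck_add; first exact: (evs_smooth hh).
  by apply: Ck_mul; [exact: Ck_id|exact: (evs_smooth hSp)].
- by move=> x Lx; rewrite (evs_supp hh)// (evs_supp hSp)// mulr0 addr0.
move=> n; have -> : f = (fun x => p x + x * q x) by apply/funext.
rewrite !(rmom_split _ k0 L0)//.
have kn i : 0 <= 2 * k + i%:R by rewrite addr_ge0// mulr_ge0.
(* The weight exponent cancels: [- (2 k + i + 1) + (1 + 2 k) = - i]. *)
have H i : mom L (2 * k + i%:R) h = - i%:R * mom L (2 * k + i%:R) q.
  have cq := evs_continuous hq; have cS := evs_continuous hSq.
  have c2 := mom_continuous (kn i) cq.
  have k2 : 0 <= 2 * k + i%:R + 2 by rewrite addr_ge0.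
  have c1 := mom_continuous k2 cS.
  have : mom L (2 * k + i%:R) h = mom L (2 * k + i%:R + 2) Sq +
      (1 + 2 * k) * mom L (2 * k + i%:R) q.
    rewrite /mom -segment_integralZ// -segment_integralD//; last first.
      by move=> x; apply: cvgM; [exact: cvg_cst|exact: c2].
    apply: eq_Rintegral => x; rewrite inE /= in_itv /= => /andP[x0 _].
    have : wt (2 * k + i%:R + 2) x = x ^+ 2 * wt (2 * k + i%:R) x.
      move: x0; rewrite le_eqVlt => /predU1P[<-|x0]; last by rewrite wtX.
      by rewrite /wt normr0 expr0n mul0r powR0// gt_eqF// ltr_wpDl.
    by rewrite /h => ->; ring.
  by rewrite (mom_sdiv L0 (kn i) hq hSq dq) => ->; ring.
(* At [n = 0] the coefficient is [0], so the value of [n.-1] does not matter. *)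
case: n => [|n] /=; first by rewrite H; ring.
case: (odd n) => /=; first by rewrite H; ring.
rewrite -[n.+2]addn2 natrD addrA (mom_sdiv L0 (kn n) hp hSp dp) -natr1; ring.
Qed.

End EvenSmooth.

(** * The Dunkl transform of a compactly supported function *)

Section ComplexIntegral.
Context {R : realType}.
Implicit Types (f g : R -> R[i]) (L M : R).
Local Notation mu := (@lebesgue_measure R).

Definition ccont f := continuous (fun x => Re (f x)) /\ continuous (fun x => Im (f x)).

Definition csupp L f := forall x, L < `|x| -> f x = 0.

Lemma ccontM f g : ccont f -> ccont g -> ccont (fun x => f x * g x).
Proof.
move=> [f1 f2] [g1 g2]; split=> x.
  rewrite (_ : (fun x => _) = (fun x => Re (f x) * Re (g x) - Im (f x) * Im (g x))).
    by apply: cvgB; apply: cvgM; [exact: f1|exact: g1|exact: f2|exact: g2].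
  by apply/funext => y; rewrite ReM.
rewrite (_ : (fun x => _) = (fun x => Re (f x) * Im (g x) + Im (f x) * Re (g x))).
  by apply: cvgD; apply: cvgM; [exact: f1|exact: g2|exact: f2|exact: g1].
by apply/funext => y; rewrite ImM.
Qed.

Lemma ccontD f g : ccont f -> ccont g -> ccont (fun x => f x + g x).
Proof.
move=> [f1 f2] [g1 g2]; split=> x.
  under eq_fun do rewrite ReD; apply: cvgD; [exact: f1|exact: g1].
under eq_fun do rewrite ImD; apply: cvgD; [exact: f2|exact: g2].
Qed.

Lemma ccont_cst (c : R[i]) : ccont (fun _ => c).
Proof. by split=> x; exact: cvg_cst. Qed.

Lemma ccont_real (g : R -> R) : continuous g -> ccont (fun x => (g x)%:C).
Proof. by move=> cg; split=> x; [exact: cg|exact: cvg_cst]. Qed.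

Lemma ccontB f g : ccont f -> ccont g -> ccont (fun x => f x - g x).
Proof.
move=> cf cg; have := ccontD cf (ccontM (ccont_cst (-1)) cg).
by rewrite (_ : (fun x => _) = (fun x => f x - g x))//; apply/funext => x; rewrite mulN1r.
Qed.

Lemma complex_integralE L f : 0 <= L -> ccont f -> csupp L f ->
  complex_integral f = (\int[mu]_(x in `[- L, L]) Re (f x)) +i*
                       (\int[mu]_(x in `[- L, L]) Im (f x)).
Proof.
move=> L0 [f1 f2] sf; rewrite /complex_integral.
by rewrite !(compact_support_integral L0)// => x /sf ->.
Qed.

(** The segment has length [2 * L], and real and imaginary parts are bounded separately; hence
    [4 * L]. *)
Lemma complex_integral_le L M f : 0 <= L -> ccont f -> csupp L f ->
  (forall x, `|x| <= L -> normc (f x) <= M) ->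
  normc (complex_integral f) <= 4 * L * M.
Proof.
move=> L0 cf sf hM; rewrite (complex_integralE L0)//; case: cf => f1 f2.
have LL : - L <= L by rewrite ge0_cp.
apply: le_trans (normc_le_ReIm _) _ => /=.
have H : 4 * L * M = M * (L - - L) + M * (L - - L) by ring.
rewrite H; apply: lerD; apply: segment_integral_le => // x; rewrite -ler_norml => /hM.
  by apply: le_trans; exact: abs_Re_le_normc.
by apply: le_trans; exact: abs_Im_le_normc.
Qed.

Lemma complex_integralD L f g : 0 <= L -> ccont f -> csupp L f ->
  ccont g -> csupp L g ->
  complex_integral (fun x => f x + g x) = complex_integral f + complex_integral g.
Proof.
move=> L0 cf sf cg sg; rewrite !(complex_integralE L0)//; last 2 first.
- exact: ccontD.
- by move=> x Lx; rewrite sf// sg// addr0.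
case: cf cg => f1 f2 [g1 g2].
rewrite [RHS]/= ; apply: complex_eq => /=.
  by rewrite -segment_integralD//; apply: eq_Rintegral => x _; rewrite ReD.
by rewrite -segment_integralD//; apply: eq_Rintegral => x _; rewrite ImD.
Qed.

Lemma complex_integralZ L (a : R[i]) f : 0 <= L -> ccont f -> csupp L f ->
  complex_integral (fun x => a * f x) = a * complex_integral f.
Proof.
move=> L0 cf sf; rewrite !(complex_integralE L0)//; last 2 first.
- by apply: ccontM => //; exact: ccont_cst.
- by move=> x Lx; rewrite sf// mulr0.
case: cf => f1 f2.
have cZ (c : R) (h : R -> R) : continuous h -> continuous (fun x => c * h x).
  by move=> ch x; apply: cvgM; [exact: cvg_cst|exact: ch].
apply: complex_eq; rewrite ?ReM ?ImM /=.
  rewrite -!segment_integralZ// -segment_integralB//; [|exact: cZ..].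
  by apply: eq_Rintegral => x _; rewrite ReM.
rewrite -!segment_integralZ// -segment_integralD//; [|exact: cZ..].
by apply: eq_Rintegral => x _; rewrite ImM.
Qed.

End ComplexIntegral.

Section TransformSeries.
Context {R : realType}.
Implicit Types (f : R -> R[i]) (k L : R) (lambda : R[i]).
Local Notation mu := (@lebesgue_measure R).

Definition cmom k f n : R[i] :=
  rmom k (fun x => Re (f x)) n +i* rmom k (fun x => Im (f x)) n.

Lemma cmomE k f n : cmom k f n = complex_integral (fun x => f x * (x ^+ n * wt (2 * k) x)%:C).
Proof.
rewrite /cmom /rmom /complex_integral; congr (_ +i* _).
  by apply: eq_Rintegral => x _; rewrite ReMr.
by apply: eq_Rintegral => x _; rewrite ImMr.
Qed.

Lemma cmom_le k L f : 0 <= k -> 0 <= L -> ccont f -> csupp L f ->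
  exists2 A, 0 <= A & forall n, normc (cmom k f n) <= A * L ^+ n.
Proof.
move=> k0 L0 cf sf; have k2 : 0 <= 2 * k by rewrite mulr_ge0.
have cw := wt_continuous k2.
have [M1 [M10 hM1]] := bounded_on_segment (- L) L cf.1.
have [M2 [M20 hM2]] := bounded_on_segment (- L) L cf.2.
have [M3 [M30 hM3]] := bounded_on_segment (- L) L cw.
exists (4 * L * ((M1 + M2) * M3)) => [|n].
  by rewrite !mulr_ge0// addr_ge0.
rewrite cmomE.
have -> : 4 * L * ((M1 + M2) * M3) * L ^+ n = 4 * L * ((M1 + M2) * (M3 * L ^+ n)) by ring.
apply: complex_integral_le => //.
- apply: ccontM => //; apply: ccont_real => x.
  by apply: cvgM; [exact: exprn_continuous|exact: cw].
- by move=> x Lx; rewrite sf// mul0r.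
- move=> x xL; rewrite Normc.normcM normc_real normrM.
  apply: ler_pM => //; first exact: normc_ge0.
    apply: le_trans (normc_le_ReIm _) _.
    by apply: lerD; [apply: hM1|apply: hM2]; rewrite -ler_norml.
  rewrite mulrC; apply: ler_pM => //; first by apply: hM3; rewrite -ler_norml.
  by rewrite normrX lerXn2r ?nnegrE.
Qed.

Lemma normc_i : normc 'i%C = 1 :> R.
Proof. by rewrite /= expr0n /= add0r expr1n sqrtr1. Qed.

(** Coefficient of [lambda ^ n] when the series of the kernel at [- lambda] is integrated termwise,
    before division by [dunkl_constant k]. *)
Definition tcoef k f n : R[i] := (- 'i%C) ^+ n * cmom k f n / (gam k n)%:C.

Lemma entire_tcoef k L f : 0 <= k -> 0 <= L -> ccont f -> csupp L f ->
  entire_coef (tcoef k f).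
Proof.
move=> k0 L0 cf sf; have [A A0 hA] := cmom_le k0 L0 cf sf.
apply: (@entire_coef_gam _ _ _ A L) => // n.
by rewrite Normc.normcM normcX normcN normc_i expr1n mul1r.
Qed.

(** Sum and integral may be exchanged because [pser_tail] bounds the tail of the kernel series by
    [C / 2 ^ N] uniformly on [[- L, L]]. *)
Lemma dunkl_integral_pser k L f lambda : 0 <= k -> 0 <= L -> ccont f -> csupp L f ->
  complex_integral
    (fun x : R => f x * dunkl_kernel k (- lambda) x%:C * (dunkl_weight k x)%:C) =
  pser (tcoef k f) lambda.
Proof.
move=> k0 L0 cf sf; have k2 : 0 <= 2 * k by rewrite mulr_ge0.
have cw : ccont (fun x => (wt (2 * k) x)%:C) by apply: ccont_real; exact: wt_continuous.
have cpsi : ccont (fun x : R => dunkl_kernel k (- lambda) x%:C).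
  exact: dunkl_kernel_continuous.
apply: csums_unique (pserP lambda (entire_tcoef k0 L0 cf sf)).
pose a := kernel_coef k (- lambda).
have ha : entire_coef a := entire_kernel_coef (- lambda) k0.
pose P N (x : R) := \sum_(i < N) a i * x%:C ^+ i.
have cX i : ccont (fun x : R => x%:C ^+ i).
  rewrite (_ : (fun x : R => _) = (fun x : R => (x ^+ i)%:C)).
    by apply: ccont_real; exact: exprn_continuous.
  by apply/funext => x; rewrite rmorphXn.
have cP N : ccont (P N).
  rewrite /P; elim: N => [|N IH].
    by under eq_fun do rewrite big_ord0; exact: ccont_cst.
  under eq_fun do rewrite big_ord_recr /=.
  by apply: ccontD => //; apply: ccontM => //; exact: ccont_cst.
have IP N : complex_integral (fun x => f x * P N x * (wt (2 * k) x)%:C) =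
    \sum_(i < N) tcoef k f i * lambda ^+ i.
  elim: N => [|N IH].
    rewrite big_ord0 -(mul0r (complex_integral f)) -(complex_integralZ 0 L0 cf sf).
    by congr complex_integral; apply/funext => x; rewrite /P big_ord0 mulr0 !mul0r.
  rewrite big_ord_recr /= -IH.
  have -> : tcoef k f N * lambda ^+ N = a N * cmom k f N.
    rewrite /a /kernel_coef /tcoef mulrN -mulNr exprMn; ring.
  have c2 : ccont (fun x => f x * (x ^+ N * wt (2 * k) x)%:C).
    apply: ccontM => //; apply: ccont_real => x.
    by apply: cvgM; [exact: exprn_continuous|exact: wt_continuous].
  have s2 : csupp L (fun x => f x * (x ^+ N * wt (2 * k) x)%:C).
    by move=> x Lx; rewrite sf// mul0r.
  rewrite cmomE -(complex_integralZ _ L0)// -(complex_integralD L0)//.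
  - congr complex_integral; apply/funext => x.
    by rewrite /P big_ord_recr /= rmorphM rmorphXn /=; ring.
  - by apply: ccontM => //; apply: ccontM.
  - by move=> x Lx; rewrite sf// !mul0r.
  - by apply: ccontM => //; exact: ccont_cst.
  - by move=> x Lx; rewrite sf// mul0r mulr0.
have [C hC] := pser_tail ha L0.
have [M1 [M10 hM1]] := bounded_on_segment (- L) L cf.1.
have [M2 [M20 hM2]] := bounded_on_segment (- L) L cf.2.
have [M3 [M30 hM3]] := bounded_on_segment (- L) L (wt_continuous k2).
pose B := 4 * L * ((M1 + M2) * M3).
have B0 : 0 <= B by rewrite !mulr_ge0// addr_ge0.
have tail N : normc (\sum_(i < N) tcoef k f i * lambda ^+ i -
    complex_integral (fun x : R => f x * dunkl_kernel k (- lambda) x%:C * (dunkl_weight k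
      x)%:C))
    <= B * C * 2^-1 ^+ N.
  rewrite -IP normcB.
  have -> : complex_integral (fun x : R => f x * dunkl_kernel k (- lambda) x%:C *
    (dunkl_weight k x)%:C)
     - complex_integral (fun x => f x * P N x * (wt (2 * k) x)%:C) =
     complex_integral (fun x => f x * (dunkl_kernel k (- lambda) x%:C - P N x) * (wt (2 * k)
       x)%:C).
    apply/eqP; rewrite subr_eq; apply/eqP; rewrite -(complex_integralD L0).
    - by congr complex_integral; apply/funext => x; rewrite /wt /dunkl_weight; ring.
    - by do 2?apply: ccontM => //; exact: ccontB.
    - by move=> x Lx; rewrite sf// !mul0r.
    - by do 2?apply: ccontM => //.
    - by move=> x Lx; rewrite sf// !mul0r.
  have -> : B * C * 2^-1 ^+ N = 4 * L * ((M1 + M2) * M3 * (C * 2^-1 ^+ N)) by rewrite /B; ring.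
  apply: complex_integral_le => //.
  - by do 2?apply: ccontM => //; exact: ccontB.
  - by move=> x Lx; rewrite sf// !mul0r.
  - move=> x xL; rewrite !Normc.normcM normc_real mulrAC.
    apply: ler_pM; [by rewrite mulr_ge0// normc_ge0|exact: normc_ge0| |].
      apply: ler_pM => //; [exact: normc_ge0| |by apply: hM3; rewrite -ler_norml].
      apply: le_trans (normc_le_ReIm _) _.
      by apply: lerD; [apply: hM1|apply: hM2]; rewrite -ler_norml.
    by rewrite dunkl_kernelE//; apply: hC; rewrite normc_real.
apply: (@squeeze_cvgr _ _ _ _ (fun _ => 0) (geometric (B * C) 2^-1)).
- by apply: nearW => N; rewrite normc_ge0 /= tail.
- exact: cvg_cst.
- by apply: cvg_geometric; rewrite ger0_norm ?invr_ge0// invf_lt1// ltr1n.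
Qed.

Lemma dunkl_transformE k L f lambda : 0 <= k -> 0 <= L -> ccont f -> csupp L f ->
  dunkl_transform k f lambda = ((dunkl_constant k)^-1)%:C * pser (tcoef k f) lambda.
Proof. by move=> k0 L0 cf sf; rewrite /dunkl_transform (dunkl_integral_pser _ k0 L0). Qed.

Lemma dunkl_transform_exp_le k L f : 0 <= k -> 0 <= L -> ccont f -> csupp L f ->
  exists2 C, 0 <= C & forall lambda,
    normc (dunkl_transform k f lambda) <= C * expR (L * `|Im lambda|).
Proof.
move=> k0 L0 cf sf; have k2 : 0 <= 2 * k by rewrite mulr_ge0.
have cw : ccont (fun x => (wt (2 * k) x)%:C) by apply: ccont_real; exact: wt_continuous.
have [M1 [M10 hM1]] := bounded_on_segment (- L) L cf.1.
have [M2 [M20 hM2]] := bounded_on_segment (- L) L cf.2.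
have [M3 [M30 hM3]] := bounded_on_segment (- L) L (wt_continuous k2).
exists (`|(dunkl_constant k)^-1| * (4 * L * ((M1 + M2) * M3 * 2))) => [|lambda].
  by rewrite !mulr_ge0// addr_ge0.
rewrite /dunkl_transform Normc.normcM normc_real -!mulrA ler_wpM2l// !mulrA.
have -> : 4 * L * (M1 + M2) * M3 * 2 * expR (L * `|Im lambda|) =
  4 * L * ((M1 + M2) * M3 * (2 * expR (L * `|Im lambda|))) by ring.
apply: complex_integral_le => //.
- do 2?apply: ccontM => //; exact: dunkl_kernel_continuous.
- by move=> x Lx; rewrite sf// !mul0r.
move=> x xL; rewrite !Normc.normcM normc_real mulrAC.
apply: ler_pM; [by rewrite mulr_ge0// normc_ge0|exact: normc_ge0| |].
  apply: ler_pM => //; [exact: normc_ge0| |by apply: hM3; rewrite -ler_norml].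
  apply: le_trans (normc_le_ReIm _) _.
  by apply: lerD; [apply: hM1|apply: hM2]; rewrite -ler_norml.
apply: le_trans (dunkl_kernel_le _ _ k0) _.
by rewrite ler_wpM2l// ler_expR ImN normrN mulrC ler_wpM2r.
Qed.

End TransformSeries.

(** * Inclusion in the Paley-Wiener space, and determination by moments *)

Section ForwardInclusion.
Context {R : realType}.
Implicit Types (f : R -> R[i]) (k r : R) (lambda : R[i]).
Local Notation mu := (@lebesgue_measure R).

Lemma entire_coefZ (c : R[i]) (a : nat -> R[i]) :
  entire_coef a -> entire_coef (fun n => c * a n).
Proof.
move=> ha rho rho0; have [C hC] := ha rho rho0; exists (normc c * C) => n.
by rewrite Normc.normcM -mulrA ler_wpM2l ?normc_ge0.
Qed.

Lemma pserZ (c : R[i]) (a : nat -> R[i]) z : entire_coef a ->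
  pser (fun n => c * a n) z = c * pser a z.
Proof.
move=> ha; apply: csums_unique (pserP z (entire_coefZ c ha)) _.
have := csumsZ c (pserP z ha).
by under [X in csums X _]funext do rewrite mulrA.
Qed.

Lemma pser_inj (a b : nat -> R[i]) : entire_coef a -> entire_coef b ->
  (forall z, pser a z = pser b z) -> a =1 b.
Proof.
move=> ha hb hab n; apply/eqP; rewrite -subr_eq0; apply/eqP.
have hc : entire_coef (fun n => a n - b n).
  move=> rho rho0; have [C hC] := ha rho rho0; have [D hD] := hb rho rho0.
  exists (C + D) => m; apply: le_trans (lerD (hC m) (hD m)).
  rewrite -mulrDl ler_wpM2r ?exprn_ge0//.
  by apply: le_trans (le_normcD _ _) _; rewrite normcN.
move: n; apply: (pser_eq0 hc) => z; apply: csums_unique (pserP z hc) _.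
rewrite -(subrr (pser a z)) [X in _ - X]hab.
have := csumsD (pserP z ha) (csumsN (pserP z hb)).
by under [X in csums X _]funext do rewrite -mulrBl.
Qed.

Record smooth_csupp r f : Prop := SmoothCsupp {
  smooth_Re : smoothr (fun x => Re (f x));
  smooth_Im : smoothr (fun x => Im (f x));
  smooth_csuppP : csupp r f }.

Lemma smooth_csupp_ccont r f : smooth_csupp r f -> ccont f.
Proof. by move=> [/smoothr_continuous h1 /smoothr_continuous h2 _]; split. Qed.

Lemma smooth_supportedP r f : smooth_supported r f <-> smooth_csupp r f.
Proof.
split=> [[sf clf]|[h1 h2 sf]].
  split.
  - by apply/smoothrP => n x; case: (sf n x).
  - by apply/smoothrP => n x; case: (sf n x).
  - move=> x Lx; apply: contraTeq Lx => fx; rewrite -leNgt ler_norml.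
    by have := clf x (subset_closure (A := [set x | f x != 0]) fx); rewrite /= in_itv.
split=> [n x|].
  by move/smoothrP : h1 => /(_ n x); move/smoothrP : h2 => /(_ n x).
have -> : `[- r, r]%classic = closure `[- r, r]%classic.
  by apply/closure_id; exact: interval_closed.
apply: closure_subset => x /= fx; rewrite in_itv /= -ler_norml.
by rewrite leNgt; apply: contra fx => /sf ->.
Qed.

(** Read on Taylor coefficients: the factor in the moments of [T_k f] is exactly the quotient
    [gam k n.+1 / gam k n], so coefficient [n.+1] of the new transform is [i] times coefficient [n]
    of the old one. *)
Lemma dunkl_transform_operator k r f : 0 <= k -> 0 <= r -> smooth_csupp r f ->
  exists2 g, smooth_csupp r g & forall lambda,
    dunkl_transform k g lambda = 'i%C * lambda * dunkl_transform k f lambda.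
Proof.
move=> k0 r0 hf; have cf := smooth_csupp_ccont hf; case: (hf) => h1 h2 sf.
have s1 : supp_in r (fun x => Re (f x)) by move=> x /sf ->.
have s2 : supp_in r (fun x => Im (f x)) by move=> x /sf ->.
have [g1 [sg1 zg1 m1]] := dunkl_operator_moments k0 r0 h1 s1.
have [g2 [sg2 zg2 m2]] := dunkl_operator_moments k0 r0 h2 s2.
pose g x := g1 x +i* g2 x.
have hg : smooth_csupp r g by split => // x Lx; rewrite /g zg1// zg2.
exists g => // lambda; have cg := smooth_csupp_ccont hg.
rewrite !(dunkl_transformE _ k0 r0)//; last exact: smooth_csuppP hg.
rewrite mulrCA; congr (_ * _).
have cm n : cmom k g n = - (n%:R + 2 * k * (odd n)%:R)%:C * cmom k f n.-1.
  by rewrite /cmom /g /= m1 m2; apply: complex_eq; rewrite -rmorphN ?ReMl ?ImMl.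
have t0 : tcoef k g 0 = 0 by rewrite /tcoef cm /= mulr0 addr0 oppr0 !(mul0r, mulr0).
have tS n : tcoef k g n.+1 = 'i%C * tcoef k f n.
  have g0 : (gam k n)%:C != 0 :> R[i].
    by apply/eqP => -[]; apply/eqP; rewrite gt_eqF ?gam_gt0.
  have s0 : (n.+1%:R + 2 * k * (odd n.+1)%:R)%:C != 0 :> R[i].
    apply/eqP => -[]; apply/eqP; rewrite gt_eqF// ltr_pwDl// mulr_ge0//.
    by rewrite mulr_ge0.
  rewrite /tcoef cm gamS exprS [n.+1.-1]/=.
  rewrite (_ : (gam k n * _)%:C = (gam k n)%:C * (n.+1%:R + 2 * k * (odd n.+1)%:R)%:C)
    ?rmorphM//.
  set s := (n.+1%:R + _)%:C in s0 *; set g' := (gam k n)%:C in g0 *.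
  move: g' g0 s s0 => g' g0 s s0.
  by field; rewrite g0 s0.
have := pserP lambda (entire_tcoef k0 r0 cg (smooth_csuppP hg)).
move/csumsS; rewrite t0 mul0r subr0.
have -> : (fun n => tcoef k g n.+1 * lambda ^+ n.+1) =
  (fun n => 'i%C * lambda * (tcoef k f n * lambda ^+ n)).
  by apply/funext => n; rewrite tS exprS; ring.
move/csums_unique; apply; apply: csumsZ.
exact: pserP (entire_tcoef k0 r0 cf sf).
Qed.

Lemma dunkl_transform_paley_wiener k r f : 0 <= k -> 0 <= r -> smooth_csupp r f ->
  paley_wiener_space r (dunkl_transform k f).
Proof.
move=> k0 r0 hf; have cf := smooth_csupp_ccont hf.
split.
  have ha := entire_tcoef k0 r0 cf (smooth_csuppP hf).
  rewrite (_ : dunkl_transform k f =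
      pser (fun n => ((dunkl_constant k)^-1)%:C * tcoef k f n)).
    by apply: entire_pser; exact: entire_coefZ.
  by apply/funext => z; rewrite (dunkl_transformE _ k0 r0 cf (smooth_csuppP hf)) pserZ.
(* Each power of [z] is traded for one application of the Dunkl operator, which keeps the function
   smooth and supported in [[- r, r]]. *)
have bound n : exists2 C, 0 <= C & forall z,
    normc z ^+ n * normc (dunkl_transform k f z) <= C * expR (r * `|Im z|).
  elim: n f hf {cf} => [|n IH] f hf.
    have [C C0 hC] := dunkl_transform_exp_le k0 r0 (smooth_csupp_ccont hf) (smooth_csuppP hf).
    by exists C => // z; rewrite expr0 mul1r.
  have [g hg gE] := dunkl_transform_operator k0 r0 hf.
  have [C C0 hC] := IH _ hg; exists C => // z.
  apply: le_trans (hC z); rewrite gE (Normc.normcM ('i%C * z)) (Normc.normcM 'i%C) normc_i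
    mul1r exprSr.
  by rewrite mulrA.
move=> n; have [C0 p0 h0] := bound 0%N; have [C1 p1 h1] := bound n.
(* The constant comes from [(1 + |z|) ^ n <= 2 ^ n * (1 + |z| ^ n)]; the added [1] makes it strictly
   positive. *)
have H : 0 < 2 ^+ n * (C0 + C1) + 1 by rewrite ltr_wpDl// mulr_ge0 ?exprn_ge0// addr_ge0.
exists (2 ^+ n * (C0 + C1) + 1) => // z.
have z1 : 0 < (1 + normc z) ^+ n by rewrite exprn_gt0// ltr_pwDl// normc_ge0.
rewrite mulrAC ler_pdivlMr//.
set E := expR _; set N := normc (dunkl_transform k f z).
have N0 : 0 <= N := normc_ge0 _.
apply: le_trans (_ : N * (2 ^+ n * (1 + normc z ^+ n)) <= _).
  rewrite ler_wpM2l//; have [zl|zl] := leP (normc z) 1.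
    apply: le_trans (_ : 2 ^+ n * 1 <= _).
      rewrite mulr1 lerXn2r ?nnegrE//; last by rewrite -[leRHS]/(1 + 1) lerD2l.
      by rewrite addr_ge0// normc_ge0.
    by rewrite ler_wpM2l ?exprn_ge0// lerDl exprn_ge0// normc_ge0.
  apply: le_trans (_ : 2 ^+ n * normc z ^+ n <= _).
    rewrite -exprMn lerXn2r ?nnegrE ?addr_ge0 ?mulr_ge0 ?normc_ge0//.
    by rewrite mulr_natl mulr2n lerD2r ltW.
  by rewrite ler_wpM2l ?exprn_ge0// lerDr.
have e0 : 0 <= E := expR_ge0 _.
have := h0 z; have := h1 z; rewrite expr0 mul1r -/E -/N => b1 b0.
apply: le_trans (_ : 2 ^+ n * (C0 + C1) * E <= _); last by rewrite ler_wpM2r// lerDl.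
rewrite mulrCA -mulrA ler_wpM2l ?exprn_ge0//.
by rewrite mulrDr mulr1 mulrDl lerD// mulrC.
Qed.

(* The powers of a quadratic polynomial that exceeds [1] only near [a]
   concentrate at [a]. *)
Lemma moments_eq0 (G : R -> R) L : 0 <= L -> continuous G -> supp_in L G ->
  (forall n, \int[mu]_x (G x * x ^+ n) = 0) -> forall a, G a <= 0.
Proof.
move=> L0 cG zG hG a; rewrite leNgt; apply/negP => Ga.
have [d d0 hd] : exists2 d, 0 < d & forall x, `|x - a| <= d -> G a / 2 <= G x.
  have /cvgrPdist_le/(_ (G a / 2)) := cG a.
  rewrite divr_gt0// => /(_ isT) /nbhs_ballP[e /= e0 he].
  exists (e / 2); first by rewrite divr_gt0.
  move=> x xd; have := he x; rewrite /ball /= distrC.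
  have xe : `|x - a| < e by apply: le_lt_trans xd _; rewrite ltr_pdivrMr// ltr_pMr// ltr1n.
  by move=> /(_ xe)/ler_normlW; lra.
have aL : `|a| <= L by rewrite leNgt; apply: contraTN Ga => /zG ->; rewrite ltxx.
pose L' := L + d; have L'0 : 0 <= L' by rewrite addr_ge0// ltW.
(* [B] is large enough for [p >= 0] on [[- L', L']], and [p] exceeds [1] exactly where
   [|x - a| < d]. Enlarging [L] to [L'] leaves room for [[a - d / 2, a + d / 2]] even when [a] is
   close to the edge. *)
pose B := (L' + L) ^+ 2 + d ^+ 2.
have B0 : 0 < B by rewrite ltr_wpDl ?sqr_ge0// exprn_gt0.
pose p x := 1 + (d ^+ 2 - (x - a) ^+ 2) / B.
have cp n : continuous (fun x => p x ^+ n).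
  have c1 : continuous p.
    move=> x; apply: cvgD; first exact: cvg_cst.
    apply: cvgM; last exact: cvg_cst.
    apply: cvgB; first exact: cvg_cst.
    have c2 : continuous (fun y : R => y - a) by move=> y; apply: cvgB;
      [exact: cvg_id|exact: cvg_cst].
    by apply: (@continuous_comp _ _ _ (fun y : R => y - a) (fun y => y ^+ 2));
      [exact: c2|exact: exprn_continuous].
  by move=> x; apply: (@continuous_comp _ _ _ p (fun y => y ^+ n));
    [exact: c1|exact: exprn_continuous].
have cGp n m : continuous (fun x => G x * p x ^+ n * x ^+ m).
  by move=> x; apply: cvgM; [apply: cvgM; [exact: cG|exact: cp]|exact: exprn_continuous].
have sL' (h : R -> R) : continuous (fun x => G x * h x) ->
    \int[mu]_x (G x * h x) = \int[mu]_(x in `[- L', L']) (G x * h x).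
  move=> ch; apply: compact_support_integral => // x Lx.
  by rewrite zG ?mul0r//; apply: le_lt_trans Lx; rewrite lerDl ltW.
(* All monomials are carried along because expanding one factor [p] raises the degree by up to
   two. *)
have I0 n m : \int[mu]_(x in `[- L', L']) (G x * p x ^+ n * x ^+ m) = 0.
  elim: n m => [|n IH] m.
    rewrite -[RHS](hG m) (sL' (fun x => x ^+ m)).
      by apply: eq_Rintegral => x _; rewrite expr0 mulr1.
    by move=> x; apply: cvgM; [exact: cG|exact: exprn_continuous].
  pose c0 := 1 + (d ^+ 2 - a ^+ 2) / B; pose c1 := 2 * a / B; pose c2 := - B^-1.
  have E x : G x * p x ^+ n.+1 * x ^+ m = c0 * (G x * p x ^+ n * x ^+ m) +
     c1 * (G x * p x ^+ n * x ^+ m.+1) + c2 * (G x * p x ^+ n * x ^+ m.+2).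
    rewrite /c0 /c1 /c2 [p x ^+ n.+1]exprS {1}/p !exprS; ring.
  have cZ (c : R) (h : R -> R) : continuous h -> continuous (fun x => c * h x).
    by move=> ch x; apply: cvgM; [exact: cvg_cst|exact: ch].
  have cD (h1 h2 : R -> R) : continuous h1 -> continuous h2 -> continuous (fun x => h1 x + h2
    x).
    by move=> ch1 ch2 x; apply: cvgD; [exact: ch1|exact: ch2].
  under eq_Rintegral do rewrite E.
  rewrite segment_integralD; [|by apply: cD; exact: cZ|exact: cZ].
  rewrite segment_integralD; [|exact: cZ|exact: cZ].
  by rewrite !segment_integralZ// !IH !mulr0 !addr0.
have [M [M0 hM]] := bounded_on_segment (- L') L' cG.
pose rho := 1 + (3 / 4) * d ^+ 2 / B.
have rho1 : 1 < rho by rewrite /rho ltrDl divr_gt0// mulr_gt0// exprn_gt0.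
have rho0 : 0 <= rho by rewrite ltW// (lt_trans ltr01).
have p_ge0 x : `|x| <= L' -> 0 <= p x.
  move=> xL; rewrite /p addrC -lerBlDr sub0r ler_pdivlMr// mulN1r /B.
  have : (x - a) ^+ 2 <= (L' + L) ^+ 2.
    rewrite -real_normK ?num_real// lerXn2r ?nnegrE ?(addr_ge0 L'0 L0)//.
    by apply: le_trans (ler_normB _ _) _; exact: lerD.
  by have := sqr_ge0 d; lra.
have p_le1 x : d <= `|x - a| -> p x <= 1.
  move=> xd; rewrite /p gerDl pmulr_lle0 ?invr_gt0// subr_le0.
  by rewrite -[leRHS]real_normK ?num_real// lerXn2r ?nnegrE// ltW.
have p_rho x : `|x - a| <= d / 2 -> rho <= p x.
  move=> xd; rewrite /p /rho lerD2l ler_pM2r ?invr_gt0//.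
  have : (x - a) ^+ 2 <= (d / 2) ^+ 2.
    by rewrite -real_normK ?num_real// lerXn2r ?nnegrE// divr_ge0// ltW.
  have -> : (d / 2) ^+ 2 = d ^+ 2 / 4 by field.
  by lra.
have low n x : - L' <= x <= L' -> - M <= G x * p x ^+ n.
  rewrite -ler_norml => xL; have [xd|xd] := leP `|x - a| d.
    apply: le_trans (_ : 0 <= _); first by rewrite oppr_le0.
    rewrite mulr_ge0 ?exprn_ge0 ?p_ge0//; apply: le_trans (hd x xd).
    by rewrite divr_ge0// ltW.
  suff : `|G x * p x ^+ n| <= M by rewrite ler_norml => /andP[].
  rewrite normrM -[leRHS]mulr1 ler_pM//; first by apply: hM; rewrite -ler_norml.
  by rewrite ger0_norm ?exprn_ge0 ?p_ge0// exprn_ile1 ?p_ge0 ?p_le1// ltW.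
have /ler_normlP[a1 a2] := aL.
(* The integral is [0], yet its integrand is at least [rho ^ n * (G a / 2)] on an interval of length
   [d] and at least [- M] elsewhere. Since [rho ^ n] is unbounded, by Bernoulli's inequality, this
   is contradictory. *)
have key n : rho ^+ n * (G a / 2 * d) <= 2 * M * L'.
  have cn : continuous (fun x => G x * p x ^+ n).
    by move=> x; apply: cvgM; [exact: cG|exact: cp].
  have := I0 n 0%N; under eq_Rintegral do rewrite expr0 mulr1.
  have s1 : - L' <= a - d / 2 by rewrite /L'; lra.
  have s2 : a - d / 2 <= a + d / 2 by lra.
  have s3 : a + d / 2 <= L' by rewrite /L'; lra.
  rewrite (segment_integral_cat s1 (le_trans s2 s3) cn) (segment_integral_cat s2 s3 cn).
  have i1 : - M * (a - d / 2 - - L') <= \int[mu]_(x in `[- L', a - d / 2]) (G x * p x ^+ n).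
    apply: segment_integral_ge => // x /andP[x1 x2]; apply: low; rewrite x1 /=.
    exact: le_trans x2 (le_trans s2 s3).
  have i3 : - M * (L' - (a + d / 2)) <= \int[mu]_(x in `[a + d / 2, L']) (G x * p x ^+ n).
    apply: segment_integral_ge => // x /andP[x1 x2]; apply: low; rewrite x2 andbT.
    exact: le_trans (le_trans s1 s2) x1.
  have i2 : rho ^+ n * (G a / 2) * (a + d / 2 - (a - d / 2)) <=
      \int[mu]_(x in `[a - d / 2, a + d / 2]) (G x * p x ^+ n).
    apply: segment_integral_ge => // x /andP[x1 x2].
    have xd : `|x - a| <= d / 2 by rewrite ler_norml; apply/andP; split; lra.
    rewrite mulrC; apply: ler_pM.
    - by rewrite divr_ge0// ltW.
    - by rewrite exprn_ge0.
    - by apply: hd; apply: le_trans xd _; lra.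
    - by rewrite lerXn2r ?nnegrE ?rho0 ?(le_trans rho0 (p_rho x xd))// p_rho.
  have Ed : a + d / 2 - (a - d / 2) = d by field.
  rewrite Ed in i2.
  have Md : 0 <= M * d by rewrite mulr_ge0// ltW.
  by have := lerD i1 (lerD i2 i3) => /[swap] ->; lra.
have r1 : 0 < rho - 1 by rewrite subr_gt0.
have bern n : 1 + n%:R * (rho - 1) <= rho ^+ n.
  elim: n => [|n IH]; first by rewrite mul0r addr0.
  rewrite exprS -natr1.
  have : rho * (1 + n%:R * (rho - 1)) <= rho * rho ^+ n by rewrite ler_wpM2l.
  apply: le_trans; have : 0 <= n%:R * (rho - 1) * (rho - 1) by rewrite !mulr_ge0// ltW.
  lra.
pose q := G a / 2 * d; have q0 : 0 < q by rewrite mulr_gt0// divr_gt0.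
have [n hn] : exists n : nat, 2 * M * L' / (q * (rho - 1)) < n%:R.
  by exists (Num.truncn (2 * M * L' / (q * (rho - 1)))).+1; exact: truncnS_gt.
have := key n; rewrite leNgt => /negP; apply.
move: hn; rewrite ltr_pdivrMr ?mulr_gt0// => /lt_le_trans; apply.
rewrite -/q mulrCA mulrC; have := bern n => hb.
by rewrite mulrC [_ * q]mulrC (ler_wpM2l (ltW q0))// mulrC; lra.
Qed.

(** The weight is put into the function, and [f] and [- f] are both treated. Away from [0] the
    weight is positive and can be divided out; the value at [0] follows by continuity. *)
Lemma rmom_eq0 k L (f : R -> R) : 0 <= k -> 0 <= L -> continuous f -> supp_in L f ->
  (forall n, rmom k f n = 0) -> forall x, f x = 0.
Proof.
move=> k0 L0 cf zf hf; have k2 : 0 <= 2 * k by rewrite mulr_ge0.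
have H (g : R -> R) : continuous g -> supp_in L g -> (forall n, rmom k g n = 0) ->
    forall x, x != 0 -> g x <= 0.
  move=> cg zg hg x x0.
  have wx : 0 < wt (2 * k) x by rewrite powR_gt0// normr_gt0.
  rewrite -(pmulr_lle0 _ wx).
  apply: (@moments_eq0 (fun x => g x * wt (2 * k) x) L) => //.
  - by move=> y; apply: cvgM; [exact: cg|exact: wt_continuous].
  - by move=> y Ly; rewrite zg// mul0r.
  - move=> n; rewrite -[RHS](hg n); apply: eq_Rintegral => y _.
    by rewrite mulrAC mulrA.
have f0 x : x != 0 -> f x = 0.
  move=> x0; apply/eqP; rewrite eq_le H//= -oppr_le0.
  apply: (H (fun x => - f x)) => //.
  - by move=> y; apply: cvgN; exact: cf.
  - by move=> y Ly; rewrite zf// oppr0.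
  - move=> n; have := hf n; rewrite /rmom => E.
    rewrite -[RHS]oppr0 -[X in - X]E -mulN1r -RintegralZl//.
      by apply: eq_Rintegral => y _; rewrite mulN1r mulNr.
    apply: (@compact_support_integrable _ _ L).
      move=> y; apply: cvgM; first exact: cf.
      by apply: cvgM; [exact: exprn_continuous|exact: wt_continuous].
    by move=> y Ly; rewrite zf// mul0r.
move=> x; have [->|/f0//] := eqVneq x 0.
apply/eqP; apply/negPn/negP => fx0.
have : \forall y \near (0 : R), f y != 0.
  have /cvgr_norm_gt := cf 0; move=> /(_ 0); rewrite normr_gt0 => /(_ fx0).
  by apply: filterS => y; rewrite normr_gt0.
move=> /nbhs_ballP[e /= e0 he].
have := he (e / 2); rewrite /ball /= sub0r normrN gtr0_norm ?divr_gt0//.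
rewrite ltr_pdivrMr// ltr_pMr// ltr1n => /(_ isT).
by rewrite f0 ?eqxx// gt_eqF// divr_gt0.
Qed.

Lemma cmom_inj k r f g : 0 <= k -> 0 <= r -> smooth_csupp r f -> smooth_csupp r g ->
  (forall n, cmom k f n = cmom k g n) -> f = g.
Proof.
move=> k0 r0 hf hg h; have k2 : 0 <= 2 * k by rewrite mulr_ge0.
have H (u v : R -> R) : continuous u -> continuous v -> supp_in r u -> supp_in r v ->
   (forall n, rmom k u n = rmom k v n) -> forall x, u x = v x.
  move=> cu cv zu zv huv x; apply/eqP; rewrite -subr_eq0; apply/eqP.
  have int (w : R -> R) n : continuous w -> supp_in r w ->
      mu.-integrable setT (EFin \o (fun x => w x * (x ^+ n * wt (2 * k) x))).
    move=> cw zw; apply: (@compact_support_integrable _ _ r).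
      move=> y; apply: cvgM; first exact: cw.
      by apply: cvgM; [exact: exprn_continuous|exact: wt_continuous].
    by move=> y Ly; rewrite zw// mul0r.
  apply: (@rmom_eq0 k r (fun x => u x - v x)) => //.
  - by move=> y; apply: cvgB; [exact: cu|exact: cv].
  - by move=> y Ly; rewrite zu// zv// subrr.
  - move=> n; rewrite -(subrr (rmom k u n)) [X in _ - X]huv /rmom -RintegralB//.
    + by apply: eq_Rintegral => y _; rewrite mulrBl.
    + exact: int.
    + exact: int.
case: (hf) (hg) => f1 f2 zf [g1 g2 zg].
apply/funext => x; apply: complex_eq.
- apply: (H (fun x => Re (f x)) (fun x => Re (g x))) => //.
  + exact: smoothr_continuous.
  + exact: smoothr_continuous.
  + by move=> y /zf ->.
  + by move=> y /zg ->.
  + by move=> n; have [] := h n.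
- apply: (H (fun x => Im (f x)) (fun x => Im (g x))) => //.
  + exact: smoothr_continuous.
  + exact: smoothr_continuous.
  + by move=> y /zf ->.
  + by move=> y /zg ->.
  + by move=> n; have [] := h n.
Qed.

End ForwardInclusion.

(** * Integrals over the real line *)

Section LineIntegral.
Context {R : realType}.
Implicit Types (f g h : R -> R) (a b c L M : R).
Local Notation mu := (@lebesgue_measure R).

Definition integrableR f := mu.-integrable setT (EFin \o f).

Lemma integral_oneDsqrV : (\int[mu]_x ((oneDsqr x)^-1)%:E = (pi : R)%:E)%E.
Proof.
rewrite (ge0_symfun_integralT (f := fun x => (oneDsqr x)^-1)).
- have -> : [set x : R | 0 <= x] = `[0, +oo[%classic by rewrite -set_itvcy.
  by rewrite integral0y_oneDsqr -EFinM; congr (_%:E); field.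
- by move=> x; rewrite invr_ge0 (le_trans ler01)// oneDsqr_ge1.
- by move=> x; exact: continuous_oneDsqrV.
- by move=> x; rewrite /oneDsqr /= sqrrN.
Qed.

Lemma oneDsqrV_integrable : integrableR (fun x => (oneDsqr x)^-1).
Proof.
apply/integrableP; split.
  by apply/measurable_EFinP; apply: continuous_measurable_fun; exact: continuous_oneDsqrV.
rewrite [ltLHS](_ : _ = (pi : R)%:E); first by rewrite ltry.
rewrite -integral_oneDsqrV; apply: eq_integral => x _ /=.
by congr (_%:E); rewrite ger0_norm// invr_ge0 (le_trans ler01)// oneDsqr_ge1.
Qed.

Lemma Rintegral_oneDsqrV : \int[mu]_x (oneDsqr x)^-1 = pi :> R.
Proof. by rewrite /Rintegral integral_oneDsqrV. Qed.

Lemma integrableR_le f g : measurable_fun setT f -> integrableR g ->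
  (forall x, `|f x| <= g x) -> integrableR f.
Proof.
move=> mf ig fg; apply: le_integrable ig => //; first exact/measurable_EFinP.
by move=> x _; rewrite lee_fin (le_trans (fg x))// ler_norm.
Qed.

Lemma integrableR_scale c f : integrableR f -> integrableR (fun x => c * f x).
Proof. by move=> /(integrableZl measurableT c). Qed.

Lemma integrableR_add f g : integrableR f -> integrableR g ->
  integrableR (fun x => f x + g x).
Proof. by move=> hf hg; apply: integrableD hf hg. Qed.

Lemma integrableR_oneDsqr C f : continuous f ->
  (forall x, `|f x| <= C * (oneDsqr x)^-1) -> integrableR f.
Proof.
move=> cf hf; apply: (integrableR_le _ _ hf); first exact: continuous_measurable_fun.
exact/integrableR_scale/oneDsqrV_integrable.
Qed.

Lemma RintegralR_le f g : integrableR f -> integrableR g ->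
  (forall x, f x <= g x) -> \int[mu]_x f x <= \int[mu]_x g x.
Proof. by move=> hf hg fg; apply: le_Rintegral. Qed.

Lemma Rintegral_dominated (f_ : nat -> R -> R) f g :
  (forall n, measurable_fun setT (f_ n)) -> integrableR f -> integrableR g ->
  (forall x, f_ n x @[n --> \oo] --> f x) -> (forall n x, `|f_ n x| <= g x) ->
  \int[mu]_x f_ n x @[n --> \oo] --> \int[mu]_x f x.
Proof.
move=> mf hf hg ff fg; apply: fine_cvg; rewrite fineK; last first.
  exact: integrable_fin_num hf.
apply: (@dominated_cvg _ _ _ mu setT measurableT (fun n => EFin \o f_ n) _ (EFin \o g)) => //.
- by move=> n; apply/measurable_EFinP; exact: mf.
- by move=> x _; apply: cvg_EFin; [exact: nearW|exact: ff].
- by move=> n x _; rewrite lee_fin.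
Qed.

Lemma Rintegral_segment_cvg f c (a : nat -> R) : integrableR f ->
  (forall x, \forall n \near \oo, `|x - c| <= a n) ->
  \int[mu]_(x in `[c - a n, c + a n]) f x @[n --> \oo] --> \int[mu]_x f x.
Proof.
move=> hf ha; have mf : measurable_fun setT (EFin \o f) by exact: measurable_int hf.
under eq_fun do rewrite Rintegral_mkcond.
apply: (@Rintegral_dominated _ f (fun x => `|f x|)) => //.
- move=> n; have /measurable_restrict H := measurable_itv `[c - a n, c + a n].
  have := (H _ _ setT (EFin \o f) measurableT).1; rewrite restrict_EFin => H1.
  apply/measurable_EFinP; apply: H1; exact: measurable_funTS.
- exact: integrable_abse hf.
- move=> x; apply: cvg_near_cst; apply: filterS (ha x) => n.
  by rewrite patchE ler_distl => h; rewrite ifT// inE /= in_itv.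
- by move=> n x; rewrite patchE; case: ifP => // _; rewrite normr0.
Qed.

Lemma truncnS_near (x : R) : \forall n \near \oo, `|x| <= n%:R.
Proof.
exists (Num.truncn `|x|).+1 => // n /= h.
by apply: le_trans (ltW (truncnS_gt `|x|)) _; rewrite ler_nat.
Qed.

Lemma Rintegral_segment_le f a b : integrableR f -> (forall x, 0 <= f x) ->
  \int[mu]_(x in `[a, b]) f x <= \int[mu]_x f x.
Proof.
move=> hf f0; rewrite Rintegral_mkcond; apply: RintegralR_le => //.
  rewrite /integrableR -restrict_EFin; apply/integrable_restrict => //.
  by rewrite setTI; exact: integrableS hf.
by move=> x; rewrite patchE; case: ifP.
Qed.

(** By Tonelli, the integrable bound [G] on the partial integrals of [|F|] makes [F] integrable for
    the product measure. *)
Lemma Rintegral_fubini (F : R -> R -> R) (G : R -> R) :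
  measurable_fun setT (fun z : R * R => F z.1 z.2) ->
  (forall x, integrableR (F x)) -> (forall y, integrableR (F ^~ y)) ->
  integrableR G -> (forall y, \int[mu]_x `|F x y| <= G y) ->
  \int[mu]_x \int[mu]_y F x y = \int[mu]_y \int[mu]_x F x y.
Proof.
move=> mF i1 i2 iG hG.
pose f (z : R * R) := (F z.1 z.2)%:E.
have mf : measurable_fun setT f by exact/measurable_EFinP.
have E1 x : (\int[mu]_y F x y)%:E = (\int[mu]_y f (x, y))%E.
  by rewrite /Rintegral fineK//; exact: integrable_fin_num (i1 x).
have E2 y : (\int[mu]_x F x y)%:E = (\int[mu]_x f (x, y))%E.
  by rewrite /Rintegral fineK//; exact: integrable_fin_num (i2 y).
have A2 y : (\int[mu]_x `|f (x, y)| = (\int[mu]_x `|F x y|)%:E)%E.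
  rewrite /Rintegral fineK//; apply: integrable_fin_num => //.
  exact: integrable_abse (i2 y).
have If : (mu \x mu)%E.-integrable setT f.
  apply/integrable21ltyP => //.
  apply: le_lt_trans (_ : (\int[mu]_y (G y)%:E < +oo)%E).
    apply: ge0_le_integral => //.
    - by move=> y _; apply: integral_ge0.
    - have := @measurable_fun_fubini_tonelli_G _ _ _ _ R mu (abse \o f) _ _. rewrite
      /fubini_G; apply => //=.
      exact: measurableT_comp.
    - by have := measurable_int _ iG.
    - by move=> y _; rewrite A2 lee_fin.
  have := integrable_fin_num measurableT iG.
  by rewrite fin_numElt => /andP[].
rewrite /Rintegral; congr fine.
under eq_integral do rewrite [X in (X%:E)%E]/(fine _) E1.
under [RHS]eq_integral do rewrite E2.
exact: Fubini If.
Qed.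

Lemma eq_Rintegral_but1 f g c : measurable_fun setT f ->
  (forall x, x != c -> f x = g x) -> \int[mu]_x f x = \int[mu]_x g x.
Proof.
move=> mf fg; have mD : measurable ([set: R] `\ c) by exact: measurableD.
have mf' : measurable_fun ([set: R] `\ c) (EFin \o f).
  by apply/measurable_EFinP; exact: measurable_funTS.
have E : {in [set: R] `\ c, EFin \o f =1 EFin \o g}.
  by move=> x; rewrite inE /= => -[_ /eqP xc]; rewrite fg.
rewrite /Rintegral -(integral_setD1 mD mf') -[in RHS](@integral_setD1 _ _ c)//.
  by congr fine; apply: eq_integral => x; exact: E.
exact: eq_measurable_fun E mf'.
Qed.

Lemma Rintegral_even_segment f L : 0 <= L -> continuous f -> supp_in L f ->
  (forall x, f (- x) = f x) -> \int[mu]_x f x = 2 * \int[mu]_(x in `[0, L]) f x.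
Proof.
move=> L0 cf zf ef; rewrite (compact_support_integral L0 cf zf) segment_integral_fold//.
by rewrite -segment_integralZ//; apply: eq_Rintegral => x _; rewrite ef; ring.
Qed.

Lemma segment_integral_affine f a b c d : a <= b -> 0 < d -> continuous f ->
  \int[mu]_(x in `[c + d * a, c + d * b]) f x =
  d * \int[mu]_(x in `[a, b]) f (c + d * x).
Proof.
move=> ab d0 cf.
have dc (x : R) : is_derive x 1 (fun x : R => c + d * x) d.
  have := is_derive_addf (is_derive_cstf c x) (is_derive_scalef d (is_derive_idf x)).
  by rewrite mulr1 add0r.
have Dc : derive1 (fun x : R => c + d * x) = cst d.
  by apply/funext => x; rewrite derive1E; case: (dc x).
have cc : continuous (fun x : R => c + d * x) by move=> x; exact: is_derive_continuous (dc x).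
have cfc : continuous (fun x => f (c + d * x)).
  by move=> x; apply: (@continuous_comp _ _ _ (fun x => c + d * x) f); [exact: cc|exact: cf].
rewrite -segment_integralZ//.
have H := @integration_by_substitution_increasing R (fun x => c + d * x) f a b ab.
rewrite /Rintegral H.
- by congr fine; apply: eq_integral => x _; rewrite /= Dc mulrC.
- by move=> x y _ _; rewrite ltrD2l ltr_pM2l.
- by rewrite Dc => x _; exact: cvg_cst.
- by rewrite Dc; exact: is_cvg_cst.
- by rewrite Dc; exact: is_cvg_cst.
- split.
  + by move=> x _; case: (dc x).
  + by apply: cvg_at_right_filter; exact: cc.
  + by apply: cvg_at_left_filter; exact: cc.
- exact: continuous_subspaceT.
Qed.

Lemma Rintegral_affine f c d : 0 < d -> continuous f -> integrableR f ->
  integrableR (fun x => f (c + d * x)) ->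
  \int[mu]_x f x = d * \int[mu]_x f (c + d * x).
Proof.
move=> d0 cf hf hfc.
have h1 : \int[mu]_(x in `[c - d * n%:R, c + d * n%:R]) f x @[n --> \oo] --> \int[mu]_x f x.
  apply: Rintegral_segment_cvg => // x.
  apply: filterS (truncnS_near ((x - c) / d)) => n.
  by rewrite normrM normfV (gtr0_norm d0) ler_pdivrMr// mulrC.
have h2 : d * \int[mu]_(x in `[0 - n%:R, 0 + n%:R]) f (c + d * x) @[n --> \oo] -->
    d * \int[mu]_x f (c + d * x).
  apply: cvgM; first exact: cvg_cst.
  apply: Rintegral_segment_cvg => // x; rewrite subr0; exact: truncnS_near.
apply: cvg_unique h1 _ => //; apply: cvg_trans h2; apply: near_eq_cvg.
apply: nearW => n; rewrite sub0r add0r -segment_integral_affine ?mulrN//.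
by rewrite ge0_cp.
Qed.

Lemma Rintegral_scale f L c : 0 <= L -> continuous f -> supp_in L f -> 0 < c ->
  \int[mu]_x f x = c * \int[mu]_x f (c * x).
Proof.
move=> L0 cf zf c0; rewrite (Rintegral_affine (c := 0) c0 cf).
- by under eq_Rintegral do rewrite add0r.
- exact: compact_support_integrable zf.
- apply: (@compact_support_integrable _ _ (L / c)).
    move=> x; apply: (@continuous_comp _ _ _ (fun x => 0 + c * x) f); last exact: cf.
    by apply: cvgD; [exact: cvg_cst|apply: cvgM; [exact: cvg_cst|exact: cvg_id]].
  move=> x; rewrite ltr_pdivrMr// => h; apply: zf.
  by rewrite add0r normrM gtr0_norm// mulrC.
Qed.

Lemma is_derive_Rintegral (f f' : R -> R -> R) (g : R -> R) (x : R) :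
  (forall y, integrableR (f y)) ->
  (forall y t : R, is_derive y 1 (f^~ t) (f' y t)) ->
  integrableR g -> (forall y t, `|f' y t| <= g t) ->
  is_derive x 1 (fun y => \int[mu]_t f y t) (\int[mu]_t f' x t).
Proof.
move=> hf df hg fg.
have d1f y t : partial1of2 f y t = f' y t.
  by rewrite partial1of2E; case: (df y t).
have Ix : `](x - 1), (x + 1)[%classic x by rewrite /= in_itv /= ltrBlDr ltrDl ltr01.
have intf y : `](x - 1), (x + 1)[%classic y -> mu.-integrable setT (EFin \o f y).
  by move=> _; exact: hf.
have derf y t : `](x - 1), (x + 1)[%classic y -> [set: R] t -> derivable (f^~ t) y 1.
  by move=> _ _; case: (df y t).
have ub y t : `](x - 1), (x + 1)[%classic y -> [set: R] t ->
    `|partial1of2 f y t| <= g t by rewrite d1f.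
have g0 t : 0 <= g t by apply: le_trans (fg 0 t).
have E := @differentiation_under_integral R _ _ mu f setT measurableT _ _ _ Ix intf derf g g0
  hg ub.
have D := @derivable_under_integral R _ _ mu f setT measurableT _ _ _ Ix intf derf g g0 hg ub.
apply: DeriveDef; first exact: D.
by rewrite -derive1E [LHS]E; apply: eq_Rintegral => t _; exact: d1f.
Qed.

End LineIntegral.

(** * Transmutation *)

Section WeylTransform.
Context {R : realType}.
Implicit Types (f g : R -> R) (a e L x t : R).
Local Notation mu := (@lebesgue_measure R).

Definition rad x t := Num.sqrt (x ^+ 2 + t ^+ 2).

Lemma radC x t : rad x t = rad t x. Proof. by rewrite /rad addrC. Qed.

Lemma rad_ge x t : `|x| <= rad x t.
Proof. by rewrite -sqrtr_sqr ler_wsqrtr// lerDl sqr_ge0. Qed.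

Lemma rad0 x : rad x 0 = `|x|.
Proof. by rewrite /rad expr0n addr0 sqrtr_sqr. Qed.

Lemma rad_ge0 x t : 0 <= rad x t. Proof. exact: sqrtr_ge0. Qed.

Lemma rad_scale x t : rad x (`|x| * t) = `|x| * rad 1 t.
Proof.
rewrite /rad exprMn real_normK ?num_real// -[X in X + _]mulr1 -mulrDr.
by rewrite sqrtrM ?sqr_ge0// sqrtr_sqr expr1n.
Qed.

Lemma continuous_rad x : continuous (rad x).
Proof.
move=> t; apply: (@continuous_comp _ _ _ (fun t : R => x ^+ 2 + t ^+ 2) (@Num.sqrt R)).
  by apply: cvgD; [exact: cvg_cst|exact: exprn_continuous].
exact: sqrt_continuous.
Qed.

Lemma continuous_rad_comp g x : continuous g -> continuous (fun t => g (rad x t)).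
Proof. by move=> cg t; apply: continuous_comp; [exact: continuous_rad|exact: cg]. Qed.

Lemma evs_norm L g x : evs L g -> g `|x| = g x.
Proof. by move=> hg; case: (ger0P x) => // _; rewrite (evs_even hg). Qed.

(** In the chain rule the factor [x / rad x t] meets [rad x t * Sg (rad x t)], so no quotient is
    left. For [t = 0], where [rad] has a corner, evenness turns [g (rad y 0)] into [g y]. *)
Lemma is_derive_rad_comp L g Sg x t : evs L g -> evs L Sg ->
  (forall y : R, is_derive y 1 g (y * Sg y)) ->
  is_derive x 1 (fun y => g (rad y t)) (x * Sg (rad x t)).
Proof.
move=> hg hS dg; have [->|t0] := eqVneq t 0.
  rewrite rad0 (evs_norm _ hS) (_ : (fun y => _) = g); first exact: dg.
  by apply/funext => y; rewrite rad0 (evs_norm _ hg).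
have p0 : 0 < x ^+ 2 + t ^+ 2 by rewrite ltr_wpDl ?sqr_ge0// exprn_even_gt0.
have r0 : 0 < rad x t by rewrite sqrtr_gt0.
have d2 : is_derive x 1 (fun y => y ^+ 2 + t ^+ 2) (2 * x).
  have := is_derive_addf (is_derive_mulf (is_derive_idf x) (is_derive_idf x)) (is_derive_cstf
    (t ^+ 2) x).
  by move/is_derive_eqr; apply; ring.
have := is_derive_compf (g := rad^~ t) (dg (rad x t))
  (is_derive_compf (g := fun y => y ^+ 2 + t ^+ 2) (is_derive1_sqrt p0) d2).
move/is_derive_eqr; apply; rewrite -/(rad x t).
by field; rewrite gt_eqF.
Qed.

(** In the variable [u = x ^ 2] this is, up to a constant, the Weyl fractional integral of order
    [(e + 1) / 2]. *)
Definition weyl e g x := \int[mu]_t (wt e t * g (rad x t)).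

Lemma weyl_integrand_continuous e g x : 0 <= e -> continuous g ->
  continuous (fun t => wt e t * g (rad x t)).
Proof.
by move=> e0 cg t; apply: cvgM; [exact: wt_continuous|exact: continuous_rad_comp].
Qed.

Lemma weyl_segment e L g x : 0 <= e -> 0 <= L -> evs L g ->
  weyl e g x = \int[mu]_(t in `[- L, L]) (wt e t * g (rad x t)).
Proof.
move=> e0 L0 hg; apply: compact_support_integral => //.
  exact: weyl_integrand_continuous (evs_continuous hg).
move=> t Lt; rewrite (evs_supp hg) ?mulr0// ger0_norm ?rad_ge0//.
by apply: lt_le_trans Lt _; rewrite radC rad_ge.
Qed.

(** In other words the Weyl transform commutes with [g |-> Sg], as fractional integration commutes
    with [d/du]. *)
Lemma is_derive_weyl e L g Sg x : 0 <= e -> 0 <= L -> evs L g -> evs L Sg ->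
  (forall y : R, is_derive y 1 g (y * Sg y)) ->
  is_derive x 1 (weyl e g) (x * weyl e Sg x).
Proof.
move=> e0 L0 hg hS dg.
have cS := evs_continuous hS; have cg := evs_continuous hg.
have cw := wt_continuous e0.
have [M1 [M10 hM1]] := bounded_on_segment (- L) L cS.
have [M2 [M20 hM2]] := bounded_on_segment (- L) L cw.
have bS y : `|Sg y| <= M1.
  have [yL|yL] := leP `|y| L; first by apply: hM1; rewrite -ler_norml.
  by rewrite (evs_supp hS)// normr0.
rewrite (_ : weyl e g = (fun y => \int[mu]_(t in `[- L, L]) (wt e t * g (rad y t))));
  last first.
  by apply/funext => y; rewrite (weyl_segment _ e0 L0 hg).
rewrite (weyl_segment _ e0 L0 hS) -segment_integralZ; last exact: weyl_integrand_continuous.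
apply: (@is_derive_segment_integral _ _ (fun y t => y * (wt e t * Sg (rad y t))) _ _ _ ((`|x|
  + 1) * (M2 * M1))).
- by rewrite !mulr_ge0// addr_ge0.
- by move=> y; exact: weyl_integrand_continuous.
- move=> y t; have := is_derive_scalef (wt e t) (is_derive_rad_comp y t hg hS dg).
  by move/is_derive_eqr; apply; ring.
- move=> y t yx tL; rewrite !normrM; apply: ler_pM => //.
    by rewrite -[y](subrK x); apply: le_trans (ler_normD _ _) _; rewrite addrC lerD2l ltW.
  by apply: ler_pM => //; exact: hM2.
Qed.

(** Smoothness is an induction over all even [g] at once, since the derivative brings in the
    transform of [Sg]. The support is kept because [rad x t >= |x|]. *)
Lemma evs_weyl e L g : 0 <= e -> 0 <= L -> evs L g -> evs L (weyl e g).
Proof.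
move=> e0 L0 hg; split.
- move=> n; elim: n g hg => [|n IH] g hg; have [Sg hS dg] := evs_sdiv L0 hg.
    by move=> x; exact: is_derive_continuous (is_derive_weyl x e0 L0 hg hS dg).
  exists (fun x => x * weyl e Sg x); first by move=> x; exact: is_derive_weyl hS dg.
  by apply: Ck_mul; [exact: Ck_id|exact: IH].
- by move=> x; apply: eq_Rintegral => t _; rewrite /rad sqrrN.
- move=> x Lx; rewrite -[RHS](mul0r (fine (mu setT))) -Rintegral_cst//.
  apply: eq_Rintegral => t _; rewrite (evs_supp hg) ?mulr0// ger0_norm ?rad_ge0//.
  exact: lt_le_trans Lx (rad_ge x t).
Qed.

(* [\int_R |t|^e (1 + t^2)^(- (a + e + 2) / 2) dt] *)
Definition weyl_integrand e N t := wt e t * oneDsqr t `^ (- (N / 2)).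
Definition weyl_const a e := \int[mu]_t weyl_integrand e (a + e + 2) t.

Lemma oneDsqr_gt0 t : 0 < oneDsqr t.
Proof. by rewrite (lt_le_trans ltr01)// oneDsqr_ge1. Qed.

Lemma is_derive_oneDsqr_powR (s : R) t :
  is_derive t 1 (fun u => oneDsqr u `^ s) (2 * t * s * oneDsqr t `^ (s - 1)).
Proof.
have d2 : is_derive t 1 (@oneDsqr R) (2 * t).
  have := is_derive_addf (is_derive_cstf 1 t) (is_derive_mulf (is_derive_idf t)
    (is_derive_idf t)).
  by move/is_derive_eqr; apply; ring.
have := is_derive_compf (is_derive1_powR s (oneDsqr_gt0 t)) d2.
by move/is_derive_eqr; apply; ring.
Qed.

Lemma weyl_integrand_bound a e t : 0 <= a -> 0 <= e ->
  0 <= weyl_integrand e (a + e + 2) t <= (oneDsqr t)^-1.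
Proof.
move=> a0 e0; rewrite /weyl_integrand mulr_ge0 ?powR_ge0//=.
have Q0 := oneDsqr_gt0 t; have Qn : oneDsqr t != 0 by rewrite gt_eqF.
(* The first factor compensates [|t| ^ e <= (1 + t^2) ^ (e / 2)], the second is at most [1], and the
   third is the bound. *)
have -> : oneDsqr t `^ (- ((a + e + 2) / 2)) =
    oneDsqr t `^ (- (e / 2)) * oneDsqr t `^ (- (a / 2)) * (oneDsqr t)^-1.
  rewrite -[(oneDsqr t)^-1]powR_inv1 ?ltW// -!powRD ?Qn ?implybT//.
  by congr (_ `^ _); field.
rewrite !mulrA -[leRHS]mul1r ler_pM2r ?invr_gt0//.
rewrite -[leRHS]mulr1; apply: ler_pM; rewrite ?mulr_ge0 ?powR_ge0//; last first.
  rewrite -[leRHS](powRr0 (oneDsqr t)) ler_powR ?oneDsqr_ge1//.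
  by rewrite oppr_le0 divr_ge0.
rewrite powRN ler_pdivrMr ?powR_gt0// mul1r.
rewrite /wt (_ : `|t| `^ e = (t ^+ 2) `^ (e / 2)).
  by apply: ge0_ler_powR; rewrite ?nnegrE ?divr_ge0 ?sqr_ge0 ?(ltW Q0)// /oneDsqr lerDr.
by rewrite -[t ^+ 2]real_normK ?num_real// -powR_mulrn// -powRrM mulrC divfK.
Qed.

Lemma weyl_integrand_continuous' e N : 0 <= e -> continuous (weyl_integrand e N).
Proof.
move=> e0 t; apply: cvgM; first exact: wt_continuous.
exact: is_derive_continuous (is_derive_oneDsqr_powR _ t).
Qed.

Lemma weyl_integrand_integrable a e : 0 <= a -> 0 <= e ->
  integrableR (weyl_integrand e (a + e + 2)).
Proof.
move=> a0 e0; apply: (@integrableR_oneDsqr _ 1).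
  exact: weyl_integrand_continuous'.
move=> t; have /andP[h0 h1] := weyl_integrand_bound t a0 e0.
by rewrite ger0_norm// mul1r.
Qed.

Lemma weyl_const_gt0 a e : 0 <= a -> 0 <= e -> 0 < weyl_const a e.
Proof.
move=> a0 e0; have iw := weyl_integrand_integrable a0 e0.
apply: lt_le_trans (_ : \int[mu]_(t in `[1, 2]) weyl_integrand e (a + e + 2) t <= _);
  last first.
  by apply: Rintegral_segment_le => // t; case/andP: (weyl_integrand_bound t a0 e0).
pose N := a + e + 2; have N0 : 0 <= N by rewrite !addr_ge0.
(* [5] is the value of [1 + t^2] at the right end of [[1, 2]]; on this segment [|t| ^ e >= 1]. *)
have m0 : 0 < (5 : R) `^ (- (N / 2)) by rewrite powR_gt0.
apply: lt_le_trans m0 _.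
have -> : (5 : R) `^ (- (N / 2)) = 5 `^ (- (N / 2)) * (2 - 1) by ring.
apply: segment_integral_ge => [||t /andP[t1 t2]]; first by rewrite ler1n.
  exact: weyl_integrand_continuous'.
rewrite /weyl_integrand -[leLHS]mul1r; apply: ler_pM => //; rewrite ?powR_ge0//.
  rewrite /wt ger0_norm ?(le_trans ler01)// -[leLHS](powRr0 t).
  by rewrite ler_powR.
rewrite !powRN lef_pV2 ?posrE ?powR_gt0 ?oneDsqr_gt0//.
apply: ge0_ler_powR; rewrite ?nnegrE ?divr_ge0 ?(ltW (oneDsqr_gt0 t))//.
by rewrite /oneDsqr; nra.
Qed.

End WeylTransform.

Section WeylMoments.
Context {R : realType}.
Implicit Types (f g h : R -> R) (a b c e L x t : R).
Local Notation mu := (@lebesgue_measure R).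

Lemma wtM b x y : wt b (x * y) = wt b x * wt b y.
Proof. by rewrite /wt normrM powRM. Qed.

Lemma oneDsqr_rad t : rad 1 t = Num.sqrt (oneDsqr t).
Proof. by rewrite /rad /oneDsqr expr1n. Qed.

Lemma rad1_gt0 t : 0 < rad 1 t.
Proof. by rewrite oneDsqr_rad sqrtr_gt0 oneDsqr_gt0. Qed.

Lemma moment_integrable b h L : 0 <= b -> continuous h -> supp_in L h ->
  integrableR (fun x => wt b x * h x).
Proof.
move=> b0 ch zh; apply: (@compact_support_integrable _ _ L).
  exact: mom_continuous.
by move=> x Lx; rewrite zh// mulr0.
Qed.

Lemma moment_scale b c h L : 0 <= b -> 0 <= L -> 0 < c -> continuous h -> supp_in L h ->
  \int[mu]_x (wt b x * h (x * c)) = c `^ (- (b + 1)) * \int[mu]_x (wt b x * h x).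
Proof.
move=> b0 L0 c0 ch zh.
have cn : c != 0 by rewrite gt_eqF.
rewrite (@Rintegral_scale _ (fun x => wt b x * h x) L c)//; last 2 first.
- exact: mom_continuous.
- by move=> x Lx; rewrite zh// mulr0.
have chc : continuous (fun x => h (x * c)) by exact: continuous_mulr_comp.
have zhc : supp_in (L / c) (fun x => h (x * c)).
  by move=> x; rewrite ltr_pdivrMr// => Lx; apply: zh; rewrite normrM (gtr0_norm c0).
under [in RHS]eq_Rintegral do rewrite /= wtM -mulrA (mulrC c).
rewrite RintegralZl//; last exact: moment_integrable zhc.
have E : c `^ (- (b + 1)) * (c * wt b c) = 1.
  rewrite /wt (gtr0_norm c0) -[X in _ * (X * _)](powRr1 (ltW c0)) -!powRD ?cn ?implybT//.
  by rewrite (_ : - (b + 1) + (1 + b) = 0) ?powRr0//; ring.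
by rewrite (mulrA c) mulrA E mul1r.
Qed.

(** Substituting [t = |x| s] turns the double integral into that of [|x| ^ (a + e + 1) * |s| ^ e * g
    (x * sqrt (1 + s^2))]. After Fubini, rescaling [x] separates the variables, and the integral in
    [s] is [weyl_const a e]. *)
Lemma weyl_moment a e L g : 0 <= a -> 0 <= e -> 0 <= L -> evs L g ->
  \int[mu]_x (wt a x * weyl e g x) =
  weyl_const a e * \int[mu]_x (wt (a + e + 1) x * g x).
Proof.
move=> a0 e0 L0 hg; pose b := a + e + 1.
have b0 : 0 <= b by rewrite !addr_ge0.
have cg := evs_continuous hg; have zg := evs_supp hg.
pose F x t := wt b x * (wt e t * g (x * rad 1 t)).
have cgN : continuous (fun x => `|g x|) by move=> x; apply: cvg_norm; exact: cg.
have zgN : supp_in L (fun x => `|g x|) by move=> x /zg ->; rewrite normr0.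
(* Stated for any [h] because it is used twice: with [g] for the value, and with [|g|] for the
   dominating function in Fubini. *)
have J h : continuous h -> supp_in L h -> forall t,
    \int[mu]_x (wt b x * (wt e t * h (x * rad 1 t))) =
    weyl_integrand e (a + e + 2) t * \int[mu]_x (wt b x * h x).
  move=> ch zh t; under eq_Rintegral do rewrite mulrCA.
  have r0 := rad1_gt0 t.
  rewrite RintegralZl//; last first.
    apply: (@moment_integrable _ _ (L / rad 1 t)) => //.
      exact: (@continuous_mulr_comp _ h).
    by move=> x; rewrite ltr_pdivrMr// => Lx; apply: zh; rewrite normrM (gtr0_norm r0).
  rewrite (moment_scale b0 L0 r0 ch zh) mulrA; congr (_ * _).
  rewrite /weyl_integrand; congr (_ * _).
  rewrite oneDsqr_rad -powR12_sqrt ?(ltW (oneDsqr_gt0 t))// -powRrM.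
  by congr (_ `^ _); rewrite /b; field.
have iF2 t : integrableR (F ^~ t).
  apply: (@moment_integrable _ (fun x => wt e t * g (x * rad 1 t)) (L / rad 1 t)) => //.
    by move=> x; apply: cvgM; [exact: cvg_cst|exact: continuous_mulr_comp].
  by move=> x; rewrite ltr_pdivrMr ?rad1_gt0// => Lx;
    rewrite zg ?mulr0// normrM (gtr0_norm (rad1_gt0 t)).
have cF x : continuous (F x).
  move=> t; apply: cvgM; first exact: cvg_cst.
  apply: cvgM; first exact: wt_continuous.
  apply: (@continuous_comp _ _ _ (fun t => x * rad 1 t) g); last exact: cg.
  by apply: cvgM; [exact: cvg_cst|exact: continuous_rad].
have iF1 x : integrableR (F x).
  have [->|x0] := eqVneq x 0.
    have -> : F 0 = cst 0.
      by apply/funext => t; rewrite /F /wt normr0 powR0 ?mul0r// gt_eqF// ltr_wpDl// addr_ge0.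
    exact: integrable0.
  apply: (@compact_support_integrable _ _ (L / `|x|)) => // t.
  rewrite ltr_pdivrMr ?normr_gt0// => Lt; rewrite /F zg ?mulr0//.
  rewrite normrM mulrC (ger0_norm (rad_ge0 _ _)); apply: lt_le_trans Lt _.
  by rewrite ler_wpM2r// radC rad_ge.
have mF : measurable_fun setT (fun z : R * R => F z.1 z.2).
  have m1 h : continuous h -> measurable_fun setT (fun z : R * R => h z.1).
    by move=> ch; apply: measurableT_comp => //; exact: continuous_measurable_fun.
  have m2 h : continuous h -> measurable_fun setT (fun z : R * R => h z.2).
    by move=> ch; apply: measurableT_comp => //; exact: continuous_measurable_fun.
  apply: measurable_funM; first by apply: m1; exact: wt_continuous.
  apply: measurable_funM; first by apply: m2; exact: wt_continuous.
  apply: (measurableT_comp (f := g)); first exact: continuous_measurable_fun.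
  by apply: measurable_funM => //; apply: m2; exact: continuous_rad.
have iG : integrableR (fun t => weyl_integrand e (a + e + 2) t * \int[mu]_x (wt b x * `|g x|)).
  under eq_fun do rewrite mulrC.
  exact/integrableR_scale/weyl_integrand_integrable.
have FG t : \int[mu]_x `|F x t| <= weyl_integrand e (a + e + 2) t * \int[mu]_x (wt b x * `|g
  x|).
  rewrite -J// le_eqVlt; apply/orP; left; apply/eqP; apply: eq_Rintegral => x _.
  by rewrite /F !normrM !(ger0_norm (wt_ge0 _ _)).
have := Rintegral_fubini mF iF1 iF2 iG FG.
under [in RHS]eq_Rintegral do rewrite J//.
rewrite RintegralZr//; last exact: weyl_integrand_integrable.
(* The substitution [t = |x| s] degenerates at [x = 0], a null set. *)
move=> <-; apply: (@eq_Rintegral_but1 _ _ _ 0).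
  apply: continuous_measurable_fun; apply: mom_continuous => //.
  exact: evs_continuous (evs_weyl e0 L0 hg).
move=> x x0; rewrite /weyl (@Rintegral_scale _ _ L `|x|) ?normr_gt0//; last 2 first.
- exact: weyl_integrand_continuous.
- move=> t Lt; rewrite zg ?mulr0// ger0_norm ?rad_ge0//.
  by apply: lt_le_trans Lt _; rewrite radC rad_ge.
have E t : wt e (`|x| * t) * g (rad x (`|x| * t)) = wt e x * (wt e t * g (x * rad 1 t)).
  rewrite wtM rad_scale {1}/wt normr_id -/(wt e x) -mulrA; congr (_ * (_ * _)).
  rewrite -(evs_norm (x * rad 1 t) hg) normrM (ger0_norm (rad_ge0 1 t)).
  by [].
under eq_Rintegral do rewrite E.
have xn : `|x| != 0 by rewrite normr_eq0.
have iH : integrableR (fun t => wt e t * g (x * rad 1 t)).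
  have := integrableR_scale ((wt b x)^-1) (iF1 x).
  rewrite /F; under eq_fun do rewrite mulKf ?powR_eq0 ?(negbTE xn)//.
  by [].
rewrite RintegralZl// /F [in RHS]RintegralZl// !mulrA; congr (_ * _).
rewrite /wt /b -[X in _ * X * _](powRr1 (normr_ge0 x)) -!powRD ?xn ?implybT//.
by congr (_ `^ _); ring.
Qed.

(** The recurrence of the Beta function, [weyl_const a e] being [B ((e + 1) / 2, (a + 1) / 2)]. It
    comes from integrating the derivative of [- t * weyl_integrand e (a + e + 2) t], a function that
    tends to [0] at infinity. *)
Lemma weyl_const_rec a e : 0 <= a -> 0 <= e ->
  (a + 1) * weyl_const a e = (a + e + 2) * weyl_const (a + 2) e.
Proof.
move=> a0 e0; pose N := a + e + 2.
have a20 : 0 <= a + 2 by rewrite addr_ge0.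
have i1 := weyl_integrand_integrable a0 e0.
have i2 := weyl_integrand_integrable a20 e0.
have c1 : continuous (weyl_integrand e (a + e + 2)) by exact: weyl_integrand_continuous'.
have c2 : continuous (weyl_integrand e (a + 2 + e + 2)) by exact: weyl_integrand_continuous'.
pose H t := (a + 1) * weyl_integrand e (a + e + 2) t - N * weyl_integrand e (a + 2 + e + 2) t.
have cZ (c : R) h : continuous h -> continuous (fun t => c * h t).
  by move=> ch t; apply: cvgM; [exact: cvg_cst|exact: ch].
have cH : continuous H.
  by move=> t; apply: cvgB; [exact: cZ|exact: cZ].
have iH : integrableR H.
  have := integrableR_add (integrableR_scale (a + 1) i1) (integrableR_scale (- N) i2).
  by under eq_fun do rewrite mulNr.
suff H0 : \int[mu]_t H t = 0.
  apply/eqP; rewrite -subr_eq0 -H0 /weyl_const -!RintegralZl//.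
  rewrite -RintegralB//; [exact: integrableR_scale|exact: integrableR_scale].
pose F t := - (t * weyl_integrand e N t).
have EH (n : nat) : \int[mu]_(t in `[- n%:R, n%:R]) H t = 2 * F n%:R.
  rewrite segment_integral_fold//.
  have HN t : H (- t) = H t by rewrite /H /weyl_integrand wtN /oneDsqr sqrrN.
  under eq_Rintegral do rewrite HN -mulr2n -mulr_natl.
  rewrite segment_integralZ//; congr (_ * _).
  transitivity (F n%:R - F 0); last by rewrite /F mul0r oppr0 subr0.
  apply: (@FTC_segment _ F H) => //.
  - move=> t; apply: cvgN; apply: cvgM; first exact: cvg_id.
    exact: weyl_integrand_continuous'.
  - move=> t /andP[t0 _].
    have := is_deriveN (is_derive_mulf (is_derive_idf t) (is_derive_mulf (is_derive_wt e t0)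
      (is_derive_oneDsqr_powR (- (N / 2)) t))).
    move/is_derive_eqr; apply.
    have Q0 := oneDsqr_gt0 t.
    have -> : wt e t = t * wt (e - 1) t.
      by rewrite -[X in X * _]expr1 wtX// subrK.
    rewrite /H /weyl_integrand.
    have -> : wt e t = t * wt (e - 1) t.
      by rewrite -[X in X * _]expr1 wtX// subrK.
    have -> : - ((a + 2 + e + 2) / 2) = - (N / 2) - 1 by rewrite /N; field.
    have -> : oneDsqr t `^ (- (N / 2)) = oneDsqr t * oneDsqr t `^ (- (N / 2) - 1).
      rewrite -[X in _ = X * _](powRr1 (ltW Q0)) -powRD ?(gt_eqF Q0) ?implybT//.
      by congr (_ `^ _); ring.
    by rewrite /N /oneDsqr; field.
have : \int[mu]_(t in `[0 - n%:R, 0 + n%:R]) H t @[n --> \oo] --> \int[mu]_t H t.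
  by apply: Rintegral_segment_cvg => // x; rewrite subr0; exact: truncnS_near.
under eq_fun do rewrite sub0r add0r EH.
move/cvg_lim => /(_ (@Rhausdorff R)) <-; apply/cvg_lim => //.
apply/cvgrPdist_le => eps eps0; near=> n.
have n0 : 0 < n%:R :> R by rewrite ltr0n; near: n; exact: nbhs_infty_gt.
rewrite sub0r normrN normrM /F normrN normrM (ger0_norm (ler0n _ _)) (ger0_norm (ler0n _ _)).
have /andP[w0 w1] := weyl_integrand_bound n%:R a0 e0.
rewrite (ger0_norm w0); apply: le_trans (_ : 2 * (n%:R * (n%:R ^+ 2)^-1) <= _).
  rewrite ler_wpM2l// ler_wpM2l//; apply: le_trans w1 _.
  by rewrite lef_pV2 ?posrE ?oneDsqr_gt0 ?exprn_gt0// /oneDsqr lerDr.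
have -> : 2 * (n%:R * (n%:R ^+ 2)^-1) = 2 / n%:R :> R.
  by field; rewrite (gt_eqF n0).
rewrite ler_pdivrMr// -ler_pdivrMl// mulrC.
near: n; exact: nbhs_infty_ger.
Unshelve. all: by end_near. Qed.

End WeylMoments.

Section Transmutation.
Context {R : realType}.
Implicit Types (f g h p q : R -> R) (a b c e k L x t : R).
Local Notation mu := (@lebesgue_measure R).

Lemma momE L a g : 0 <= L -> 0 <= a -> evs L g ->
  \int[mu]_x (wt a x * g x) = 2 * mom L a g.
Proof.
move=> L0 a0 hg; apply: Rintegral_even_segment => //.
- exact: mom_continuous (evs_continuous hg).
- by move=> x Lx; rewrite (evs_supp hg)// mulr0.
- by move=> x; rewrite wtN (evs_even hg).
Qed.

Lemma mom_weyl L a e g : 0 <= L -> 0 <= a -> 0 <= e -> evs L g ->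
  mom L a (weyl e g) = weyl_const a e * mom L (a + e + 1) g.
Proof.
move=> L0 a0 e0 hg; have b0 : 0 <= a + e + 1 by rewrite !addr_ge0.
apply: (@mulfI _ 2) => //.
rewrite -(momE L0 a0 (evs_weyl e0 L0 hg)).
by rewrite (weyl_moment a0 e0 L0 hg) (momE L0 b0 hg) mulrCA.
Qed.

(** The product of the factors given by [mom_sdiv] along the exponents [a], [a + 2], ..., one for
    each application of [g |-> Sg]. *)
Definition sfac n a : R := \prod_(j < n) - (a + 2 * j%:R + 1).

Lemma sfacS n a : sfac n.+1 a = sfac n a * - (a + 2 * n%:R + 1).
Proof. by rewrite /sfac big_ord_recr. Qed.

Lemma sfac_shift n a : (a + 1) * sfac n (a + 2) = sfac n a * (a + 2 * n%:R + 1).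
Proof.
elim: n => [|n IH]; first by rewrite /sfac !big_ord0; ring.
rewrite !sfacS mulrA IH -[n.+1%:R]natr1; ring.
Qed.

Lemma sfac_neq0 n a : 0 <= a -> sfac n a != 0.
Proof.
move=> a0; elim: n => [|n IH]; first by rewrite /sfac big_ord0 oner_eq0.
by rewrite sfacS mulf_neq0// oppr_eq0 gt_eqF// ltr_wpDl// addr_ge0// mulr_ge0.
Qed.

Lemma sdiv_iter n L p : 0 <= L -> evs L p ->
  exists2 pn, evs L pn & forall a, 0 <= a ->
    mom L (a + 2 * n%:R) pn = sfac n a * mom L a p.
Proof.
move=> L0 hp; elim: n => [|n [pn hn En]].
  by exists p => // a a0; rewrite mulr0 addr0 /sfac big_ord0 mul1r.
have [Sp hS dS] := evs_sdiv L0 hn; exists Sp => // a a0.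
have a1 : 0 <= a + 2 * n%:R by rewrite addr_ge0// mulr_ge0.
rewrite -[n.+1%:R]natr1 mulrDr mulr1 addrA (mom_sdiv L0 a1 hn hS dS) En// sfacS; ring.
Qed.

(** Under the Weyl transform the moment of exponent [2 k + i] becomes one of exponent [i + 2 N], and
    the [N] divisions bring it down to exponent [i], with total factor [K i]. The quotients
    [K i / K 0] are recognised by a recurrence that they share with [gam k n / gam 0 n]. The scalar
    [s] is left free for the normalising constants. *)
Lemma transmutation_real k (s : R) : 0 <= k -> forall L f, 0 <= L ->
  smoothr f -> supp_in L f ->
  exists g, [/\ smoothr g, supp_in L g & forall n,
    rmom k g n = s * (gam k n / gam 0 n) * rmom 0 f n].
Proof.
move=> k0 L f L0 sf zf.
(* [e] solves [2 k + e + 1 = 2 N], so the Weyl integral has order [N - k]; [N > k + 1] ensures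
   [0 <= e]. *)
pose N := (Num.truncn k).+2; pose e := 2 * (N%:R - k) - 1.
have e0 : 0 <= e.
  have := truncnS_gt k; rewrite /e /N -[_.+2%:R]natr1; lra.
have [p [q [hp hq fE]]] := even_odd_split L0 sf zf.
have [pn hpn Ep] := sdiv_iter N L0 hp.
have [qn hqn Eq] := sdiv_iter N L0 hq.
pose K i := weyl_const (2 * k + i) e * sfac N i.
have ki i : 0 <= i -> 0 <= 2 * k + i by move=> i0; rewrite addr_ge0// mulr_ge0.
have KE g gn : evs L g -> evs L gn ->
    (forall a, 0 <= a -> mom L (a + 2 * N%:R) gn = sfac N a * mom L a g) ->
    forall i, 0 <= i -> mom L (2 * k + i) (weyl e gn) = K i * mom L i g.
  move=> hg hgn E i i0; rewrite mom_weyl ?ki// /K -mulrA; congr (_ * _).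
  have -> : 2 * k + i + e + 1 = i + 2 * N%:R by rewrite /e; ring.
  exact: E.
have Krec i : 0 <= i -> (i + 1) * K (i + 2) = (2 * k + i + 1) * K i.
  move=> i0; have := weyl_const_rec (ki i i0) e0; have := sfac_shift N i.
  rewrite /K -addrA.
  have -> : 2 * k + i + e + 2 = i + 2 * N%:R + 1 by rewrite /e; ring.
  have n0 : i + 2 * N%:R + 1 != 0 by rewrite gt_eqF// ltr_wpDl// addr_ge0// mulr_ge0.
  move=> h1 h2; apply: (mulfI n0).
  rewrite -(addrA (2 * k) i 2) in h2.
  rewrite mulrCA (mulrA _ (weyl_const _ _)) -h2 mulrCA h1; ring.
have g00 n : gam 0 n != 0 :> R by rewrite gt_eqF// gam_gt0.
(* [m + odd m] is the even exponent that [rmom_split] attaches to the moment of order [m]; it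
   increases by [2] only when [m] passes from even to odd. *)
have KG m : K (m + odd m)%:R * gam 0 m = K 0 * gam k m.
  elim: m => [|m IH]; first by rewrite !gam0.
  rewrite !gamS /= mulr0 mul0r addr0; case: (boolP (odd m)) IH => om /=.
    rewrite !addn1 addn0 mulr0 addr0 => IH; rewrite mulrA IH; ring.
  rewrite addn0 => IH; rewrite addn1 -addn2 natrD mulr1.
  have := Krec m%:R (ler0n _ _) => h.
  rewrite -[m.+1%:R]natr1.
  transitivity ((m%:R + 1) * K (m%:R + 2) * gam 0 m); first by ring.
  by rewrite h -mulrA IH; ring.
have K0 : K 0 != 0 by rewrite mulf_neq0 ?sfac_neq0// gt_eqF// weyl_const_gt0// ki.
exists (fun x => s / K 0 * (weyl e pn x + x * weyl e qn x)).
have hP := evs_weyl e0 L0 hpn; have hQ := evs_weyl e0 L0 hqn.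
split.
- move=> n; apply: Ck_mul; first exact: Ck_cst.
  apply: Ck_add; first exact: (evs_smooth hP).
  by apply: Ck_mul; [exact: Ck_id|exact: (evs_smooth hQ)].
- by move=> x Lx; rewrite (evs_supp hP)// (evs_supp hQ)// mulr0 addr0 mulr0.
move=> n.
have -> : rmom k (fun x => s / K 0 * (weyl e pn x + x * weyl e qn x)) n =
    s / K 0 * rmom k (fun x => weyl e pn x + x * weyl e qn x) n.
  rewrite /rmom -RintegralZl//.
    by apply: eq_Rintegral => x _; rewrite -!mulrA.
  apply: (@compact_support_integrable _ _ L).
    move=> x; apply: cvgM.
      apply: cvgD; first exact: (evs_continuous hP).
      by apply: cvgM; [exact: cvg_id|exact: (evs_continuous hQ)].
    by apply: cvgM; [exact: exprn_continuous|apply: wt_continuous; rewrite mulr_ge0].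
  by move=> x Lx; rewrite (evs_supp hP)// (evs_supp hQ)// mulr0 addr0 mul0r.
have -> : f = (fun x => p x + x * q x) by apply/funext.
rewrite (rmom_split _ k0 L0 hP hQ) (rmom_split _ (lexx 0) L0 hp hq).
have R1 i j r : K i * gam 0 n = K 0 * gam k n -> j = i ->
   s / K 0 * (2 * (K i * r)) = s * (gam k n / gam 0 n) * (2 * r).
  move=> h _; have -> : K i = K 0 * gam k n / gam 0 n by rewrite -h mulfK.
  by field; rewrite K0 g00.
have := KG n; case: (odd n) => /= hn; rewrite mulr0 add0r.
  by rewrite (KE q qn)//; apply: R1 => //; rewrite -hn addn1.
by rewrite (KE p pn)//; apply: R1 => //; rewrite -hn addn0.
Qed.

Lemma dunkl_constant_gt0 k : 0 <= k -> 0 < dunkl_constant k.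
Proof.
move=> k0; have k2 : 0 <= 2 * k by rewrite mulr_ge0.
pose h x := expR (- (x ^+ 2 / 2)) * wt (2 * k) x.
have ch : continuous h.
  move=> x; apply: cvgM; last exact: wt_continuous.
  apply: (@continuous_comp _ _ _ (fun x : R => - (x ^+ 2 / 2)) expR);
    last exact: continuous_expR.
  by apply: cvgN; apply: cvgM; [exact: exprn_continuous|exact: cvg_cst].
have h0 x : 0 <= h x by rewrite mulr_ge0 ?expR_ge0 ?powR_ge0.
pose n := (Num.truncn k).+1; pose m := n.+1.
have kn : k <= n%:R by exact/ltW/truncnS_gt.
have ih : integrableR h.
  apply: (@integrableR_oneDsqr _ ((2 * m%:R) ^+ m)) => // x.
  have Q0 := oneDsqr_gt0 x.
  rewrite (ger0_norm (h0 x)) ler_pdivlMr//.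
  have b1 : wt (2 * k) x <= oneDsqr x ^+ n.
    rewrite /wt powRrM powR_mulrn// real_normK ?num_real//.
    apply: le_trans (_ : oneDsqr x `^ k <= _).
      by apply: ge0_ler_powR; rewrite ?nnegrE ?sqr_ge0 ?(ltW Q0)// /oneDsqr lerDr.
    by rewrite -powR_mulrn ?(ltW Q0)// ler_powR ?oneDsqr_ge1.
  (* From [1 + u <= exp u] at [u = x^2 / (2 m)], raised to the power [m]. As [m = n.+1], one factor
     [1 + x^2] remains after the weight is absorbed. *)
  have b2 : oneDsqr x ^+ m <= (2 * m%:R) ^+ m * expR (x ^+ 2 / 2).
    have m0 : 0 < 2 * m%:R :> R by rewrite mulr_gt0// ltr0n.
    have -> : x ^+ 2 / 2 = m%:R * (x ^+ 2 / (2 * m%:R)) by field; rewrite pnatr_eq0.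
    rewrite expRM_natl -exprMn; apply: lerXn2r; rewrite ?nnegrE ?(ltW Q0)//.
    rewrite -ler_pdivrMl//; apply: le_trans (expR_ge1Dx _).
    rewrite mulrC /oneDsqr mulrDl lerD2r mul1r invf_le1//.
    by rewrite -[leLHS]mul1r; apply: ler_pM => //; rewrite ?ler1n.
  rewrite /h -mulrA mulrC expRN ler_pdivrMr ?expR_gt0//.
  apply: le_trans b2; rewrite exprSr ler_wpM2r// ltW//.
rewrite /dunkl_constant.
apply: lt_le_trans (_ : \int[mu]_(x in `[1, 2]) h x <= _); last exact: Rintegral_segment_le.
apply: lt_le_trans (_ : expR (- 2) * (2 - 1) <= _); first by rewrite mulr_gt0 ?expR_gt0//; lra.
apply: segment_integral_ge => // [|x /andP[x1 x2]]; first by rewrite ler1n.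
rewrite -[leLHS]mulr1; apply: ler_pM => //; rewrite ?expR_ge0//.
  by rewrite ler_expR lerN2; nra.
rewrite /wt ger0_norm ?(le_trans ler01)// -[leLHS](powRr0 x).
by rewrite ler_powR.
Qed.

Lemma transmutation k r (f : R -> R[i]) : 0 <= k -> 0 <= r -> smooth_csupp r f ->
  exists2 g, smooth_csupp r g & forall lambda, dunkl_transform k g lambda = dunkl_transform 0
    f lambda.
Proof.
move=> k0 r0 hf; have cf := smooth_csupp_ccont hf; case: (hf) => h1 h2 sf.
have s1 : supp_in r (fun x => Re (f x)) by move=> x /sf ->.
have s2 : supp_in r (fun x => Im (f x)) by move=> x /sf ->.
(* Converts the normalisation of [dunkl_transform 0] into that of [dunkl_transform k]. *)
pose s := dunkl_constant k / dunkl_constant (0 : R).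
have ck := dunkl_constant_gt0 k0; have c0 := @dunkl_constant_gt0 0 (lexx 0).
have [g1 [sg1 zg1 m1]] := transmutation_real s k0 r0 h1 s1.
have [g2 [sg2 zg2 m2]] := transmutation_real s k0 r0 h2 s2.
pose g x := g1 x +i* g2 x.
have hg : smooth_csupp r g by split => // x Lx; rewrite /g zg1// zg2.
exists g; first exact: hg.
move=> lambda; have cg := smooth_csupp_ccont hg.
rewrite (dunkl_transformE _ k0 r0 cg (smooth_csuppP hg)).
rewrite (dunkl_transformE _ (lexx 0) r0 cf sf).
rewrite -!pserZ; last 2 first.
- exact: entire_tcoef (smooth_csuppP hf).
- exact: entire_tcoef (smooth_csuppP hg).
apply: (congr1 (pser ^~ lambda)); apply/funext => n.
have cm : cmom k g n = (s * (gam k n / gam 0 n))%:C * cmom 0 f n.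
  by rewrite /cmom /g /= m1 m2; apply: complex_eq; rewrite ?ReMl ?ImMl.
have g0 : gam k n != 0 by rewrite gt_eqF ?gam_gt0.
have g00 : gam 0 n != 0 :> R by rewrite gt_eqF ?gam_gt0.
have ck' : dunkl_constant k != 0 by rewrite gt_eqF.
have c0' : dunkl_constant 0 != 0 :> R by rewrite gt_eqF.
have nz (x : R) : x != 0 -> x%:C != 0 by apply: contra_neq => -[].
rewrite /tcoef cm /s !rmorphM !fmorphV /=.
move: (nz _ g0) (nz _ g00) (nz _ ck') (nz _ c0').
move: (gam k n)%:C (gam 0 n)%:C (dunkl_constant k)%:C (dunkl_constant 0)%:C => A B C D A0 B0
  C0 D0.
by field; rewrite A0 B0 C0 D0.
Qed.

End Transmutation.

(** * Goursat's theorem for closed forms *)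

Section Goursat.
Context {R : realType}.
Implicit Types (a c s t x y : R).
Local Notation mu := (@lebesgue_measure R).
Variables P Q : R -> R -> R.

(* The form [P dx + Q dy] is differentiable with [dP/dy = dQ/dx]. *)
Definition closed_form := forall x0 y0, exists p1 p2 q2 : R, forall e, 0 < e ->
  exists2 d, 0 < d & forall x y, `|x - x0| <= d -> `|y - y0| <= d ->
    `|P x y - P x0 y0 - p1 * (x - x0) - p2 * (y - y0)| <= e * (`|x - x0| + `|y - y0|) /\
    `|Q x y - Q x0 y0 - p2 * (x - x0) - q2 * (y - y0)| <= e * (`|x - x0| + `|y - y0|).

(** The integral of [P dx + Q dy] counterclockwise around [[a, a + s] x [c, c + t]]. *)
Definition boundary_integral a c s t :=
  \int[mu]_(x in `[a, a + s]) (P x c - P x (c + t)) +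
  \int[mu]_(y in `[c, c + t]) (Q (a + s) y - Q a y).

Hypothesis PQ : closed_form.

Lemma lipschitz_continuous (f : R -> R) :
  (forall x0, exists2 K, 0 < K & exists2 d, 0 < d &
     forall x, `|x - x0| <= d -> `|f x - f x0| <= K * `|x - x0|) -> continuous f.
Proof.
move=> H x0; have [K K0 [d d0 hd]] := H x0.
suff : f x @[x --> x0] --> f x0 by [].
apply/cvgrPdist_le => e e0; apply/nbhs_ballP.
exists (Num.min d (e / K)) => /=; first by rewrite lt_min d0 divr_gt0.
move=> x; rewrite /ball /= lt_min => /andP[h1 h2].
rewrite distrC; rewrite distrC in h1; rewrite distrC in h2.
apply: le_trans (hd x (ltW h1)) _.
by rewrite mulrC -ler_pdivlMr// ltW.
Qed.

Lemma continuous_P y : continuous (P^~ y).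
Proof.
apply: lipschitz_continuous => x0; have [p1 [p2 [q2 H]]] := PQ x0 y.
have [d d0 hd] := H 1 ltr01; exists (1 + `|p1|); first by rewrite ltr_pwDl.
exists d => // x xd; have [|h _] := hd x y xd; first by rewrite subrr normr0 ltW.
rewrite subrr normr0 mulr0 subr0 addr0 mul1r in h.
rewrite -[P x y - P x0 y](subrK (p1 * (x - x0))).
by apply: le_trans (ler_normD _ _) _; rewrite mulrDl mul1r lerD// normrM.
Qed.

Lemma continuous_Q x : continuous (Q x).
Proof.
apply: lipschitz_continuous => y0; have [p1 [p2 [q2 H]]] := PQ x y0.
have [d d0 hd] := H 1 ltr01; exists (1 + `|q2|); first by rewrite ltr_pwDl.
exists d => // y yd; have [|//|_ h] := hd x y; first by rewrite subrr normr0 ltW.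
rewrite subrr normr0 mulr0 subr0 add0r mul1r in h.
rewrite -[Q x y - Q x y0](subrK (q2 * (y - y0))).
by apply: le_trans (ler_normD _ _) _; rewrite mulrDl mul1r lerD// normrM.
Qed.

Let cPP c t : continuous (fun x => P x c - P x (c + t)).
Proof. by move=> x; apply: cvgB; exact: continuous_P. Qed.

Let cQQ a s : continuous (fun y => Q (a + s) y - Q a y).
Proof. by move=> x; apply: cvgB; exact: continuous_Q. Qed.

Lemma boundary_integral_split a c s t : 0 <= s -> 0 <= t ->
  boundary_integral a c s t =
  boundary_integral a c (s / 2) (t / 2) +
  boundary_integral (a + s / 2) c (s / 2) (t / 2) +
  boundary_integral a (c + t / 2) (s / 2) (t / 2) +
  boundary_integral (a + s / 2) (c + t / 2) (s / 2) (t / 2).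
Proof.
move=> s0 t0; rewrite /boundary_integral.
have s2 : s / 2 + s / 2 = s by field.
have t2 : t / 2 + t / 2 = t by field.
rewrite -!(addrA a) -!(addrA c) s2 t2.
have as1 : a <= a + s / 2 by rewrite lerDl divr_ge0.
have as2 : a + s / 2 <= a + s by rewrite lerD2l ler_pdivrMr// ler_peMr// ler1n.
have ct1 : c <= c + t / 2 by rewrite lerDl divr_ge0.
have ct2 : c + t / 2 <= c + t by rewrite lerD2l ler_pdivrMr// ler_peMr// ler1n.
have cP y : continuous (P^~ y) := @continuous_P y.
have cQ x : continuous (Q x) := @continuous_Q x.
rewrite !segment_integralB//.
rewrite !(segment_integral_cat as1 as2 (cP _)) !(segment_integral_cat ct1 ct2 (cQ _)).
ring.
Qed.

Lemma boundary_integral_quarter a c s t : 0 <= s -> 0 <= t ->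
  exists ac : R * R, [/\ (ac.1 = a \/ ac.1 = a + s / 2), (ac.2 = c \/ ac.2 = c + t / 2) &
    `|boundary_integral a c s t| / 4 <= `|boundary_integral ac.1 ac.2 (s / 2) (t / 2)|].
Proof.
move=> s0 t0; have := boundary_integral_split a c s0 t0.
set B := boundary_integral a c s t; set B1 := boundary_integral a c _ _.
set B2 := boundary_integral _ c _ _; set B3 := boundary_integral a _ _ _.
set B4 := boundary_integral _ _ _ _ => E.
have [h1|h1] := leP (`|B| / 4) `|B1|; first by exists (a, c); split => //=; left.
have [h2|h2] := leP (`|B| / 4) `|B2|; first by exists (a + s / 2, c); split => //=;
  [right|left].
have [h3|h3] := leP (`|B| / 4) `|B3|; first by exists (a, c + t / 2); split => //=;
  [left|right].
exists (a + s / 2, c + t / 2); split => /=; [by right|by right|].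
rewrite -/B4 leNgt; apply/negP => h4.
have : `|B| <= `|B1| + `|B2| + `|B3| + `|B4|.
  rewrite E; do 3?[apply: le_trans (ler_normD _ _) _; apply: lerD => //].
lra.
Qed.

(** The affine part of a closed form integrates to [0] around the rectangle. What is left is at most
    [e * (s + t)] on each of the four sides. *)
Lemma boundary_integral_small x0 y0 : forall e, 0 < e -> exists2 d, 0 < d &
  forall a c s t, 0 <= s <= d -> 0 <= t <= d -> a <= x0 <= a + s -> c <= y0 <= c + t ->
    `|boundary_integral a c s t| <= 2 * e * (s + t) ^+ 2.
Proof.
move=> e e0; have [p1 [p2 [q2 H]]] := PQ x0 y0; have [d d0 hd] := H e e0.
exists d => // a c s t /andP[s0 sd] /andP[t0 td] /andP[ax xa] /andP[cy yc].
have loc x : a <= x <= a + s -> `|x - x0| <= s.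
  by move=> /andP[x1 x2]; rewrite ler_norml; apply/andP; split; lra.
have loc2 y : c <= y <= c + t -> `|y - y0| <= t.
  by move=> /andP[x1 x2]; rewrite ler_norml; apply/andP; split; lra.
have eP x y : a <= x <= a + s -> c <= y <= c + t ->
    `|P x y - P x0 y0 - p1 * (x - x0) - p2 * (y - y0)| <= e * (s + t).
  move=> hx hy; have [|/=|h _] := hd x y; [exact: le_trans (loc _ hx) sd|exact: le_trans
    (loc2 _ hy) td|].
  by apply: le_trans h _; rewrite ler_wpM2l ?(ltW e0)// lerD// ?loc// loc2.
have eQ x y : a <= x <= a + s -> c <= y <= c + t ->
    `|Q x y - Q x0 y0 - p2 * (x - x0) - q2 * (y - y0)| <= e * (s + t).
  move=> hx hy; have [|/=|_ h] := hd x y; [exact: le_trans (loc _ hx) sd|exact: le_trans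
    (loc2 _ hy) td|].
  by apply: le_trans h _; rewrite ler_wpM2l ?(ltW e0)// lerD// ?loc// loc2.
have ccst (r : R) : continuous (fun _ : R => r) by move=> x; exact: cvg_cst.
have as1 : a <= a + s by rewrite lerDl.
have ct1 : c <= c + t by rewrite lerDl.
have mI (r b h : R) : 0 <= h -> \int[mu]_(x in `[b, b + h]) (cst r x) = r * h.
  by move=> h0; rewrite segment_integral_cst ?lerDl// addrAC subrr add0r.
(* The contributions [p2 * t * s] and [p2 * s * t] of the mixed partial derivative cancel; adding
   them in leaves differences of Taylor remainders. *)
have -> : boundary_integral a c s t =
   \int[mu]_(x in `[a, a + s]) (P x c - P x (c + t) + p2 * t) +
   \int[mu]_(y in `[c, c + t]) (Q (a + s) y - Q a y - p2 * s).
  rewrite [X in _ = X + _]segment_integralD// [X in _ = _ + X]segment_integralB//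
    /boundary_integral.
  rewrite (mI (p2 * t) a s s0) (mI (p2 * s) c t t0); ring.
have -> : 2 * e * (s + t) ^+ 2 = 2 * (e * (s + t)) * (a + s - a) + 2 * (e * (s + t)) * (c + t
  - c) by ring.
apply: le_trans (ler_normD _ _) _; apply: lerD; apply: segment_integral_le => //.
- by move=> x; apply: cvgD; [exact: cPP|exact: cvg_cst].
- move=> x hx; have h1 := eP x c hx; have h2 := eP x (c + t) hx.
  have -> : P x c - P x (c + t) + p2 * t =
    (P x c - P x0 y0 - p1 * (x - x0) - p2 * (c - y0)) -
    (P x (c + t) - P x0 y0 - p1 * (x - x0) - p2 * (c + t - y0)) by ring.
  rewrite mulr_natl mulr2n; apply: le_trans (ler_normB _ _) _.
  by apply: lerD; [apply: h1|apply: h2]; rewrite ?lexx ?ct1.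
- by move=> x; apply: cvgB; [exact: cQQ|exact: cvg_cst].
- move=> y hy; have h1 := eQ (a + s) y _ hy; have h2 := eQ a y _ hy.
  have -> : Q (a + s) y - Q a y - p2 * s =
    (Q (a + s) y - Q x0 y0 - p2 * (a + s - x0) - q2 * (y - y0)) -
    (Q a y - Q x0 y0 - p2 * (a - x0) - q2 * (y - y0)) by ring.
  rewrite mulr_natl mulr2n; apply: le_trans (ler_normB _ _) _.
  by apply: lerD; [apply: h1|apply: h2]; rewrite ?lexx ?as1.
Qed.

Lemma nested_halving (a : nat -> R) (w : R) : 0 <= w ->
  (forall n, a n <= a n.+1 <= a n + w * 2^-1 ^+ n.+1) ->
  exists x0, forall n, a n <= x0 <= a n + w * 2^-1 ^+ n.
Proof.
move=> w0 ha.
have half n : w * 2^-1 ^+ n = w * 2^-1 ^+ n.+1 + w * 2^-1 ^+ n.+1.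
  by rewrite exprS; field.
have nd : nondecreasing_seq a by apply/nondecreasing_seqP => n; case/andP: (ha n).
have ub n m : (n <= m)%N -> a m + w * 2^-1 ^+ m <= a n + w * 2^-1 ^+ n.
  elim: m => [|m IH]; first by rewrite leqn0 => /eqP ->.
  rewrite leq_eqVlt => /predU1P[->//|]; rewrite ltnS => /IH; apply: le_trans.
  have /andP[_ h] := ha m.
  by rewrite [leRHS](_ : _ = a m + w * 2^-1 ^+ m.+1 + w * 2^-1 ^+ m.+1) ?lerD2r// (half m)
    addrA.
have p n : 0 <= w * 2^-1 ^+ n by rewrite mulr_ge0// exprn_ge0// invr_ge0.
have B n m : a m <= a n + w * 2^-1 ^+ n.
  have [mn|/ltnW nm] := leqP m n.
    by apply: le_trans (nd _ _ mn) _; rewrite lerDl.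
  by apply: le_trans (ub _ _ nm); rewrite lerDl.
have cv : cvgn a.
  by apply: nondecreasing_is_cvgn => //; exists (a 0%N + w * 2^-1 ^+ 0) => _ [m _ <-]; exact: B.
exists (limn a) => n; apply/andP; split; first exact: nondecreasing_cvgn_le.
by apply: limr_le => //; apply: nearW => m; exact: B.
Qed.

(** Bisection: some quarter keeps at least a fourth of the modulus at each step, while near the
    common point of the nested rectangles the local bound also shrinks like [4 ^ - n], with an
    arbitrarily small constant. *)
Lemma goursat a c s t : 0 <= s -> 0 <= t -> boundary_integral a c s t = 0.
Proof.
move=> s0 t0; pose w n (r : R) := r * 2^-1 ^+ n.
have w0 n r : 0 <= r -> 0 <= w n r.
  by move=> r0; rewrite mulr_ge0// exprn_ge0// invr_ge0.
have wS n r : w n r / 2 = w n.+1 r by rewrite /w exprSr mulrA.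
pose next n (ac ac' : R * R) := [/\ (ac'.1 = ac.1 \/ ac'.1 = ac.1 + w n.+1 s),
    (ac'.2 = ac.2 \/ ac'.2 = ac.2 + w n.+1 t) &
    `|boundary_integral ac.1 ac.2 (w n s) (w n t)| / 4 <=
    `|boundary_integral ac'.1 ac'.2 (w n.+1 s) (w n.+1 t)|].
have step n ac : {ac' | next n ac ac'}.
  apply: cid; have := @boundary_integral_quarter ac.1 ac.2 _ _ (w0 n s s0) (w0 n t t0).
  by rewrite !wS.
pose fix u n := if n is n'.+1 then sval (step n' (u n')) else (a, c).
have uS n : next n (u n) (u n.+1) := svalP (step n (u n)).
have low n : `|boundary_integral a c s t| * 4^-1 ^+ n <=
    `|boundary_integral (u n).1 (u n).2 (w n s) (w n t)|.
  elim: n => [|n IH]; first by rewrite /w !expr0 !mulr1.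
  have [_ _ h] := uS n; apply: le_trans h.
  by rewrite exprSr mulrA ler_pM2r// invr_gt0.
have [|x0 hx0] := @nested_halving (fun n => (u n).1) s s0.
  move=> n; have [[->|->] _ _] := uS n; rewrite lexx ?andbT/=.
    by rewrite lerDl; exact: w0.
  by rewrite lerDl; exact: w0.
have [|y0 hy0] := @nested_halving (fun n => (u n).2) t t0.
  move=> n; have [_ [->|->] _] := uS n; rewrite lexx ?andbT/=.
    by rewrite lerDl; exact: w0.
  by rewrite lerDl; exact: w0.
apply/eqP; rewrite -normr_le0; apply/ler_addgt0Pr => e e0; rewrite add0r.
(* Chosen so that the local estimate with [e / K] comes out below [e]; the [1] keeps [K]
   positive. *)
pose K := 2 * (s + t) ^+ 2 + 1.
have K0 : 0 < K by rewrite ltr_wpDl// mulr_ge0// sqr_ge0.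
have [d d0 hd] := boundary_integral_small x0 y0 (divr_gt0 e0 K0).
have [n hn] : exists n, w n (s + t) <= d.
  have : w n (s + t) @[n --> \oo] --> (0 : R).
    by apply: cvg_geometric; rewrite ger0_norm ?invr_ge0// invf_lt1// ltr1n.
  move/cvgrPdist_le => /(_ d d0)[n _ /(_ n (leqnn _))].
  rewrite sub0r normrN ger0_norm; first by exists n.
  exact/w0/addr_ge0.
have wD : w n (s + t) = w n s + w n t by rewrite /w mulrDl.
have b1 : w n s <= d by apply: le_trans hn; rewrite wD lerDl w0.
have b2 : w n t <= d by apply: le_trans hn; rewrite wD lerDr w0.
have := hd (u n).1 (u n).2 (w n s) (w n t).
rewrite !w0//= b1 b2 => /(_ isT isT (hx0 n) (hy0 n)) h.
have := le_trans (low n) h; rewrite -wD /w exprMn -exprM mulnC exprM.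
have -> : (2^-1 ^+ 2 : R) = 4^-1 by field.
rewrite mulrA ler_pM2r ?exprn_gt0 ?invr_gt0// => h'.
apply: le_trans h' _.
rewrite (_ : 2 * (e / K) * (s + t) ^+ 2 = e * (2 * (s + t) ^+ 2 / K)); last by ring.
by rewrite ler_piMr ?(ltW e0)// ler_pdivrMr// mul1r lerDl.
Qed.

End Goursat.

(** * Fourier inversion and the case k = 0 *)

Section FourierInversion.
Context {R : realType}.
Implicit Types (f : R -> R) (e s t x r C T : R).
Local Notation mu := (@lebesgue_measure R).

(** As [T] grows this tends to [e / (e^2 + s^2)], which is [pi] times the Poisson kernel. *)
Definition abel_kernel e T s : R :=
  \int[mu]_(x in `[0, T]) (expR (- e * x) * cos (s * x)).

Definition abel_prim e s x : R :=
  expR (- e * x) * (s * sin (s * x) - e * cos (s * x)) / (e ^+ 2 + s ^+ 2).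

Lemma continuous_scaled_cos s : continuous (fun x : R => cos (s * x)).
Proof.
move=> x; apply: (@continuous_comp _ _ _ (fun x : R => s * x) cos); last exact: continuous_cos.
by apply: cvgM; [exact: cvg_cst|exact: cvg_id].
Qed.

Lemma continuous_scaled_expR s : continuous (fun x : R => expR (s * x)).
Proof.
move=> x; apply: (@continuous_comp _ _ _ (fun x : R => s * x) expR);
  last exact: continuous_expR.
by apply: cvgM; [exact: cvg_cst|exact: cvg_id].
Qed.

Lemma sqrD_gt0 e s : 0 < e -> 0 < e ^+ 2 + s ^+ 2.
Proof. by move=> e0; rewrite ltr_pwDl ?exprn_gt0 ?sqr_ge0. Qed.

Lemma abel_kernelE e T s : 0 < e -> 0 <= T ->
  abel_kernel e T s = abel_prim e s T + e / (e ^+ 2 + s ^+ 2).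
Proof.
move=> e0 T0; have q0 := sqrD_gt0 s e0.
have dA x : is_derive x 1 (abel_prim e s) (expR (- e * x) * cos (s * x)).
  have d1 : is_derive x 1 (fun x : R => expR (- e * x)) (expR (- e * x) * (- e * 1)).
    by apply: (is_derive_compf (f := expR) (g := fun x => - e * x)); exact: is_derive_scalef.
  have d2 : is_derive x 1 (fun x : R => sin (s * x)) (cos (s * x) * (s * 1)).
    by apply: (is_derive_compf (f := sin) (g := fun x => s * x)); exact: is_derive_scalef.
  have d3 : is_derive x 1 (fun x : R => cos (s * x)) (- sin (s * x) * (s * 1)).
    by apply: (is_derive_compf (f := cos) (g := fun x => s * x)); exact: is_derive_scalef.
  have := is_derive_mulf (is_derive_mulf d1 (is_derive_subf (is_derive_scalef s d2)
    (is_derive_scalef e d3)))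
     (is_derive_cstf (e ^+ 2 + s ^+ 2)^-1 x).
  by move/is_derive_eqr; apply; field; rewrite gt_eqF.
transitivity (abel_prim e s T - abel_prim e s 0).
  apply: FTC_segment => //.
  - by move=> x; exact: is_derive_continuous (dA x).
  - by move=> x; apply: cvgM; [exact: continuous_scaled_expR|exact: continuous_scaled_cos].
rewrite /abel_prim !mulr0 expR0 sin0 cos0; ring.
Qed.

(** Uniformity in [s], from [(|s| + e) * e <= 2 * (e^2 + s^2)], is what dominated convergence in [T]
    requires. *)
Lemma abel_prim_le e s x : 0 < e ->
  `|abel_prim e s x| <= expR (- e * x) * (2 / e).
Proof.
move=> e0; have q0 := sqrD_gt0 s e0.
rewrite /abel_prim -mulrA normrM ger0_norm ?expR_ge0// ler_wpM2l ?expR_ge0//.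
rewrite normrM normfV (gtr0_norm q0) ler_pdivrMr//.
apply: le_trans (_ : `|s| + e <= _).
  apply: le_trans (ler_normB _ _) _; rewrite !normrM (gtr0_norm e0); apply: lerD.
    by rewrite ler_piMr// ler_norml sin_geN1 sin_le1.
  by rewrite ler_piMr ?(ltW e0)// ler_norml cos_geN1 cos_le1.
rewrite mulrAC ler_pdivlMr// -[s ^+ 2]real_normK ?num_real//.
have := sqr_ge0 (`|s| - e); have := normr_ge0 s; nra.
Qed.

Lemma integral_abel_kernel f C e T : 0 < e -> 0 <= T -> continuous f ->
  (forall s, `|f s| <= C * (oneDsqr s)^-1) ->
  \int[mu]_(x in `[0, T]) (expR (- e * x) * \int[mu]_s (f s * cos (s * x))) =
  \int[mu]_s (f s * abel_kernel e T s).
Proof.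
move=> e0 T0 cf hf; have if_ := integrableR_oneDsqr cf hf.
(* The indicator turns the segment into the whole line, where [Rintegral_fubini] applies. *)
pose F x s := \1_(`[0, T]) x * (expR (- e * x) * (f s * cos (s * x))).
have cfc x : continuous (fun s => f s * cos (s * x)).
  move=> s; apply: cvgM; first exact: cf.
  by apply: continuous_mulr_comp; exact: continuous_cos.
have ifc x : integrableR (fun s => f s * cos (s * x)).
  apply: (integrableR_oneDsqr (C := C)) => // s; apply: le_trans (hf s).
  by rewrite normrM ler_piMr// ler_norml cos_geN1 cos_le1.
have E1 x : \int[mu]_s F x s =
    \1_(`[0, T]) x * (expR (- e * x) * \int[mu]_s (f s * cos (s * x))).
  rewrite -(RintegralZl _ measurableT (ifc x)) -RintegralZl//.
  exact: integrableR_scale.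
have indE (h : R -> R) : \int[mu]_x (\1_(`[0, T]) x * h x) = \int[mu]_(x in `[0, T]) h x.
  rewrite [RHS]Rintegral_mkcond; apply: eq_Rintegral => x _.
  by rewrite patchE indicE; case: ifP => _; rewrite ?mul1r ?mul0r.
have indI (h : R -> R) : continuous h -> integrableR (fun x => \1_(`[0, T]) x * h x).
  move=> ch; have := @integrable_restrict _ _ _ mu `[0,
    T]%classic (measurable_itv _) setT measurableT (EFin \o h).
  rewrite setTI => -[H _]; have := H (segment_integrable 0 T ch);
    rewrite restrict_EFin /integrableR.
  congr (integrable _ _ _); apply/funext => x /=; congr (_%:E).
  by rewrite patchE indicE; case: ifP => _; rewrite ?mul1r ?mul0r.
have cF s : continuous (fun x => expR (- e * x) * (f s * cos (s * x))).
  move=> x; apply: cvgM; first exact: continuous_scaled_expR.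
  by apply: cvgM; [exact: cvg_cst|exact: continuous_scaled_cos].
have i1 x : integrableR (F x) by do 2!apply: integrableR_scale.
have i2 s : integrableR (F ^~ s) by exact: indI.
have mF : measurable_fun setT (fun z : R * R => F z.1 z.2).
  have m1 (h : R -> R) : measurable_fun setT h -> measurable_fun setT (fun z : R * R => h z.1).
    by move=> mh; apply: measurableT_comp.
  have m2 (h : R -> R) : continuous h -> measurable_fun setT (fun z : R * R => h z.2).
    by move=> ch; apply: measurableT_comp => //; exact: continuous_measurable_fun.
  apply: measurable_funM; first by apply: m1; exact: measurable_indic.
  apply: measurable_funM.
    apply: (m1 (fun x => expR (- e * x))).
    by apply: continuous_measurable_fun; exact: continuous_scaled_expR.
  apply: measurable_funM; first exact: (m2 f).
  apply: (measurableT_comp (f := cos)).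
    by apply: continuous_measurable_fun; exact: continuous_cos.
  by apply: measurable_funM => //.
have iG : integrableR (fun s => T * `|f s|).
  by apply: integrableR_scale; exact: integrable_abse if_.
have FG s : \int[mu]_x `|F x s| <= T * `|f s|.
  have -> : \int[mu]_x `|F x s| =
      \int[mu]_x (\1_(`[0, T]) x * `|expR (- e * x) * (f s * cos (s * x))|).
    by apply: eq_Rintegral => x _; rewrite /F normrM !indicE normr_nat.
  rewrite indE; apply: le_trans (ler_norm _) _.
  rewrite -{2}[T]subr0 mulrC; apply: segment_integral_le => //.
    by move=> x; apply: cvg_norm; exact: cF.
  move=> x /andP[x0 _]; rewrite normr_id normrM -[leRHS]mul1r; apply: ler_pM => //.
    rewrite ger0_norm ?expR_ge0// -[leRHS]expR0 ler_expR mulNr oppr_le0.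
    by rewrite mulr_ge0// ltW.
  by rewrite normrM ler_piMr// ler_norml cos_geN1 cos_le1.
have := Rintegral_fubini mF i1 i2 iG FG.
under eq_Rintegral do rewrite E1.
rewrite indE => ->; apply: eq_Rintegral => s _.
rewrite /F indE /abel_kernel -segment_integralZ.
  by apply: eq_Rintegral => x _; rewrite mulrCA.
by move=> x; apply: cvgM; [exact: continuous_scaled_expR|exact: continuous_scaled_cos].
Qed.

(** Limit of [integral_abel_kernel] as [T] grows: the left side is constant for [T >= r] because [c]
    vanishes there, and the right side converges with majorant [(3 / e) * |f|]. *)
Lemma abel_sum f C e r : 0 < e -> 0 <= r -> continuous f ->
  (forall s, `|f s| <= C * (oneDsqr s)^-1) ->
  let c x := \int[mu]_s (f s * cos (s * x)) in
  continuous c -> (forall x, r < x -> c x = 0) ->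
  \int[mu]_(x in `[0, r]) (expR (- e * x) * c x) =
  \int[mu]_s (f s * (e / (e ^+ 2 + s ^+ 2))).
Proof.
move=> e0 r0 cf hf c cc zc; have if_ := integrableR_oneDsqr cf hf.
have cec : continuous (fun x => expR (- e * x) * c x).
  by move=> x; apply: cvgM; [exact: continuous_scaled_expR|exact: cc].
have ck T : 0 <= T -> continuous (abel_kernel e T).
  move=> T0 s; rewrite (_ : abel_kernel e T = (fun s => abel_prim e s T + e / (e ^+ 2 + s ^+
    2))).
    have cq : {for s, continuous (fun s => (e ^+ 2 + s ^+ 2)^-1)}.
      apply: cvgV; first by rewrite gt_eqF// sqrD_gt0.
      by apply: cvgD; [exact: cvg_cst|exact: exprn_continuous].
    apply: cvgD; last by apply: cvgM; [exact: cvg_cst|exact: cq].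
    apply: cvgM; last exact: cq.
    apply: cvgM; first exact: cvg_cst.
    apply: cvgB.
      apply: cvgM; first exact: cvg_id.
      apply: (@continuous_comp _ _ _ (fun s : R => s * T) sin); last exact: continuous_sin.
      by apply: cvgM; [exact: cvg_id|exact: cvg_cst].
    apply: cvgM; first exact: cvg_cst.
    apply: (@continuous_comp _ _ _ (fun s : R => s * T) cos); last exact: continuous_cos.
    by apply: cvgM; [exact: cvg_id|exact: cvg_cst].
  by apply/funext => u; rewrite abel_kernelE.
pose g s := f s * (e / (e ^+ 2 + s ^+ 2)).
have q_le s : 0 <= e / (e ^+ 2 + s ^+ 2) <= e^-1.
  have q0 := sqrD_gt0 s e0.
  rewrite divr_ge0 ?(ltW e0) ?(ltW q0)//= ler_pdivrMr// mulrDr.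
  have -> : e^-1 * e ^+ 2 = e by field; rewrite gt_eqF.
  by rewrite lerDl mulr_ge0 ?invr_ge0 ?sqr_ge0// ltW.
have cg : continuous g.
  move=> s; apply: cvgM; first exact: cf.
  apply: cvgM; first exact: cvg_cst.
  apply: cvgV; first by rewrite gt_eqF// sqrD_gt0.
  by apply: cvgD; [exact: cvg_cst|exact: exprn_continuous].
have ig : integrableR g.
  apply: (integrableR_le (g := fun s => e^-1 * `|f s|)).
  - exact: continuous_measurable_fun.
  - by apply: integrableR_scale; exact: integrable_abse if_.
  - move=> s; have /andP[q1 q2] := q_le s.
    by rewrite normrM mulrC (ger0_norm q1) ler_wpM2r.
have H : \int[mu]_s (f s * abel_kernel e n%:R s) @[n --> \oo] --> \int[mu]_s g s.
  apply: (@Rintegral_dominated _ (fun n s => f s * abel_kernel e n%:R s) _ (fun s => (3 / e)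
    * `|f s|)) => //.
  - move=> n; apply: continuous_measurable_fun => s.
    by apply: cvgM; [exact: cf|exact: ck].
  - by apply: integrableR_scale; exact: integrable_abse if_.
  - move=> s; apply: cvgM; first exact: cvg_cst.
    under eq_fun do rewrite abel_kernelE//.
    have : abel_prim e s n%:R + e / (e ^+ 2 + s ^+ 2) @[n --> \oo]
      --> 0 + e / (e ^+ 2 + s ^+ 2).
      apply: cvgD; last exact: cvg_cst.
      have hx : expR (- e * n%:R) * (2 / e) @[n --> \oo] --> (0 : R).
        rewrite (_ : (fun n => _) = geometric (2 / e) (expR (- e))).
          by apply: cvg_geometric; rewrite ger0_norm ?expR_ge0// -expR0 ltr_expR oppr_lt0.
        by apply/funext => n; rewrite /= mulrC -expRM_natr.
      apply/cvgrPdist_le => d d0; move/cvgrPdist_le : hx => /(_ d d0).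
      apply: filterS => n; rewrite !sub0r !normrN; apply: le_trans.
      by apply: le_trans (abel_prim_le _ _ e0) (ler_norm _).
    by rewrite add0r.
  - move=> n s; rewrite normrM mulrC; apply: ler_wpM2r => //.
    have /andP[q1 q2] := q_le s; rewrite abel_kernelE//.
    apply: le_trans (ler_normD _ _) _; rewrite (ger0_norm q1).
    have -> : 3 / e = 1 * (2 / e) + e^-1 by field; rewrite gt_eqF.
    apply: lerD => //; apply: le_trans (abel_prim_le _ _ e0) _.
    rewrite ler_wpM2r ?divr_ge0 ?(ltW e0)//.
    by rewrite -[leRHS]expR0 ler_expR mulNr oppr_le0 mulr_ge0// ltW.
have E : \forall n \near \oo, \int[mu]_s (f s * abel_kernel e n%:R s) =
    \int[mu]_(x in `[0, r]) (expR (- e * x) * c x).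
  apply: filterS (truncnS_near r) => n; rewrite (ger0_norm r0) => rn.
  rewrite -(integral_abel_kernel (C := C) e0 _ cf hf)// -/c.
  rewrite (segment_integral_cat r0 rn cec).
  rewrite [X in _ + X](_ : _ = 0) ?addr0//.
  rewrite (eq_segment_integral (g := cst 0))//.
  - by rewrite segment_integral_cst// mul0r.
  - by move=> x; exact: cvg_cst.
  - by move=> x /andP[rx _]; rewrite zc ?mulr0.
apply: cvg_unique (_ : _ @ \oo --> _) H => //.
exact: cvg_near_cst.
Qed.

(** Abel summation with [e] tending to [0]. Rescaling [s = e t] turns the Poisson integral into
    [\int f (e t) / (1 + t^2) dt], which tends to [pi * f 0]; on the other side the damping
    [exp (- e x)] disappears on [[0, r]]. *)
Lemma cosine_inversion f C r : 0 <= r -> continuous f ->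
  (forall s, `|f s| <= C * (oneDsqr s)^-1) ->
  let c x := \int[mu]_s (f s * cos (s * x)) in
  continuous c -> (forall x, r < x -> c x = 0) ->
  \int[mu]_(x in `[0, r]) c x = pi * f 0.
Proof.
move=> r0 cf hf c cc zc; have if_ := integrableR_oneDsqr cf hf.
have C0 : 0 <= C.
  by have := hf 0; rewrite /oneDsqr expr0n addr0 invr1 mulr1; apply: le_trans.
have fC s : `|f s| <= C.
  by apply: le_trans (hf s) _; rewrite ler_piMr// invf_le1 ?oneDsqr_ge1.
have cV : continuous (fun t : R => (oneDsqr t)^-1) by move=> t; exact: continuous_oneDsqrV.
pose e (n : nat) : R := n.+1%:R^-1.
have e0 n : 0 < e n by rewrite invr_gt0.
have ce n : continuous (fun t => f (e n * t)).
  move=> t; apply: (@continuous_comp _ _ _ (fun t => e n * t) f); last exact: cf.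
  by apply: cvgM; [exact: cvg_cst|exact: cvg_id].
have ife n : integrableR (fun t => f (e n * t) * (oneDsqr t)^-1).
  apply: (@integrableR_oneDsqr _ C) => [t|t].
    by apply: cvgM; [exact: ce|exact: cV].
  by rewrite normrM [X in _ * X]ger0_norm ?invr_ge0 ?(le_trans ler01 (oneDsqr_ge1 _))//
    ler_wpM2r ?invr_ge0 ?(le_trans ler01 (oneDsqr_ge1 _)).
have E n : \int[mu]_(x in `[0, r]) (expR (- e n * x) * c x) =
    \int[mu]_t (f (e n * t) * (oneDsqr t)^-1).
  have q0 (s : R) : e n ^+ 2 + s ^+ 2 != 0 by rewrite gt_eqF// sqrD_gt0.
  have EE t : f (0 + e n * t) * (e n / (e n ^+ 2 + (0 + e n * t) ^+ 2)) =
      (e n)^-1 * (f (e n * t) * (oneDsqr t)^-1).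
    have := q0 (e n * t); rewrite add0r => h; rewrite /oneDsqr.
    have en0 : e n != 0 by rewrite gt_eqF.
    have t0 : 1 + t ^+ 2 != 0 by rewrite gt_eqF// ltr_pwDl// sqr_ge0.
    by field; rewrite en0 t0 /= h.
  rewrite (abel_sum (C := C) (e0 n) r0 cf hf cc zc).
  rewrite (@Rintegral_affine _ (fun s => f s * (e n / (e n ^+ 2 + s ^+ 2))) 0 (e n))//.
  - under eq_Rintegral do rewrite EE.
    rewrite RintegralZl//; last exact: ife.
    by rewrite mulrA divff ?mul1r// gt_eqF.
  - move=> s; apply: cvgM; first exact: cf.
    apply: cvgM; first exact: cvg_cst.
    by apply: cvgV; [exact: q0|apply: cvgD; [exact: cvg_cst|exact: exprn_continuous]].
  - apply: (integrableR_le (g := fun s => (e n)^-1 * `|f s|)).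
    + apply: continuous_measurable_fun => s; apply: cvgM; first exact: cf.
      apply: cvgM; first exact: cvg_cst.
      by apply: cvgV; [exact: q0|apply: cvgD; [exact: cvg_cst|exact: exprn_continuous]].
    + by apply: integrableR_scale; exact: integrable_abse if_.
    + move=> s; rewrite normrM mulrC ler_wpM2r//.
      have qs := sqrD_gt0 s (e0 n).
      rewrite ger0_norm ?divr_ge0 ?(ltW (e0 n)) ?(ltW qs)//.
      rewrite ler_pdivrMr// mulrDr.
      have -> : (e n)^-1 * e n ^+ 2 = e n by field; rewrite gt_eqF.
      by rewrite lerDl mulr_ge0 ?invr_ge0 ?sqr_ge0// ltW.
  - by under eq_fun do rewrite EE; exact: integrableR_scale.
have ecvg : e n @[n --> \oo] --> (0 : R) by exact: cvg_harmonic.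
have H1 : \int[mu]_t (f (e n * t) * (oneDsqr t)^-1) @[n --> \oo] --> pi * f 0.
  have -> : pi * f 0 = \int[mu]_t (f 0 * (oneDsqr t)^-1).
    by rewrite RintegralZl ?Rintegral_oneDsqrV 1?mulrC//; exact: oneDsqrV_integrable.
  apply: (@Rintegral_dominated _ (fun n t => f (e n * t) * (oneDsqr t)^-1) _ (fun t => C *
    (oneDsqr t)^-1)).
  - by move=> n; apply: continuous_measurable_fun => t; apply: cvgM; [exact: ce|exact: cV].
  - exact/integrableR_scale/oneDsqrV_integrable.
  - exact/integrableR_scale/oneDsqrV_integrable.
  - move=> t; apply: cvgM; last exact: cvg_cst.
    have h : e n * t @[n --> \oo] --> 0 * t by apply: cvgM; [exact: ecvg|exact: cvg_cst].
    by rewrite mul0r in h; exact: (cvg_comp _ _ h (cf 0)).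
  - move=> n t; rewrite normrM [X in _ * X]ger0_norm ?invr_ge0 ?(le_trans ler01 (oneDsqr_ge1
    _))//.
    by rewrite ler_wpM2r ?invr_ge0 ?(le_trans ler01 (oneDsqr_ge1 _)).
have [M [M0 hM]] := bounded_on_segment 0 r cc.
have cec n : continuous (fun x => expR (- e n * x) * c x).
  by move=> x; apply: cvgM; [exact: continuous_scaled_expR|exact: cc].
have H2 : \int[mu]_(x in `[0, r]) (expR (- e n * x) * c x) @[n --> \oo]
  --> \int[mu]_(x in `[0, r]) c x.
  have h : e n * (r * M * r) @[n --> \oo] --> (0 : R).
    by rewrite -[X in _ --> X](mul0r (r * M * r)); apply: cvgM; [exact: ecvg|exact: cvg_cst].
  apply/cvgrPdist_le => d d0; move/cvgrPdist_le : h => /(_ d d0).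
  apply: filterS => n; rewrite sub0r normrN => h.
  rewrite -segment_integralB//; apply: le_trans (le_trans (ler_norm _) h).
  have -> : e n * (r * M * r) = e n * r * M * (r - 0) by ring.
  apply: segment_integral_le => //.
    by move=> x; apply: cvgB; [exact: cc|exact: cec].
  move=> x /andP[x0 xr]; rewrite -[X in X - _]mul1r -mulrBl normrM; apply: ler_pM => //.
    have ex0 : 0 <= e n * x by rewrite mulr_ge0// ltW.
    rewrite ger0_norm; last by rewrite subr_ge0 -expR0 ler_expR mulNr oppr_le0.
    apply: le_trans (_ : e n * x <= _); last by rewrite ler_wpM2l// ltW.
    rewrite lerBlDl -lerBlDr; have := expR_ge1Dx (- e n * x); rewrite mulNr; lra.
  by apply: hM; rewrite x0.
move: H2; under eq_fun do rewrite E.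
by move=> H2; exact: cvg_unique H2 H1.
Qed.

End FourierInversion.

(** * Holomorphic functions as closed forms, and shifting the line of integration *)

Section ContourShift.
Context {R : realType}.
Implicit Types (F G : R[i] -> R[i]) (x y s t r : R).
Local Notation mu := (@lebesgue_measure R).

Lemma entire_taylor1 G z : entire G -> exists d : R[i], forall e : R, 0 < e ->
  exists2 delta : R, 0 < delta & forall h, normc h <= delta ->
    normc (G (z + h) - G z - d * h) <= e * normc h.
Proof.
move=> eG; exists (derive1 (G : R[i] -> R[i]^o) z) => e e0.
have H : (fun h : R[i]^o => h^-1 *: (((G : R[i]^o -> R[i]^o) \o shift (z : R[i]^o)) (h *: (1
  : R[i]^o)) - G z))
    h @[h --> (0 : R[i]^o)^'] --> (derive1 (G : R[i] -> R[i]^o) z : R[i]^o).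
  by rewrite derive1E; exact: (eG z).
move/cvgrPdist_le : H => /(_ e%:C); rewrite ltcR => /(_ e0)/nbhs_ballP[d] /=.
rewrite ltcE /= => /andP[/eqP Id d0] hd.
have dE : d = (Re d)%:C by rewrite {1}(complexE d) Id mulr0 addr0.
exists (Re d / 2); first by rewrite divr_gt0.
move=> h hh; have [->|h0] := eqVneq h 0.
  by rewrite addr0 subrr mulr0 subrr Normc.normc0 mulr0.
have := hd h; rewrite /ball /= sub0r normrN normr_normc dE ltcR.
have -> : normc h < Re d.
  by apply: le_lt_trans hh _; rewrite ltr_pdivrMr// ltr_pMr// ltr1n.
move=> /(_ isT h0); rewrite normr_normc lecR /= /GRing.scale /= mulr1 => h1.
have -> : G (z + h) - G z - derive1 (G : R[i] -> R[i]^o) z * h =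
    - (derive1 (G : R[i] -> R[i]^o) z - h^-1 * (G (h + z) - G z)) * h.
  by rewrite (addrC h z); field.
by rewrite Normc.normcM normcN ler_wpM2r// normc_ge0.
Qed.

(** The Cauchy-Riemann equations: these are the real and imaginary parts of [G dz]. *)
Lemma entire_closed_form G : entire G ->
  closed_form (fun x y => Re (G (x +i* y))) (fun x y => - Im (G (x +i* y))) /\
  closed_form (fun x y => Im (G (x +i* y))) (fun x y => Re (G (x +i* y))).
Proof.
move=> eG.
have H x0 y0 : exists a b : R, forall e, 0 < e -> exists2 d, 0 < d &
   forall x y, `|x - x0| <= d -> `|y - y0| <= d ->
     `|Re (G (x +i* y)) - Re (G (x0 +i* y0)) - a * (x - x0) + b * (y - y0)| <= e * (`|x - x0|
       + `|y - y0|) /\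
     `|Im (G (x +i* y)) - Im (G (x0 +i* y0)) - b * (x - x0) - a * (y - y0)| <= e * (`|x - x0|
       + `|y - y0|).
  have [[a b] hd] := entire_taylor1 (x0 +i* y0) eG; exists a, b => e e0.
  have [d d0 {}hd] := hd e e0; exists (d / 2); first by rewrite divr_gt0.
  move=> x y hx hy; pose h := (x - x0) +i* (y - y0).
  have hh : normc h <= `|x - x0| + `|y - y0| by apply: (normc_le_ReIm h).
  have hnd : normc h <= d by apply: le_trans hh _; rewrite [d]splitr lerD.
  have := hd h hnd; have -> : x0 +i* y0 + h = x +i* y.
    by apply: complex_eq; rewrite /h /=; ring.
  have hq : e * normc h <= e * (`|x - x0| + `|y - y0|) by rewrite ler_wpM2l// ltW.
  move=> hn; split.
    apply: le_trans (le_trans hn hq); apply: le_trans (abs_Re_le_normc _).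
    rewrite ReD ReN ReD ReN ReM /= le_eqVlt; apply/orP; left; apply/eqP; congr `|_|; ring.
  apply: le_trans (le_trans hn hq); apply: le_trans (abs_Im_le_normc _).
  rewrite ImD ImN ImD ImN ImM /= le_eqVlt; apply/orP; left; apply/eqP; congr `|_|; ring.
split=> x0 y0; have [a [b hab]] := H x0 y0.
  exists a, (- b), (- a) => e e0; have [d d0 {}hab] := hab e e0; exists d => // x y hx hy.
  have [h1 h2] := hab x y hx hy; split; first by rewrite mulNr opprK.
  rewrite -normrN in h2; apply: le_trans h2; rewrite le_eqVlt; apply/orP; left; apply/eqP.
  by congr `|_|; ring.
exists b, a, (- b) => e e0; have [d d0 {}hab] := hab e e0; exists d => // x y hx hy.
by have [h1 h2] := hab x y hx hy; split => //; rewrite mulNr opprK.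
Qed.

(** Goursat on [[- n, n] x [c, c + h]]: by the decay of [Q], the vertical sides contribute at most a
    constant times [1 / n]. *)
Lemma closed_form_shift (P Q : R -> R -> R) (K c h : R) : 0 <= h -> closed_form P Q ->
  (forall x y, c <= y <= c + h -> `|P x y| <= K * (oneDsqr x)^-1) ->
  (forall x y, c <= y <= c + h -> `|Q x y| <= K * (oneDsqr x)^-1) ->
  \int[mu]_x P x c = \int[mu]_x P x (c + h).
Proof.
move=> h0 PQ bP bQ; have cP := continuous_P PQ; have cQ := continuous_Q PQ.
have iP y : c <= y <= c + h -> integrableR (P^~ y).
  by move=> hy; apply: integrableR_oneDsqr (cP y) _ => x; exact: bP.
have i1 := iP c; rewrite lexx lerDl h0 in i1; have {}i1 := i1 isT.
have i2 := iP (c + h); rewrite lexx lerDl h0 in i2; have {}i2 := i2 isT.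
have lim (y : R) : integrableR (P^~ y) ->
    \int[mu]_(x in `[0 - n%:R, 0 + n%:R]) P x y @[n --> \oo] --> \int[mu]_x P x y.
  by move=> iy; apply: Rintegral_segment_cvg => // x; rewrite subr0; exact: truncnS_near.
apply/eqP; rewrite -subr_eq0; apply/eqP.
have L : (\int[mu]_(x in `[0 - n%:R, 0 + n%:R]) P x c -
    \int[mu]_(x in `[0 - n%:R, 0 + n%:R]) P x (c + h)) @[n --> \oo] -->
    (\int[mu]_x P x c - \int[mu]_x P x (c + h)).
  by apply: cvgB; exact: lim.
suff L0 : (\int[mu]_(x in `[0 - n%:R, 0 + n%:R]) P x c -
    \int[mu]_(x in `[0 - n%:R, 0 + n%:R]) P x (c + h)) @[n --> \oo] --> (0 : R).
  by apply: (@cvg_unique _ (@Rhausdorff R) _ _ _ _ L L0).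
have K0 : 0 <= K.
  have := bP 0 c; rewrite lexx lerDl h0 /oneDsqr expr0n addr0 invr1 mulr1 => /(_ isT).
  exact: le_trans.
apply/cvgrPdist_le => e e0; near=> n.
have n0 : 0 < n%:R :> R by rewrite ltr0n; near: n; exact: nbhs_infty_gt.
have nn : - n%:R + (n%:R + n%:R) = n%:R :> R by ring.
have := goursat PQ (- n%:R) c (addr_ge0 (ltW n0) (ltW n0)) h0.
rewrite /boundary_integral nn segment_integralB//.
rewrite !add0r; set A := _ - \int[mu]_(x in _) P x (c + h) => E.
have {E}-> : A = - \int[mu]_(y in `[c, c + h]) (Q n%:R y - Q (- n%:R) y).
  by apply/eqP; rewrite -subr_eq0 opprK E.
rewrite opprK; apply: le_trans (_ : 2 * K * (n%:R)^-1 * (c + h - c) <= _).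
  apply: segment_integral_le; first by rewrite lerDl.
    by move=> y; apply: cvgB; exact: cQ.
  move=> y hy; apply: le_trans (ler_normB _ _) _.
  have -> : 2 * K * n%:R^-1 = K * n%:R^-1 + K * n%:R^-1 by ring.
  have n2 : (oneDsqr n%:R)^-1 <= n%:R^-1 :> R.
    rewrite lef_pV2 ?posrE ?oneDsqr_gt0// /oneDsqr.
    have : 1 <= n%:R :> R by rewrite ler1n; move: n0; rewrite ltr0n.
    by rewrite expr2; nra.
  apply: lerD.
    by apply: le_trans (bQ _ _ hy) _; rewrite ler_wpM2l.
  by apply: le_trans (bQ _ _ hy) _; rewrite /oneDsqr sqrrN ler_wpM2l.
rewrite addrAC subrr add0r mulrAC ler_pdivrMr// -ler_pdivrMl// mulrC.
near: n; exact: nbhs_infty_ger.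
Unshelve. all: by end_near. Qed.

(* [expo t z = exp (i * t * z)] *)
Definition expo t : R[i] -> R[i] := pser (kernel_coef 0 t%:C).

Lemma entire_expo t : entire (expo t).
Proof. exact/entire_pser/entire_kernel_coef. Qed.

(** For [k = 0] the series depends only on the product of variable and parameter, so the two may be
    exchanged. This carries the closed formula for the kernel, known at real points, over to complex
    [z]. *)
Lemma expo_kernel t z : expo t z = dunkl_kernel 0 z t%:C.
Proof.
rewrite (dunkl_kernelE z t (lexx 0)).
have := pserP t%:C (entire_kernel_coef z (lexx 0)).
apply: csums_unique; have := pserP z (entire_kernel_coef t%:C (lexx (0 : R))).
rewrite (_ : (fun n => _) = (fun n => kernel_coef 0 z n * t%:C ^+ n))//.
by apply/funext => n; rewrite /kernel_coef !exprMn; ring.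
Qed.

Lemma expoE t z : expo t z =
  (expR (- Im z * t) * cos (Re z * t)) +i* (expR (- Im z * t) * sin (Re z * t)).
Proof.
rewrite expo_kernel -[z in LHS]opprK dunkl_kernel0E ReN ImN.
by rewrite [X in cos X]mulNr cosN [X in sin X]mulNr sinN mulrN opprK.
Qed.

Lemma normc_expo t z : normc (expo t z) = expR (- Im z * t).
Proof.
rewrite expoE /= !exprMn -mulrDr addrC sin2cos2 subrK mulr1 sqrtr_sqr.
by rewrite ger0_norm// expR_ge0.
Qed.

End ContourShift.

Section LineComplexIntegral.
Context {R : realType}.
Implicit Types (f : R -> R[i]).
Local Notation mu := (@lebesgue_measure R).

Definition cintegrable f := integrableR (fun x => Re (f x)) /\ integrableR (fun x => Im (f x)).

Lemma cintegrable_oneDsqr (C : R) f : ccont f ->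
  (forall x, normc (f x) <= C * (oneDsqr x)^-1) -> cintegrable f.
Proof.
move=> [f1 f2] hf; split; apply: integrableR_oneDsqr => // x.
  exact: le_trans (abs_Re_le_normc _) (hf x).
exact: le_trans (abs_Im_le_normc _) (hf x).
Qed.

Lemma complex_integral_scale (a : R[i]) f : cintegrable f ->
  complex_integral (fun x => a * f x) = a * complex_integral f.
Proof.
move=> [i1 i2]; apply: complex_eq; rewrite ?ReM ?ImM /=.
  rewrite -!RintegralZl// -RintegralB//; [|exact: integrableR_scale..].
  by apply: eq_Rintegral => x _; rewrite ReM.
rewrite -!RintegralZl// -RintegralD//; [|exact: integrableR_scale..].
by apply: eq_Rintegral => x _; rewrite ImM.
Qed.

Lemma complex_integral_oneDsqr_le (C : R) f : ccont f ->
  (forall x, normc (f x) <= C * (oneDsqr x)^-1) ->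
  normc (complex_integral f) <= 2 * C * pi.
Proof.
move=> cf hf; have [i1 i2] := cintegrable_oneDsqr cf hf.
have iC : integrableR (fun x : R => C * (oneDsqr x)^-1).
  exact/integrableR_scale/oneDsqrV_integrable.
have H (p : R -> R) : integrableR p -> (forall x, `|p x| <= normc (f x)) ->
    `|\int[mu]_x p x| <= C * pi.
  move=> ip hp; apply: le_trans (le_normr_Rintegral _ ip) _ => //.
  rewrite -Rintegral_oneDsqrV -RintegralZl//; last exact: oneDsqrV_integrable.
  apply: RintegralR_le => //; first exact: integrable_abse ip.
  by move=> x; exact: le_trans (hp x) (hf x).
apply: le_trans (normc_le_ReIm _) _ => /=.
have -> : 2 * C * pi = C * pi + C * pi by ring.
by apply: lerD; apply: H => // x; [exact: abs_Re_le_normc|exact: abs_Im_le_normc].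
Qed.

End LineComplexIntegral.

Section RapidDecay.
Context {R : realType}.
Implicit Types (f : R -> R) (s t : R).
Local Notation mu := (@lebesgue_measure R).

(** A class stable under multiplication by [s], which is what differentiation under the integral
    sign produces; the factor [1 / (1 + s^2)] builds in integrability. *)
Definition rapid f := continuous f /\
  forall n, exists C : R, forall s, `|s ^+ n * f s| <= C * (oneDsqr s)^-1.

Lemma rapid_mulX f : rapid f -> rapid (fun s => s * f s).
Proof.
move=> [cf hf]; split.
  by move=> s; apply: cvgM; [exact: cvg_id|exact: cf].
by move=> n; have [C hC] := hf n.+1; exists C => s; rewrite mulrA -exprSr.
Qed.

Lemma rapid_integrable f (g : R -> R) : rapid f -> continuous g ->
  (forall s, `|g s| <= 1) -> integrableR (fun s => f s * g s).
Proof.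
move=> [cf hf] cg g1; have [C hC] := hf 0%N.
apply: (@integrableR_oneDsqr _ C) => s.
  by apply: cvgM; [exact: cf|exact: cg].
have := hC s; rewrite expr0 mul1r; apply: le_trans.
by rewrite normrM ler_piMr.
Qed.

Definition cos_transform f t := \int[mu]_s (f s * cos (s * t)).
Definition sin_transform f t := \int[mu]_s (f s * sin (s * t)).

Lemma cos_integrand_integrable f t : rapid f -> integrableR (fun s => f s * cos (s * t)).
Proof.
move=> hf; apply: rapid_integrable => //; last by move=> s; rewrite ler_norml cos_geN1 cos_le1.
by apply: continuous_mulr_comp; exact: continuous_cos.
Qed.

Lemma sin_integrand_integrable f t : rapid f -> integrableR (fun s => f s * sin (s * t)).
Proof.
move=> hf; apply: rapid_integrable => //; last by move=> s; rewrite ler_norml sin_geN1 sin_le1.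
by apply: continuous_mulr_comp; exact: continuous_sin.
Qed.

Lemma is_derive_cos_transform f t : rapid f ->
  is_derive t 1 (cos_transform f) (-1 * sin_transform (fun s => s * f s) t).
Proof.
move=> hf; have hf1 := rapid_mulX hf; have [C hC] := hf1.2 0%N.
rewrite /sin_transform -RintegralZl//; last exact: sin_integrand_integrable.
apply: (@is_derive_Rintegral _ (fun t s => f s * cos (s * t))
  (fun t s => -1 * (s * f s * sin (s * t))) (fun s => C * (oneDsqr s)^-1)).
- by move=> u; exact: cos_integrand_integrable.
- move=> u s; have := is_derive_scalef (f s)
    (is_derive_compf (g := fun u => s * u) (is_derive_cos (s * u)) (is_derive_scalef s
      (is_derive_idf u))).
  by move/is_derive_eqr; apply; ring.
- exact/integrableR_scale/oneDsqrV_integrable.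
- move=> u s; have := hC s; rewrite expr0 mul1r; apply: le_trans.
  by rewrite mulN1r normrN normrM ler_piMr// ler_norml sin_geN1 sin_le1.
Qed.

Lemma is_derive_sin_transform f t : rapid f ->
  is_derive t 1 (sin_transform f) (cos_transform (fun s => s * f s) t).
Proof.
move=> hf; have hf1 := rapid_mulX hf; have [C hC] := hf1.2 0%N.
apply: (@is_derive_Rintegral _ (fun t s => f s * sin (s * t))
  (fun t s => s * f s * cos (s * t)) (fun s => C * (oneDsqr s)^-1)).
- by move=> u; exact: sin_integrand_integrable.
- move=> u s; have := is_derive_scalef (f s)
    (is_derive_compf (g := fun u => s * u) (is_derive_sin (s * u)) (is_derive_scalef s
      (is_derive_idf u))).
  by move/is_derive_eqr; apply; ring.
- exact/integrableR_scale/oneDsqrV_integrable.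
- move=> u s; have := hC s; rewrite expr0 mul1r; apply: le_trans.
  by rewrite normrM ler_piMr// ler_norml cos_geN1 cos_le1.
Qed.

Lemma rapid_transform_smooth f : rapid f ->
  smoothr (cos_transform f) /\ smoothr (sin_transform f).
Proof.
suff H n : forall f, rapid f -> Ck n (cos_transform f) /\ Ck n (sin_transform f).
  by move=> hf; split=> n; case: (H n f hf).
elim: n => [|n IH] {}f hf.
  split=> t; first exact: is_derive_continuous (is_derive_cos_transform t hf).
  exact: is_derive_continuous (is_derive_sin_transform t hf).
have [h1 h2] := IH _ (rapid_mulX hf); split.
  exists (fun t => -1 * sin_transform (fun s => s * f s) t).
    by move=> t; exact: is_derive_cos_transform.
  by apply: Ck_mul; first exact: Ck_cst.
exists (cos_transform (fun s => s * f s)) => // t.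
exact: is_derive_sin_transform.
Qed.

End RapidDecay.

(** * The Paley-Wiener theorem for the Fourier transform *)

Section FourierPaleyWiener.
Context {R : realType}.
Variables (r : R) (F : R[i] -> R[i]).
Hypotheses (r0 : 0 <= r) (hF : paley_wiener_space r F).
Implicit Types (x y s t : R) (z lambda : R[i]).
Local Notation mu := (@lebesgue_measure R).

Let eF : entire F. Proof. by case: hF. Qed.

Lemma ccont_line (G : R[i] -> R[i]) y : entire G -> ccont (fun x => G (x +i* y)).
Proof.
move=> eG; have [h1 h2] := entire_closed_form eG; split.
  exact: (continuous_P h1).
exact: (continuous_P h2).
Qed.

Lemma oneDsqr_le_normc x y : oneDsqr x <= (1 + normc (x +i* y)) ^+ 2.
Proof.
have h : x ^+ 2 <= normc (x +i* y) ^+ 2 by rewrite sqr_normc_ReIm /= lerDl sqr_ge0.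
rewrite /oneDsqr; have := normc_ge0 (x +i* y); nra.
Qed.

Lemma paley_wiener_line : exists2 C, 0 <= C & forall x y,
  normc (F (x +i* y)) <= C * (oneDsqr x)^-1 * expR (r * `|y|).
Proof.
case: hF => _ /(_ 2%N)[C C0 hC]; exists C; first exact: ltW.
move=> x y; apply: le_trans (hC _) _; rewrite ler_wpM2r ?expR_ge0// ler_wpM2l ?(ltW C0)//.
have n0 := normc_ge0 (x +i* y).
rewrite lef_pV2 ?posrE ?oneDsqr_gt0 ?exprn_gt0 ?ltr_pwDl//.
exact: oneDsqr_le_normc.
Qed.

Lemma paley_wiener_rapid : rapid (fun s => Re (F s%:C)) /\ rapid (fun s => Im (F s%:C)).
Proof.
have [c1 c2] := ccont_line 0 eF.
have H n : exists C : R, forall s, normc (s%:C ^+ n * F s%:C) <= C * (oneDsqr s)^-1.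
  case: hF => _ /(_ (n + 2)%N)[C C0 hC]; exists C => s.
  have := hC s%:C; rewrite [Im _]/= normr0 mulr0 expR0 mulr1 => h.
  rewrite Normc.normcM normcX.
  have n0 := normc_ge0 s%:C; set N := normc s%:C in n0 h *.
  have N1 : 0 < 1 + N by rewrite ltr_pwDl.
  have oN : oneDsqr s <= (1 + N) ^+ 2 by apply: (oneDsqr_le_normc s 0).
  rewrite ler_pdivlMr ?oneDsqr_gt0//.
  rewrite ler_pdivlMr ?exprn_gt0// in h.
  apply: le_trans h; rewrite mulrAC mulrC; apply: ler_wpM2l; first exact: normc_ge0.
  rewrite exprD; apply: ler_pM; rewrite ?exprn_ge0 ?(ltW (oneDsqr_gt0 s))//.
  by apply: lerXn2r; rewrite ?nnegrE ?(ltW N1)// lerDr.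
split; split => // n; have [C hC] := H n; exists C => s.
  apply: le_trans (hC s); apply: le_trans (abs_Re_le_normc _).
  by rewrite -rmorphXn ReMl.
apply: le_trans (hC s); apply: le_trans (abs_Im_le_normc _).
by rewrite -rmorphXn ImMl.
Qed.

(** The inverse Fourier integral of [F] along the line [Im z = y], without its factor
    [1 / (2 pi)]. *)
Definition fourier_line t y := complex_integral (fun x => F (x +i* y) * expo t (x +i* y)).

Lemma entireM (G H : R[i] -> R[i]) : entire G -> entire H -> entire (fun z => G z * H z).
Proof.
move=> eG eH z; exact: (@derivableM _ _ (G : R[i]^o -> R[i]^o) (H : R[i]^o -> R[i]^o) z 1 (eG
  z) (eH z)).
Qed.

Lemma fourier_line_integrand : exists2 C, 0 <= C & forall t y x,
  normc (F (x +i* y) * expo t (x +i* y)) <= C * expR (r * `|y| - y * t) * (oneDsqr x)^-1.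
Proof.
have [C C0 hC] := paley_wiener_line; exists C => // t y x.
rewrite Normc.normcM normc_expo /= mulNr expRD.
have := hC x y; rewrite -(ler_pM2r (expR_gt0 (- (y * t)))).
by move=> h; apply: le_trans h _; rewrite le_eqVlt; apply/orP; left; apply/eqP; ring.
Qed.

Lemma fourier_line_le : exists2 C, 0 <= C & forall t y,
  normc (fourier_line t y) <= C * expR (r * `|y| - y * t).
Proof.
have [C C0 hC] := fourier_line_integrand; exists (2 * C * pi).
  by rewrite !mulr_ge0// pi_ge0.
move=> t y; have -> : 2 * C * pi * expR (r * `|y| - y * t) = 2 * (C * expR (r * `|y| - y *
  t)) * pi by ring.
apply: complex_integral_oneDsqr_le; last exact: hC.
exact: (ccont_line y (entireM eF (@entire_expo _ t))).
Qed.

Lemma fourier_line_shift t y : fourier_line t y = fourier_line t 0.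
Proof.
have eG := entireM eF (@entire_expo _ t).
have [h1 h2] := entire_closed_form eG.
have [C C0 hC] := fourier_line_integrand.
have H a h : 0 <= h -> fourier_line t a = fourier_line t (a + h).
  (* [B] bounds [|u|] throughout the strip, hence [(r + |t|) * B] bounds the exponent
     [r |u| - u t]. *)
  move=> hh; pose B := `|a| + h; pose K := C * expR ((r + `|t|) * B).
  have bd x u : a <= u <= a + h ->
      normc (F (x +i* u) * expo t (x +i* u)) <= K * (oneDsqr x)^-1.
    move=> /andP[u1 u2]; apply: le_trans (hC t u x) _.
    rewrite ler_wpM2r ?invr_ge0 ?(ltW (oneDsqr_gt0 _))// ler_wpM2l// ler_expR mulrDl.
    have uB : `|u| <= B.
      rewrite /B ler_norml; have := ler_norm a; have := ler_norm (- a); rewrite normrN => ? ?.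
      by apply/andP; split; lra.
    apply: lerD; first by rewrite ler_wpM2l.
    apply: le_trans (ler_norm _) _; rewrite normrN normrM mulrC.
    by rewrite ler_wpM2l.
  rewrite /fourier_line /complex_integral; apply: eq_Complex.
    apply: (closed_form_shift (K := K) hh h1) => x u hu.
      exact: le_trans (abs_Re_le_normc _) (bd x u hu).
    by rewrite normrN; exact: le_trans (abs_Im_le_normc _) (bd x u hu).
  apply: (closed_form_shift (K := K) hh h2) => x u hu.
    exact: le_trans (abs_Im_le_normc _) (bd x u hu).
  exact: le_trans (abs_Re_le_normc _) (bd x u hu).
have [y0|y0] := leP 0 y; first by have := H 0 y y0; rewrite add0r => ->.
by have := H y (- y); rewrite subrr oppr_ge0; apply; exact: ltW.
Qed.

(** Moving the line to height [n * sgn t] bounds the integral by [C * exp (n * (r - |t|))], which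
    tends to [0]. *)
Lemma fourier_line_supp t : r < `|t| -> fourier_line t 0 = 0.
Proof.
move=> rt; have [C C0 hC] := fourier_line_le.
apply: Normc.eq0_normc; apply/eqP; rewrite eq_le normc_ge0 andbT.
have B (n : nat) : normc (fourier_line t 0) <= C * expR (r - `|t|) ^+ n.
  rewrite -(fourier_line_shift t (n%:R * Num.sg t)); apply: le_trans (hC _ _) _.
  rewrite ler_wpM2l// -expRM_natl ler_expR normrM (ger0_norm (ler0n _ _)) -mulrA -normrEsg.
  have t0 : t != 0 by rewrite -normr_gt0; exact: le_lt_trans rt.
  by rewrite normr_sg t0 mulr1 le_eqVlt; apply/orP; left; apply/eqP; ring.
have L : C * expR (r - `|t|) ^+ n @[n --> \oo] --> (0 : R).
  by apply: cvg_geometric; rewrite ger0_norm ?expR_ge0// -expR0 ltr_expR subr_lt0.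
apply/ler_addgt0Pr => e e0; rewrite add0r.
move/cvgrPdist_le : L => /(_ e e0)[n _ /(_ n (leqnn _))].
rewrite sub0r normrN ger0_norm ?mulr_ge0 ?exprn_ge0 ?expR_ge0//.
exact: le_trans (B n).
Qed.

Lemma fourier_line0E t : fourier_line t 0 =
  (cos_transform (fun s => Re (F s%:C)) t - sin_transform (fun s => Im (F s%:C)) t) +i*
  (sin_transform (fun s => Re (F s%:C)) t + cos_transform (fun s => Im (F s%:C)) t).
Proof.
have [h1 h2] := paley_wiener_rapid.
have E x : expo t (x +i* 0) = cos (x * t) +i* sin (x * t).
  by rewrite expoE /= oppr0 mul0r expR0 !mul1r.
congr (_ +i* _).
  rewrite /cos_transform /sin_transform -RintegralB//;
    [|exact: cos_integrand_integrable|exact: sin_integrand_integrable].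
  by apply: eq_Rintegral => x _; rewrite E ReM.
rewrite /cos_transform /sin_transform -RintegralD//;
  [|exact: sin_integrand_integrable|exact: cos_integrand_integrable].
by apply: eq_Rintegral => x _; rewrite E ImM.
Qed.

Lemma fourier_line_smooth : smooth_csupp r (fun t => fourier_line t 0).
Proof.
have [h1 h2] := paley_wiener_rapid.
have [c1 s1] := rapid_transform_smooth h1; have [c2 s2] := rapid_transform_smooth h2.
split.
- move=> n; rewrite (_ : (fun x => _) = (fun t => cos_transform (fun s => Re (F s%:C)) t +
     -1 * sin_transform (fun s => Im (F s%:C)) t)).
    by apply: Ck_add => //; apply: Ck_mul => //; exact: Ck_cst.
  by apply/funext => t; rewrite fourier_line0E mulN1r.
- move=> n; rewrite (_ : (fun x => _) = (fun t => sin_transform (fun s => Re (F s%:C)) t +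
     cos_transform (fun s => Im (F s%:C)) t)).
    exact: Ck_add.
  by apply/funext => t; rewrite fourier_line0E.
- by move=> t; exact: fourier_line_supp.
Qed.

(** The shift costs a factor [(1 + |lambda|) ^ 2], since [1 + |s| <= (1 + |lambda|) * (1 + |lambda +
    s|)]. *)
Lemma translated_line lambda : ccont (fun s : R => F (lambda + s%:C)) /\
  exists C, forall s, normc (F (lambda + s%:C)) <= C * (oneDsqr s)^-1.
Proof.
have E s : lambda + s%:C = (Re lambda + s) +i* Im lambda.
  by case: lambda => a b; apply: complex_eq => /=; rewrite ?addr0.
split.
  have [h1 h2] := ccont_line (Im lambda) eF.
  have ct (h : R -> R) : continuous h -> continuous (fun s => h (Re lambda + s)).
    move=> ch s; apply: (@continuous_comp _ _ _ (fun s => Re lambda + s) h); last exact: ch.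
    by apply: cvgD; [exact: cvg_cst|exact: cvg_id].
  by split; [move/ct : h1|move/ct : h2]; under eq_fun do rewrite -E.
case: hF => _ /(_ 2%N)[C C0 hC].
exists (C * (1 + normc lambda) ^+ 2 * expR (r * `|Im lambda|)) => s.
apply: le_trans (hC _) _.
rewrite ImD /= addr0 [leRHS]mulrAC ler_wpM2r ?expR_ge0//.
rewrite -[leRHS]mulrA ler_wpM2l ?(ltW C0)//.
have n1 := normc_ge0 lambda; have n2 := normc_ge0 (lambda + s%:C).
rewrite ler_pdivlMr ?oneDsqr_gt0// ler_pdivrMl ?exprn_gt0 ?ltr_pwDl//.
rewrite -exprMn; apply: le_trans (oneDsqr_le_normc s 0) _.
have n3 := normc_ge0 s%:C.
have tri : normc s%:C <= normc lambda + normc (lambda + s%:C).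
  rewrite -{1}[s%:C](addKr lambda); apply: le_trans (le_normcD _ _) _.
  by rewrite normcN.
apply: lerXn2r; rewrite ?nnegrE ?mulr_ge0 ?addr_ge0//.
move: tri n1 n2 n3; rewrite -/(s%:C); nra.
Qed.

(** On the line of height [Im lambda] the factor [exp (- i lambda x)] cancels the real exponential
    of [expo], leaving a pure phase in [s - Re lambda]; translating by [Re lambda] then gives the
    right side. *)
Lemma fourier_line_kernel lambda x :
  fourier_line x 0 * dunkl_kernel 0 (- lambda) x%:C =
  complex_integral (fun s => F (lambda + s%:C) * (cos (s * x) +i* sin (s * x))).
Proof.
pose eta := Im lambda; pose xi := Re lambda.
have [C C0 hC] := fourier_line_integrand.
have cE : ccont (fun s => F (s +i* eta) * expo x (s +i* eta)).
  exact: (ccont_line eta (entireM eF (@entire_expo _ x))).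
rewrite -(fourier_line_shift x eta) mulrC -complex_integral_scale; last first.
  exact: cintegrable_oneDsqr cE (hC x eta).
pose g s := F (s +i* eta) * (cos ((s - xi) * x) +i* sin ((s - xi) * x)).
have E1 s : dunkl_kernel 0 (- lambda) x%:C * (F (s +i* eta) * expo x (s +i* eta)) = g s.
  rewrite dunkl_kernel0E expoE /= -/eta -/xi /g.
  rewrite mulrCA; congr (_ * _).
  have ee : expR (eta * x) * expR (- eta * x) = 1.
    by rewrite -expRD mulNr subrr expR0.
  rewrite mulrBl cosB sinB.
  set E := expR (eta * x) in ee *; set E' := expR (- eta * x) in ee *.
  apply: complex_eq => /=.
    rewrite -[RHS]mul1r -ee; ring.
  by rewrite -[RHS]mul1r -ee; ring.
have E2 s : F (lambda + s%:C) * (cos (s * x) +i* sin (s * x)) = g (xi + 1 * s).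
  rewrite /g mul1r [xi + s]addrC addrK; congr (F _ * _).
  by rewrite /xi /eta; case: (lambda) => a b; apply: complex_eq => /=; rewrite ?addr0// addrC.
have Eg : (fun s => dunkl_kernel 0 (- lambda) x%:C * (F (s +i* eta) * expo x (s +i* eta))) = g.
  by apply/funext.
have cg : ccont g.
  by rewrite -Eg; apply: ccontM => //; exact: ccont_cst.
have [cF [D hD]] := translated_line lambda.
have n1 t : normc (cos t +i* sin t) = 1 by rewrite /= cos2Dsin2 sqrtr1.
have g2 s : normc (g (xi + 1 * s)) <= D * (oneDsqr s)^-1.
  by rewrite -E2 Normc.normcM n1 mulr1.
have [cR cI] := cg.
have ct (h : R -> R) : continuous h -> continuous (fun s => h (xi + 1 * s)).
  move=> ch s; apply: (@continuous_comp _ _ _ (fun s => xi + 1 * s) h); last exact: ch.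
  by apply: cvgD; [exact: cvg_cst|apply: cvgM; [exact: cvg_cst|exact: cvg_id]].
have g1 s : normc (g s) <= C * expR (r * `|eta|) * (oneDsqr s)^-1.
  rewrite /g Normc.normcM n1 mulr1.
  have := hC 0 eta s; rewrite Normc.normcM normc_expo /= !mulr0 expR0 mulr1 subr0.
  by [].
have i1 := cintegrable_oneDsqr cg g1.
have i2 : cintegrable (fun s => g (xi + 1 * s)).
  by apply: cintegrable_oneDsqr g2; split; [exact: ct cR|exact: ct cI].
rewrite Eg; have -> : (fun s => F (lambda + s%:C) * (cos (s * x) +i* sin (s * x))) =
  (fun s => g (xi + 1 * s)) by apply/funext => s; exact: E2.
rewrite /complex_integral; apply: eq_Complex.
  rewrite (@Rintegral_affine _ (fun s => Re (g s)) xi 1)//; first by rewrite mul1r.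
  - by case: i1.
  - by case: i2.
rewrite (@Rintegral_affine _ (fun s => Im (g s)) xi 1)//; first by rewrite mul1r.
- by case: i1.
- by case: i2.
Qed.

(** By [fourier_line_kernel] the integrand in [x] is the Fourier integral of [s |-> F (lambda + s)].
    Integration over a symmetric segment keeps its even part, made of cosine transforms, and cosine
    inversion returns the value at [s = 0]. *)
Lemma fourier_inversion lambda :
  complex_integral (fun x => fourier_line x 0 * dunkl_kernel 0 (- lambda) x%:C *
    (dunkl_weight 0 x)%:C) = (2 * pi)%:C * F lambda.
Proof.
pose k x := fourier_line x 0 * dunkl_kernel 0 (- lambda) x%:C.
have ck : ccont k.
  apply: ccontM; first exact: smooth_csupp_ccont fourier_line_smooth.
  exact: dunkl_kernel_continuous.
have sk : csupp r k by move=> x Lx; rewrite /k fourier_line_supp// mul0r.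
have -> : (fun x => fourier_line x 0 * dunkl_kernel 0 (- lambda) x%:C * (dunkl_weight 0
  x)%:C) = k.
  by apply/funext => x; rewrite /dunkl_weight mulr0 powRr0 mulr1.
have [[cR cI] [D hD]] := translated_line lambda.
pose u s := Re (F (lambda + s%:C)); pose v s := Im (F (lambda + s%:C)).
have hu s : `|u s| <= D * (oneDsqr s)^-1 by exact: le_trans (abs_Re_le_normc _) (hD s).
have hv s : `|v s| <= D * (oneDsqr s)^-1 by exact: le_trans (abs_Im_le_normc _) (hD s).
have it (p q : R -> R) x : continuous p -> (forall s, `|p s| <= D * (oneDsqr s)^-1) ->
    continuous q -> (forall s, `|q s| <= 1) -> integrableR (fun s => p s * q (s * x)).
  move=> cp hp cq hq; apply: (@integrableR_oneDsqr _ D) => s.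
    by apply: cvgM; [exact: cp|exact: continuous_mulr_comp].
  by apply: le_trans (hp s); rewrite normrM ler_piMr.
have c1 s : `|cos s| <= 1 :> R by rewrite ler_norml cos_geN1 cos_le1.
have s1 s : `|sin s| <= 1 :> R by rewrite ler_norml sin_geN1 sin_le1.
have kR x : Re (k x) = cos_transform u x - sin_transform v x.
  rewrite /k fourier_line_kernel /= /cos_transform /sin_transform -RintegralB//.
  - by apply: eq_Rintegral => s _; rewrite ReM.
  - by apply: it => //; exact: continuous_cos.
  - by apply: it => //; exact: continuous_sin.
have kI x : Im (k x) = sin_transform u x + cos_transform v x.
  rewrite /k fourier_line_kernel /= /cos_transform /sin_transform -RintegralD//.
  - by apply: eq_Rintegral => s _; rewrite ImM.
  - by apply: it => //; exact: continuous_sin.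
  - by apply: it => //; exact: continuous_cos.
have cN (p : R -> R) x : cos_transform p (- x) = cos_transform p x.
  by apply: eq_Rintegral => s _; rewrite mulrN cosN.
have sN (p : R -> R) x : continuous p -> (forall s, `|p s| <= D * (oneDsqr s)^-1) ->
    sin_transform p (- x) = - sin_transform p x.
  move=> cp hp; rewrite -[RHS]mulN1r /sin_transform -RintegralZl//.
    by apply: eq_Rintegral => s _; rewrite mulrN sinN; ring.
  by apply: it => //; exact: continuous_sin.
have sumR x : Re (k x) + Re (k (- x)) = 2 * cos_transform u x.
  have e := kR (- x); rewrite (cN u x) (sN v x)// opprK in e.
  by rewrite (congr2 +%R (kR x) e) addrACA addNr addr0 mulr2n mulrDl mul1r.
have sumI x : Im (k x) + Im (k (- x)) = 2 * cos_transform v x.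
  have e := kI (- x); rewrite (cN v x) (sN u x)// in e.
  by rewrite (congr2 +%R (kI x) e) addrACA subrr add0r mulr2n mulrDl mul1r.
have [ckR ckI] := ck.
(* Applied to the real and to the imaginary part of [k]. The support of [w] and the relation between
   [w] and [p] also supply the continuity and the support of the cosine transform. *)
have main (p w : R -> R) : continuous p -> (forall s, `|p s| <= D * (oneDsqr s)^-1) ->
    continuous w -> supp_in r w -> (forall x, w x + w (- x) = 2 * cos_transform p x) ->
    \int[mu]_(x in `[- r, r]) w x = 2 * pi * p 0.
  move=> cp hp cw zw sw; rewrite segment_integral_fold//.
  have cE x : cos_transform p x = 2^-1 * (w x + w (- x)) by rewrite sw mulKf.
  have cc : continuous (cos_transform p).
    rewrite (_ : cos_transform p = (fun x => 2^-1 * (w x + w (- x)))); last exact/funext.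
    move=> x; apply: cvgM; first exact: cvg_cst.
    apply: cvgD; first exact: cw.
    by apply: (@continuous_comp _ _ _ -%R w); [exact: opp_continuous|exact: cw].
  under eq_Rintegral do rewrite sw.
  rewrite segment_integralZ// -mulrA; congr (_ * _).
  apply: (cosine_inversion r0 cp hp cc) => x rx.
  have x0 : `|x| = x by rewrite ger0_norm// (le_trans r0)// ltW.
  by rewrite -/(cos_transform p x) cE !zw ?normrN ?x0// addr0 mulr0.
rewrite (complex_integralE r0 ck sk).
rewrite (main u (fun x => Re (k x)))//; last by move=> x /sk ->.
rewrite (main v (fun x => Im (k x)))//; last by move=> x /sk ->.
by rewrite /u /v addr0; apply: complex_eq; rewrite ?ReMl ?ImMl.
Qed.

Lemma fourier_paley_wiener : exists2 f, smooth_csupp r f & dunkl_transform 0 f = F.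
Proof.
(* Cancels both the [2 * pi] of the inversion formula and the normalisation of the transform. *)
pose c : R := dunkl_constant 0 / (2 * pi).
have c0 := @dunkl_constant_gt0 R 0 (lexx 0).
have p0 := pi_gt0 R.
have [h1 h2 sk] := fourier_line_smooth.
exists (fun x => c%:C * fourier_line x 0).
  split.
  - move=> n; rewrite (_ : (fun x => _) = (fun x => c * Re (fourier_line x 0))).
      by apply: Ck_mul; [exact: Ck_cst|exact: h1].
    by apply/funext => x; rewrite ReMl.
  - move=> n; rewrite (_ : (fun x => _) = (fun x => c * Im (fourier_line x 0))).
      by apply: Ck_mul; [exact: Ck_cst|exact: h2].
    by apply/funext => x; rewrite ImMl.
  - by move=> x /sk ->; rewrite mulr0.
apply/funext => lambda; rewrite /dunkl_transform.
have ck : ccont (fun x => fourier_line x 0 * dunkl_kernel 0 (- lambda) x%:C * (dunkl_weight 0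
  x)%:C).
  apply: ccontM; first apply: ccontM.
  - exact: smooth_csupp_ccont fourier_line_smooth.
  - exact: dunkl_kernel_continuous.
  - by apply: ccont_real; exact: (@wt_continuous _ (2 * 0)); rewrite mulr0.
have -> : (fun x => c%:C * fourier_line x 0 * dunkl_kernel 0 (- lambda) x%:C * (dunkl_weight
  0 x)%:C) =
  (fun x => c%:C * (fourier_line x 0 * dunkl_kernel 0 (- lambda) x%:C * (dunkl_weight 0 x)%:C)).
  by apply/funext => x; rewrite -!mulrA.
rewrite (complex_integralZ _ r0 ck); last by move=> x Lx; rewrite sk// !mul0r.
rewrite fourier_inversion !mulrA -!rmorphM /=.
rewrite (_ : _ * _ * _ = 1 :> R) ?mul1r//.
by rewrite /c [_^-1 * _]mulrA mulVf ?mul1r ?mulVf// ?mulf_neq0// gt_eqF.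
Qed.

End FourierPaleyWiener.

(** * Injectivity and bijectivity of the Dunkl transform *)

Lemma dunkl_transform_inj (R : realType) (k r : R) f g : 0 <= k -> 0 <= r ->
  smooth_csupp r f -> smooth_csupp r g ->
  dunkl_transform k f = dunkl_transform k g -> f = g.
Proof.
move=> k0 r0 hf hg fg; apply: (cmom_inj k0 r0 hf hg).
have H h : smooth_csupp r h -> forall z, pser (tcoef k h) z =
    (dunkl_constant k)%:C * dunkl_transform k h z.
  move=> hh z; have [_ _ sh] := hh.
  rewrite (dunkl_transformE _ k0 r0 (smooth_csupp_ccont hh) sh) mulrA -rmorphM.
  by rewrite divff ?mul1r// gt_eqF// dunkl_constant_gt0.
have [_ _ sf] := hf; have [_ _ sg] := hg.
have E : tcoef k f =1 tcoef k g.
  apply: pser_inj => [||z]; last by rewrite !H// fg.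
    exact: entire_tcoef r0 (smooth_csupp_ccont hf) sf.
  exact: entire_tcoef r0 (smooth_csupp_ccont hg) sg.
move=> n; have := E n; rewrite /tcoef.
have g0 : ((gam k n)%:C)^-1 != 0 by rewrite invr_eq0 fmorph_eq0 gt_eqF// gam_gt0.
have i0 : (- 'i%C : R[i]) ^+ n != 0.
  by rewrite expf_neq0// oppr_eq0 eq_complex /= oner_eq0 andbF.
by move=> /(mulIf g0)/(mulfI i0).
Qed.

Theorem theorem5 (R : realType) (r k : R) (hr : 0 < r) (hk : 0 <= k) :
  set_bij (smooth_supported r) (paley_wiener_space r) (dunkl_transform k).
Proof.
have r0 := ltW hr; split.
- by move=> f /smooth_supportedP hf; exact: dunkl_transform_paley_wiener.
- move=> f g; rewrite !inE => /smooth_supportedP hf /smooth_supportedP hg.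
  exact: dunkl_transform_inj hf hg.
- move=> F hF; have [f hf <-] := fourier_paley_wiener r0 hF.
  have [g hg E] := transmutation hk r0 hf.
  exists g; [exact/smooth_supportedP|exact/funext].
Qed.
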